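(* Let $I\subset\mathbb{R}$ be an interval and let $f:I\to\mathbb{R}$ be of bounded variation. Then $Mf$ is absolutely continuous on $I$. Furthermore, $V(Mf)\le V(\overline{f})$, or equivalently, $\|DMf\|_{L^1(I)}\le |Df|(I)$. The same holds for the local maximal function: for every $R>0$, $M_Rf$ is absolutely continuous on $I$ and $V(M_Rf)\le V(\overline{f})$, or equivalently, $\|DM_Rf\|_{L^1(I)}\le |Df|(I)$.
   Context: An interval means a nondegenerate interval of $\mathbb{R}$ (open, closed or half-open, possibly of infinite length, possibly all of $\mathbb{R}$). $\lambda$ is Lebesgue measure. For $f:I\to\mathbb{R}$ and a finite set (partition) $P=\{x_1<\dots<x_L\}\subset I$, put $V(f,P)=\sum_{j=2}^L|f(x_j)-f(x_{j-1})|$ and $V(f)=\sup_P V(f,P)$; $f$ is of bounded variation if $V(f)<\infty$. $Df$ denotes the distributional derivative of $f$ and $|Df|$ its total variation measure (for $f$ of bounded variation, $Df$ is a Radon measure); if $f$ is absolutely continuous, $Df$ is a function and coincides with the a.e. pointwise derivative. The canonical representative of $f$ is $\overline{f}(x)=\limsup_{\lambda(J)\to 0,\ x\in J}\frac{1}{\lambda(J)}\int_J f(y)\,dy$, where $J$ ranges over intervals $J\subset I$ containing $x$. For locally integrable $f:I\to\mathbb{R}$, the noncentered Hardy-Littlewood maximal function is $Mf(x)=\sup_{x\in J\subset I}\frac{1}{\lambda(J)}\int_J|f(y)|\,dy$, the supremum being over intervals $J\subset I$ of finite length containing $x$. For $R>0$, the local maximal function $M_Rf$ is defined in the same way, except that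 the intervals $J$ are also required to satisfy $\lambda(J)\le R$. *)

(* Defs.v *)
From HB Require Import structures.
From mathcomp Require Import all_boot all_order all_algebra.
From mathcomp Require Import all_classical all_reals all_analysis.

Set Implicit Arguments.
Unset Strict Implicit.
Unset Printing Implicit Defensive.

Import Order.TTheory GRing.Theory Num.Theory.
Import numFieldNormedType.Exports.

Local Open Scope classical_set_scope.
Local Open Scope ring_scope.

(* A function on an interval I is a function R -> R of which only the values
   on I are used. *)

Definition nondegenerate_itv (R : realType) (J : interval R) : Prop :=
  exists x y, [/\ x \in J, y \in J & x < y].

(* The partition x_1 < ... < x_L is the strictly sorted sequence P. *)
Definition partition_variation (R : realType) (f : R -> R) (P : seq R) : R :=
  \sum_(0 <= j < (size P).-1) `|f P`_j.+1 - f P`_j|.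

Definition variation_on (R : realType) (I : interval R) (f : R -> R) : \bar R :=
  ereal_sup [set (partition_variation f P)%:E |
    P in [set P : seq R | sorted <%R P /\ all [in I] P]].

Definition abs_continuous_on (R : realType) (I : interval R) (F : R -> R) :
    Prop :=
  forall e : R, 0 < e -> exists2 d : R, 0 < d &
    forall (n : nat) (a b : 'I_n -> R),
      (forall i, [/\ a i \in I, b i \in I & a i <= b i]) ->
      trivIset setT (fun i => [set` `]a i, b i[]) ->
      \sum_(i < n) (b i - a i) < d ->
      \sum_(i < n) `|F (b i) - F (a i)| < e.

Definition averaging_intervals (R : realType) (I : interval R) (x : R) :
    set (interval R) :=
  [set J | [/\ nondegenerate_itv J, x \in J, [set` J] `<=` [set` I]
             & (lebesgue_measure [set` J] < +oo)%E]].

(* [iavg f A] is the average of |f|, not of f, over A. *)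
Definition maximal_fun (R : realType) (I : interval R) (f : R -> R) (x : R) :
    \bar R :=
  ereal_sup [set iavg f [set` J] | J in averaging_intervals I x].

Definition local_maximal_fun (R : realType) (I : interval R) (r : R) (f : R -> R)
    (x : R) : \bar R :=
  ereal_sup [set iavg f [set` J] |
    J in [set J | averaging_intervals I x J /\
                  (lebesgue_measure [set` J] <= r%:E)%E]].

Definition canonical_representative (R : realType) (I : interval R)
    (f : R -> R) (x : R) : R :=
  fine (ereal_inf [set ereal_sup
      [set ((lebesgue_measure [set` J])^-1 *
            \int[lebesgue_measure]_(y in [set` J]) (f y)%:E)%E |
        J in [set J | averaging_intervals I x J /\
                      (lebesgue_measure [set` J] < d%:E)%E]] |
    d in [set d : R | 0 < d]]).

Definition test_function (R : realType) (U : set R) (phi : R -> R) : Prop :=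
  let supp := closure [set x | phi x != 0] in
  [/\ forall (n : nat) (x : R), derivable (derive1n n phi) x 1,
      compact supp & supp `<=` U].

(* The finite signed Borel measure nu, extended by 0 outside the interior of
   I, is the distributional derivative Df: as a distribution it lives on the
   interior of I, so Df does not charge the endpoints of I. *)
Definition distributional_derivative (R : realType) (I : interval R)
    (f : R -> R) (nu : {charge set (measurableTypeR R) -> \bar R})
    (P N : set R) (nuPN : hahn_decomposition nu P N) : Prop :=
  [/\ locally_integrable [set` I]° f,
      forall A : set R, measurable A -> nu (A `&` [set` I]°) = nu A &
      forall phi, test_function [set` I]° phi ->
        (\int[lebesgue_measure]_(x in [set` I]) (f x * derive1 phi x)%:E =
         - (\int[jordan_pos nuPN]_x (phi x)%:E -
            \int[jordan_neg nuPN]_x (phi x)%:E))%E].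

(* The distributional derivative DF is the function g. *)
Definition weak_derivative (R : realType) (I : interval R) (F g : R -> R) :
    Prop :=
  [/\ locally_integrable [set` I]° F, locally_integrable [set` I]° g &
      forall phi, test_function [set` I]° phi ->
        (\int[lebesgue_measure]_(x in [set` I]) (F x * derive1 phi x)%:E =
         - \int[lebesgue_measure]_(x in [set` I]) (g x * phi x)%:E)%E].

(* Main.v *)
(* Let F be one of the maximal functions and g the canonical representative of f.
   If F x > t, some admissible interval J containing x has an average of |f| above
   t, so |g| > t somewhere in J, whereas all points with F <= t lie outside J; on
   the other hand |g| <= F. Thus in an alternating chain for F the peaks can be
   replaced by points where |g| is larger, keeping the order and the valleys, and
   V(F) <= V(|g|) <= V(g).

   If |f| does not oscillate across the level F x near x, then |f| <= F x near x,
   so intervals with an average above F x are not short, and moving them costs only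
   linearly: F is Lipschitz at x unless x is a local maximum. The Banach indicatrix
   of |f| is integrable, so this covers almost every level, and an argument of
   Banach-Zarecki type, dominated by the indicatrix of F, gives the absolute
   continuity of F.

   Finally F is a difference of two monotone functions with total variation V(F);
   their Lebesgue-Stieltjes measures are dominated by Lebesgue measure, and the
   difference of the Radon-Nikodym densities is the weak derivative of F. *)

Require Import Defs.
From HB Require Import structures.
From mathcomp Require Import all_boot all_order all_algebra.
From mathcomp Require Import all_classical all_reals all_analysis.
From mathcomp Require Import measurable_realfun ring lra.
Import Order.TTheory GRing.Theory Num.Theory.
Import numFieldNormedType.Exports.
Local Open Scope classical_set_scope.
Local Open Scope ring_scope.

Set Implicit Arguments.
Unset Strict Implicit.
Unset Printing Implicit Defensive.

(** * Variation sums *)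

(** [F] need not be Lipschitz at a local maximum, so Lipschitz bounds alone do not settle absolute
    continuity. The obstacle disappears at level crossings: if infinitely many gaps crossing a level
    [y] shrink to a point [x], continuity gives [F x = y], and each gap has an end where [F] exceeds
    [y], so [x] is not a local maximum. Absolute continuity is proved in a stronger shape: the
    variation over gaps contained in a measurable set [U] is small as soon as the measure of [U] is.
    For a finite union of intervals this yields the epsilon-delta definition, for an open
    neighbourhood of a null set it yields the domination of the Stieltjes measures. The variation of
    [f] itself may exceed the mass of [Df], because the values of [f] at its discontinuities are
    arbitrary. Sums for the canonical representative are therefore compared with sums of [f] over
    continuity points in the interior of [I], where increments of [f] are values of [Df]; only
    countably many points are lost. *)

Section gap_sums.
Context {R : realType}.
Implicit Types (g : R -> R -> R) (s t : seq R) (x y z : R).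

(** The gap weight [g] is left general: it will be the jump of a function, the crossing indicator of
    a level, or a jump counted only for gaps inside a given set. *)
Fixpoint gap_sum_from g x s : R :=
  if s is y :: s' then g x y + gap_sum_from g y s' else 0.

Definition gap_sum g s : R := if s is x :: s' then gap_sum_from g x s' else 0.

Lemma partition_variationE (f : R -> R) s :
  partition_variation f s = gap_sum (fun x y => `|f y - f x|) s.
Proof.
rewrite /partition_variation; case: s => [|x s] /=; first by rewrite big_nil.
elim: s x => [|y s IH] x /=; first by rewrite big_nil.
by rewrite big_nat_recl//= -IH.
Qed.

Lemma gap_sum_from_cat g x s y t :
  gap_sum_from g x (s ++ y :: t) =
  gap_sum_from g x (rcons s y) + gap_sum_from g y t.
Proof.
by elim: s x => [|z s IH] x /=; [rewrite addr0|rewrite IH addrA].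
Qed.

Lemma gap_sum_cat g s y t :
  gap_sum g (s ++ y :: t) = gap_sum g (rcons s y) + gap_sum_from g y t.
Proof. by case: s => [|x s] /=; [rewrite add0r|exact: gap_sum_from_cat]. Qed.

Lemma eq_gap_sum_from g g' x s :
  path <%R x s -> (forall a b, x <= a -> b <= last x s -> a < b -> g a b = g' a b) ->
  gap_sum_from g x s = gap_sum_from g' x s.
Proof.
elim: s x => [//|y s IH] x /= /andP[xy ys] H.
have yl : y <= last y s.
  by move: ys; rewrite lt_path_sortedE => /andP[/allP ys _];
    case: s ys {IH H} => [//|z s] ys; apply/ltW/ys => /=; exact: mem_last.
rewrite H// IH// => a b ya bl ab.
by apply: H => //; exact: le_trans (ltW xy) ya.
Qed.

(** Only ordered triples are required: a jump counted only for gaps inside a set satisfies this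
    inequality when [y] lies between [x] and [z], but not in general. It makes a gap sum grow under
    refinement. *)
Definition gap_subadditive g := forall x y z, x < y -> y < z ->
  g x z <= g x y + g y z.

Section monotony.
Context {g : R -> R -> R}.
Hypotheses (g0 : forall x y, 0 <= g x y) (gsub : gap_subadditive g).

Lemma gap_sum_from_ge0 x s : 0 <= gap_sum_from g x s.
Proof. by elim: s x => //= y s IH x; rewrite addr_ge0. Qed.

Lemma gap_sum_ge0 s : 0 <= gap_sum g s.
Proof. by case: s => //= x s; exact: gap_sum_from_ge0. Qed.

Lemma gap_sum_from_le x s t : path <%R x t -> subseq s t ->
  gap_sum_from g x s <= gap_sum_from g x t.
Proof.
elim: t s x => [|y t IH] s x /=; first by move=> _ /eqP ->.
case: s => [|z s] /andP[xy yt] /=.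
  by move=> _; rewrite addr_ge0// gap_sum_from_ge0.
case: eqP => [->|_] st; first by rewrite lerD2l IH.
have yz : y < z.
  move: yt; rewrite lt_path_sortedE => /andP[/allP yt _]; apply: yt.
  by apply: (mem_subseq st); rewrite inE eqxx.
by have /= := IH _ _ yt st; have := gsub xy yz; lra.
Qed.

Lemma gap_sum_le s t : sorted <%R t -> subseq s t -> gap_sum g s <= gap_sum g t.
Proof.
case: t => [|y t]; first by move=> _ /eqP ->.
case: s => [|x s] /= yt; first by rewrite gap_sum_from_ge0.
case: eqP => [->|_] st; first by rewrite gap_sum_from_le.
have xt : x \in t by apply: (mem_subseq st); rewrite inE eqxx.
have yx : y < x by move: yt; rewrite lt_path_sortedE => /andP[/allP yt _]; apply: yt.
by have /= := gap_sum_from_le yt st; have := g0 y x; lra.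
Qed.

End monotony.

Lemma sorted_subseq s t : sorted <%R s -> sorted <%R t -> {subset s <= t} ->
  subseq s t.
Proof.
move=> ss st sub; have -> : s = [seq x <- t | x \in s].
  apply: lt_sorted_eq => //; first by apply: sorted_filter => //; exact: lt_trans.
  by move=> x; rewrite mem_filter; apply/idP/andP => [xs|[]//]; split; rewrite ?sub.
exact: filter_subseq.
Qed.

Definition strict_sort s : seq R := sort <=%R (undup s).

Lemma strict_sort_sorted s : sorted <%R (strict_sort s).
Proof.
by rewrite lt_sorted_uniq_le sort_uniq undup_uniq sort_sorted//; exact: le_total.
Qed.

Lemma mem_strict_sort s : strict_sort s =i s.
Proof. by move=> x; rewrite mem_sort mem_undup. Qed.

End gap_sums.

(** * The variation function of a subadditive gap weight *)

Section control.
Context {R : realType}.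
Variables (g : R -> R -> R) (D : set R) (M : R).
Hypotheses (g0 : forall x y, 0 <= g x y) (gsub : gap_subadditive g).
Hypothesis gM : forall s, sorted <%R s -> {in s, forall y, D y} -> gap_sum g s <= M.

Definition control_fun (x : R) : R :=
  sup [set gap_sum g s | s in [set s | sorted <%R s /\
    {in s, forall y, D y /\ y <= x}]].

Lemma control_fun_ge x s : sorted <%R s -> {in s, forall y, D y /\ y <= x} ->
  gap_sum g s <= control_fun x.
Proof.
move=> ss sx; apply: ub_le_sup; last by exists s.
by exists M => _ [t [st tx] <-]; apply: gM => // y /tx[].
Qed.

Lemma control_fun_le_ub x B :
  (forall s, sorted <%R s -> {in s, forall y, D y /\ y <= x} -> gap_sum g s <= B) ->
  control_fun x <= B.
Proof.
move=> H; apply: ge_sup; first by exists (gap_sum g [::]), [::]; split.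
by move=> _ [s [ss sx] <-]; exact: H.
Qed.

Lemma control_fun_ge0 x : 0 <= control_fun x.
Proof. by rewrite -[0]/(gap_sum g [::]); apply: control_fun_ge. Qed.

Lemma control_fun_le x : control_fun x <= M.
Proof. by apply: control_fun_le_ub => s ss sx; apply: gM => // y /sx[]. Qed.

Lemma control_fun_nd : {homo control_fun : x y / x <= y}.
Proof.
move=> x y xy; apply: control_fun_le_ub => s ss sx; apply: control_fun_ge => //.
by move=> z /sx[Dz zx]; split=> //; exact: le_trans xy.
Qed.

(** A partition of points up to [x] may be ended at [x] without decreasing its sum, after which any
    partition starting at [x] continues it. *)
Lemma control_fun_cat x y t : D x -> x <= y -> path <%R x t ->
  {in t, forall z, D z /\ z <= y} ->
  control_fun x + gap_sum_from g x t <= control_fun y.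
Proof.
move=> Dx xy xt ty; rewrite -lerBrDr; apply: control_fun_le_ub => s ss sx.
rewrite lerBrDr; set s' := [seq z <- s | z < x].
have s's : sorted <%R (rcons s' x).
  rewrite -cats1 (sorted_pairwise lt_trans) pairwise_cat/= andbT.
  rewrite -(sorted_pairwise lt_trans) sorted_filter//; last exact: lt_trans.
  by rewrite andbT; apply/allrelP => z w; rewrite mem_filter inE => /andP[zx _] /eqP ->.
have s'xt : sorted <%R (s' ++ x :: t).
  move: s's; rewrite -cat_rcons !(sorted_pairwise lt_trans) pairwise_cat => ->.
  move: xt; rewrite lt_path_sortedE => /andP[/allP xt st] /=.
  rewrite -(sorted_pairwise lt_trans) st andbT; apply/allrelP => z w.
  rewrite mem_rcons inE mem_filter => /orP[/eqP -> /xt//|/andP[zx _] /xt].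
  exact: lt_trans.
have ss' : gap_sum g s <= gap_sum g (rcons s' x).
  apply: gap_sum_le => //; apply: sorted_subseq => // z zs.
  rewrite mem_rcons inE mem_filter zs andbT.
  by have [_] := sx _ zs; rewrite le_eqVlt.
rewrite (le_trans (lerD ss' (lexx _)))// -gap_sum_cat; apply: control_fun_ge => //.
move=> z; rewrite mem_cat mem_filter inE => /or3P[/andP[zx zs]|/eqP ->//|/ty//].
by have [Dz _] := sx _ zs; split=> //; rewrite (le_trans (ltW zx)).
Qed.

Lemma control_fun_step x y : D x -> D y -> x < y ->
  control_fun x + g x y <= control_fun y.
Proof.
move=> Dx Dy xy.
have /= := @control_fun_cat x y [:: y] Dx (ltW xy); rewrite xy/= addr0; apply => //.
by move=> z; rewrite inE => /eqP ->.
Qed.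

(** Inserting [x] into a partition up to [y] does not decrease its sum and cuts it into a part
    ending at [x] and a part starting there. *)
Lemma control_fun_split x y B : D x -> x <= y ->
  (forall t, path <%R x t -> {in t, forall z, D z /\ z <= y} ->
     gap_sum_from g x t <= B) ->
  control_fun y <= control_fun x + B.
Proof.
move=> Dx xy H; apply: control_fun_le_ub => s ss sy.
set s' := [seq z <- s | z < x]; set t := [seq z <- s | x < z].
have xt : path <%R x t.
  rewrite lt_path_sortedE sorted_filter//; last exact: lt_trans.
  by rewrite andbT; apply/allP => z; rewrite mem_filter => /andP[].
have s'xt : sorted <%R (s' ++ x :: t).
  rewrite (sorted_pairwise lt_trans) pairwise_cat -!(sorted_pairwise lt_trans).
  rewrite sorted_filter//=; last exact: lt_trans.
  rewrite xt andbT; apply/allrelP => z w; rewrite mem_filter inE => /andP[zx _].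
  by case/orP=> [/eqP -> //|]; rewrite mem_filter => /andP[xw _]; exact: lt_trans xw.
have ss' : gap_sum g s <= gap_sum g (s' ++ x :: t).
  apply: gap_sum_le => //; apply: sorted_subseq => // z zs.
  rewrite mem_cat inE !mem_filter zs !andbT.
  by case: (ltgtP z x).
rewrite (le_trans ss')// gap_sum_cat lerD//.
- apply: control_fun_ge.
    by move: s'xt; rewrite -cat_rcons => /cat_sorted2[].
  move=> z; rewrite mem_rcons inE mem_filter => /orP[/eqP ->//|/andP[zx zs]].
  by split; [case: (sy _ zs)|exact: ltW].
- by apply: H => // z; rewrite mem_filter => /andP[_ /sy].
Qed.

End control.

(** * Comparing variations through alternating chains *)

Section variation_comparison.
Context {R : realType}.
Implicit Types (F : R -> R) (s t : seq R).

Definition jump F (x y : R) : R := `|F y - F x|.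

Lemma jump_ge0 F x y : 0 <= jump F x y. Proof. exact: normr_ge0. Qed.

Lemma jump_subadditive F : gap_subadditive (jump F).
Proof. by move=> x y z _ _; rewrite /jump -(subrKA (F y)) addrC ler_normD. Qed.

Lemma jump_lt F x y : F x < F y -> jump F x y = F y - F x.
Proof. by move=> xy; rewrite /jump gtr0_norm// subr_gt0. Qed.

Lemma jump_gt F x y : F y < F x -> jump F x y = F x - F y.
Proof. by move=> xy; rewrite /jump ltr0_norm ?subr_lt0// opprB. Qed.

Lemma jump_geB F x y : F y - F x <= jump F x y.
Proof. exact: ler_norm. Qed.

Lemma jump_geBC F x y : F x - F y <= jump F x y.
Proof. by rewrite /jump distrC ler_norm. Qed.

Fixpoint alternating F (b : bool) x s : bool :=
  if s is y :: s' then (if b then F x < F y else F y < F x) && alternating F (~~ b) y s'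
  else true.

Lemma alternating_subseq F x s : path <%R x s ->
  exists b s', [/\ path <%R x s', subseq s' s, alternating F b x s' &
    gap_sum_from (jump F) x s' = gap_sum_from (jump F) x s].
Proof.
elim: s x => [|y s IH] x /=; first by move=> _; exists true, [::].
move=> /andP[xy] /[dup] ys /IH[b1 [s1 [ys1 s1s alt1 <-]]].
have xs1 : path <%R x s1.
  by case: s1 ys1 {s1s alt1} => //= z s1 /andP[yz ->]; rewrite (lt_trans xy yz).
have s1ys : subseq s1 (y :: s) by exact: subseq_trans s1s (subseq_cons _ _).
have ys1ys : subseq (y :: s1) (y :: s) by rewrite /= eqxx.
have pxy : path <%R x (y :: s1) by rewrite /= xy.
case: (ltgtP (F x) (F y)) => Fxy.
- case: s1 b1 alt1 ys1 s1s xs1 s1ys ys1ys pxy => [|z s1] b1 /= alt1 ys1 s1s xs1 s1ys ys1ys pxy.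
    by exists true, [:: y]; rewrite /= Fxy; split.
  case: b1 alt1 => /andP[Fyz alt1]; last first.
    by exists true, [:: y, z & s1]; rewrite /= Fxy Fyz; split.
  exists true, (z :: s1); split => //=; first by rewrite (lt_trans Fxy Fyz).
  by rewrite !jump_lt ?(lt_trans Fxy Fyz)//; lra.
- case: s1 b1 alt1 ys1 s1s xs1 s1ys ys1ys pxy => [|z s1] b1 /= alt1 ys1 s1s xs1 s1ys ys1ys pxy.
    by exists false, [:: y]; rewrite /= Fxy; split.
  case: b1 alt1 => /andP[Fyz alt1].
    by exists false, [:: y, z & s1]; rewrite /= Fxy Fyz; split.
  exists false, (z :: s1); split => //=; first by rewrite (lt_trans Fyz Fxy).
  by rewrite !jump_gt ?(lt_trans Fyz Fxy)//; lra.
- exists b1, s1; split => //.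
    by case: s1 alt1 {ys1 s1s xs1 s1ys ys1ys pxy} => //= z s1; rewrite Fxy.
  rewrite /jump Fxy subrr normr0 add0r.
  by case: s1 {alt1 ys1 s1s xs1 s1ys ys1ys pxy} => //= z s1; rewrite Fxy.
Qed.

Variables (F G : R -> R) (D E : set R) (B : R).
(** The two hypotheses differ because an averaging interval need not be short: a value of [G] above
    [t] may be found far from [x], and it is only known not to pass beyond given points where
    [F <= t]. A low value is available arbitrarily close to [x]. *)
Hypothesis peak : forall x (t : R) (ws : seq R), D x -> t < F x ->
  {in ws, forall w, D w /\ F w <= t} ->
  exists z, [/\ E z, t < G z & {in ws, forall w, (w < x -> w < z) /\ (x < w -> z < w)}].
Hypothesis valley : forall x (t e : R), D x -> F x < t -> 0 < e ->
  exists z, [/\ E z, G z < t & `|z - x| < e].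
Hypothesis GB : forall s, sorted <%R s -> {in s, forall y, E y} ->
  gap_sum (jump G) s <= B.

(* Peaks are moved first, then each valley is moved by less than its distance
   to the two neighbouring peaks, so that the order is kept. *)
Let from_valley (e l x : R) s : 0 < e -> l < x -> D x -> path <%R x s ->
  {in s, forall y, D y} -> alternating F true x s ->
  exists z t, [/\ path <%R l (z :: t), {in z :: t, forall y, E y}, G z < F x + e &
    gap_sum_from (jump F) x s <= gap_sum_from (jump G) z t + e *+ (2 * size s)].
Proof.
move=> e0; have [n] := ubnP (size s); elim: n s l x => // n IH [|y [|z s]] l x /= sn lx Dx.
- move=> _ _ _.
  have [||z [Ez Gz]] := @valley x (F x + e) (x - l) Dx; [lra|lra|rewrite ltr_distl => /andP[zx _]].
  exists z, [::]; split => //=; [by rewrite andbT; lra|by move=> w; rewrite inE => /eqP ->|].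
  by rewrite muln0 addr0.
- rewrite !andbT => xy Ds Fxy.
  have Dy : D y by apply: Ds; rewrite inE.
  have [||u [Eu Gu /(_ x)]] := @peak y (Num.max (F x) (F y - e)) [:: x] Dy.
  + by rewrite gt_max; apply/andP; split; lra.
  + by move=> w; rewrite inE => /eqP ->; split; rewrite // le_max lexx.
  rewrite inE eqxx => /(_ isT)[/(_ xy) xu _].
  move: Gu; rewrite gt_max => /andP[Gu1 Gu2].
  have [||v [Ev Gv]] := @valley x (F x + e) (Num.min (x - l) (u - x)) Dx; first by lra.
    by rewrite lt_min; apply/andP; split; lra.
  rewrite lt_min !ltr_distl => /andP[v1 v2].
  exists v, [:: u]; split => //=; [|by move=> w; rewrite !inE => /orP[] /eqP ->|].
  + by rewrite andbT; apply/andP; split; lra.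
  + rewrite !addr0 jump_lt// mulr2n.
    by have := jump_geB G v u; lra.
- move=> /and3P[xy yz zs] Ds /and3P[Fxy Fyz alt].
  have Dy : D y by apply: Ds; rewrite inE eqxx.
  have Dz : D z by apply: Ds; rewrite !inE eqxx orbT.
  (* The maximum with [F x] and [F z] makes both neighbours low points for [peak], and [F y - e]
     limits the loss at the peak to [e]. *)
  have [||u [Eu Gu wu]] :=
    @peak y (Num.max (Num.max (F x) (F z)) (F y - e)) [:: x; z] Dy.
  + by rewrite !gt_max Fxy Fyz; lra.
  + by move=> w; rewrite !inE => /orP[] /eqP ->; split; rewrite // !le_max lexx ?orbT.
  have xu : x < u by have [|+ _] := wu x; [rewrite inE eqxx|apply].
  have uz : u < z by have [|_] := wu z; [rewrite !inE eqxx orbT|apply].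
  move: Gu; rewrite !gt_max => /andP[/andP[Gu1 Gu2] Gu3].
  have [||v [Ev Gv]] := @valley x (F x + e) (Num.min (x - l) (u - x)) Dx; first by lra.
    by rewrite lt_min; apply/andP; split; lra.
  rewrite lt_min !ltr_distl => /andP[v1 v2].
  have [||z' [t [uz't Ez' Gz' HIH]]] := IH s u z _ uz Dz zs _ alt.
  + by rewrite -ltnS (ltn_trans _ sn).
  + by move=> w ws; apply: Ds; rewrite !inE ws !orbT.
  exists v, [:: u, z' & t]; split => //.
  + by move: uz't => /= ->; rewrite andbT; apply/andP; split; lra.
  + by move=> w; rewrite inE => /orP[/eqP ->//|]; rewrite inE => /orP[/eqP ->//|/Ez'].
  + rewrite /= (jump_lt Fxy) (jump_gt Fyz).
    (* Two jumps, each losing at most [e] at its peak and [e] at its valley. *)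
    rewrite (_ : (2 * (size s).+2 = 2 * size s + 4)%N); last by rewrite -(addn2 (size s)) mulnDr.
    rewrite mulrnDr -[e *+ 4]/(e + (e + (e + e))).
    by have := jump_geB G v u; have := jump_geBC G u z'; lra.
Qed.

Lemma variation_comparison s : sorted <%R s -> {in s, forall y, D y} ->
  gap_sum (jump F) s <= B.
Proof.
have B0 : 0 <= B by apply: (GB (s := [::])).
case: s => [//|x s] /= xs Ds; have Dx : D x by apply: Ds; rewrite inE eqxx.
have [b [s' [xs' s's alt <-]]] := alternating_subseq F xs.
have {s's} Ds' : {in s', forall y, D y}.
  by move=> w /(mem_subseq s's) ws; apply: Ds; rewrite inE ws orbT.
apply/ler_addgt0Pr => d d0.
have [e e0 ed] : exists2 e : R, 0 < e & e *+ (2 * size s').+2 <= d.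
  by exists (d / (2 * size s').+2%:R); rewrite ?divr_gt0// -[leLHS]mulr_natr divfK.
case: b alt => alt.
  have [|z [t [zt Et _ H]]] := from_valley e0 (l := x - 1) _ Dx xs' Ds' alt; first by lra.
  have := GB (path_sorted zt) Et; rewrite /= => HB.
  by move: ed; rewrite !mulrS; lra.
(* The chain starts with a peak. Its new place [u] serves as the left bound for the valleys that
   remain. *)
case: s' alt xs' Ds' ed => [|y s'] alt /= xs' Ds' ed.
  by rewrite addr_ge0// ltW.
move: alt => /= /andP[Fyx alt].
have Dy : D y by apply: Ds'; rewrite inE eqxx.
move: xs' => /andP[xy ys'].
have [||u [Eu Gu /(_ y)]] := @peak x (Num.max (F y) (F x - e)) [:: y] Dx.
- by rewrite gt_max; apply/andP; split; lra.
- by move=> w; rewrite inE => /eqP ->; split; rewrite // le_max lexx.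
rewrite inE eqxx => /(_ isT)[_ /(_ xy) uy].
move: Gu; rewrite gt_max => /andP[Gu1 Gu2].
have [|z [t [zt Et Gz H]]] := from_valley e0 uy Dy ys' _ alt.
  by move=> w ws; apply: Ds'; rewrite inE ws orbT.
have := GB (s := [:: u, z & t]) zt _ => /= HB.
have {}HB : jump G u z + gap_sum_from (jump G) z t <= B.
  by apply: HB => w; rewrite inE => /orP[/eqP ->//|/Et].
have := jump_geBC G u z; rewrite (jump_gt Fyx).
move: ed; rewrite (_ : (2 * (size s').+1).+2 = (2 * size s' + 4)%N); last first.
  by rewrite -(addn1 (size s')) mulnDr -addn2 -addnA.
rewrite mulrnDr -[e *+ 4]/(e + (e + (e + e))) => ed.
by move: HB; lra.
Qed.

End variation_comparison.

(** * Regularity of maximal functions *)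

(** The indicator of a superlevel set: [jump (above u y) a b] is 1 when the level [y] separates
    [u a] from [u b] and 0 otherwise, so gap sums of it count level crossings. *)
Definition above (R : realType) (u : R -> R) (y x : R) : R := ((y < u x)%R)%:R.

(** A bounded monotone function has one-sided limits at [x], so its increments are small on either
    side. The point [x] itself is excluded, as [w] may jump there. *)
Lemma nondecreasing_small_increments (R : realType) (w : R -> R) (M : R) :
  {homo w : x y / x <= y} -> (forall x, 0 <= w x <= M) ->
  forall x e : R, 0 < e -> exists2 d : R, 0 < d & forall p q, p <= q ->
    (x < p /\ q < x + d) \/ (x - d < p /\ q < x) -> w q - w p < e.
Proof.
move=> wnd wM x e e0.
have [d1 d10 H1] : exists2 d : R, 0 < d &
    forall p q, x < p -> p <= q -> q < x + d -> w q - w p < e.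
  have ne : [set w q | q in [set q | x < q]] !=set0.
    by exists (w (x + 1)), (x + 1) => //=; lra.
  have lb : has_lbound [set w q | q in [set q | x < q]].
    by exists 0 => _ [q _ <-]; have /andP[] := wM q.
  have [_ [q /= xq <-] wq] := inf_adherent e0 (conj ne lb).
  exists (q - x); first lra.
  move=> p q' xp pq' q'q; have : inf [set w q | q in [set q | x < q]] <= w p.
    by apply: ge_inf => //; exists p.
  have : w q' <= w q by apply: wnd; lra.
  lra.
have [d2 d20 H2] : exists2 d : R, 0 < d &
    forall p q, q < x -> p <= q -> x - d < p -> w q - w p < e.
  have ne : [set w q | q in [set q | q < x]] !=set0.
    by exists (w (x - 1)), (x - 1) => //=; lra.
  have ub : has_ubound [set w q | q in [set q | q < x]].
    by exists M => _ [q _ <-]; have /andP[] := wM q.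
  have [_ [q /= xq <-] wq] := sup_adherent e0 (conj ne ub).
  exists (x - q); first lra.
  move=> p q' xp pq' q'q; have : w q' <= sup [set w q | q in [set q | q < x]].
    by apply: ub_le_sup => //; exists q'.
  have : w q <= w p by apply: wnd; lra.
  lra.
exists (Num.min d1 d2); first by rewrite lt_min d10.
move=> p q pq [[xp qx]|[xp qx]]; [apply: H1|apply: H2] => //.
  by rewrite (lt_le_trans qx)// lerD2l ge_min lexx.
by rewrite (le_lt_trans _ xp)// lerD2l lerN2 ge_min lexx orbT.
Qed.

(* [S a b] stands for the integral of [|f|] over [a, b], and [F] for the maximal
   function, restricted to intervals whose length satisfies [adm]. *)
Section maximal_regularity.
Context {R : realType}.
Variables (I : set R) (S : R -> R -> R) (C r0 : R) (adm : R -> Prop) (F : R -> R).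
Hypothesis I_itv : is_interval I.
Hypothesis SD : forall a b c, I a -> I c -> a <= b -> b <= c -> S a c = S a b + S b c.
Hypothesis S_bounds : forall a b, I a -> I b -> a <= b -> 0 <= S a b <= C * (b - a).
Hypothesis r0_gt0 : 0 < r0.
Hypothesis adm_small : forall l, l <= r0 -> adm l.
Hypothesis average_leF : forall a b x, I a -> I b -> a < b -> adm (b - a) ->
  a <= x <= b -> S a b <= F x * (b - a).
Hypothesis F_ltP : forall x t, I x -> t < F x -> exists a b,
  [/\ I a, I b, a < b, adm (b - a) & a <= x <= b] /\ t * (b - a) < S a b.

Let between a b x : I a -> I b -> a <= x -> x <= b -> I x.
Proof. by move=> Ia Ib ax xb; apply: (I_itv Ia Ib); rewrite ax. Qed.

Let C_ge0 a b : I a -> I b -> a < b -> 0 <= C.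
Proof.
move=> Ia Ib ab; have /andP[S0 SC] := S_bounds Ia Ib (ltW ab).
by rewrite -(pmulr_lge0 _ (_ : 0 < b - a)) ?(le_trans S0)//; lra.
Qed.

(* Translate the interval, keeping its length, until it contains [z]. *)
Lemma maximal_shift a b z d : I a -> I b -> a < b -> adm (b - a) -> I z ->
  a - d <= z <= b + d -> 0 <= d -> S a b - F z * (b - a) <= C * d.
Proof.
move=> Ia Ib ab ab_adm Iz /andP[az zb] d0; have C0 := C_ge0 Ia Ib ab.
have Cd0 : 0 <= C * d by exact: mulr_ge0.
have [za|az'] := ltP z a.
- have Iw : I (z + (b - a)) by apply: (between Iz Ib); lra.
  have := @average_leF z (z + (b - a)) z Iz Iw.
  rewrite addrAC subrr add0r lexx /= => /(_ _ ab_adm) H.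
  have {}H : S z (z + (b - a)) <= F z * (b - a) by apply: H; lra.
  have Cz : C * (a - z) <= C * d by rewrite ler_wpM2l//; lra.
  have [aw|wa] := leP a (z + (b - a)).
  + have E1 := SD Iz Iw (ltW za) aw.
    have E2 : S a b = S a (z + (b - a)) + S (z + (b - a)) b by apply: SD => //; lra.
    have /andP[B1 _] := S_bounds Iz Ia (ltW za).
    have : z + (b - a) <= b by lra.
    by move=> /(S_bounds Iw Ib)/andP[_]; lra.
  + have /andP[B1 _] : 0 <= S z (z + (b - a)) <= C * (z + (b - a) - z).
      by apply: S_bounds => //; lra.
    have /andP[_ B2] := S_bounds Ia Ib (ltW ab).
    have : C * (b - a) <= C * (a - z) by rewrite ler_wpM2l//; lra.
    lra.
- have [bz|zb'] := ltP b z; last first.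
    by have := average_leF Ia Ib ab ab_adm (_ : a <= z <= b); rewrite az' zb'; lra.
  have Iw : I (z - (b - a)) by apply: (between Ia Iz); lra.
  have := @average_leF (z - (b - a)) z z Iw Iz.
  rewrite subKr lexx andbT => H.
  have {}H : S (z - (b - a)) z <= F z * (b - a) by apply: H => //; lra.
  have Cz : C * (z - b) <= C * d by rewrite ler_wpM2l//; lra.
  have [wb|bw] := leP (z - (b - a)) b.
  + have E1 := SD Iw Iz wb (ltW bz).
    have E2 : S a b = S a (z - (b - a)) + S (z - (b - a)) b by apply: SD => //; lra.
    have /andP[B1 _] := S_bounds Ib Iz (ltW bz).
    have : a <= z - (b - a) by lra.
    by move=> /(S_bounds Ia Iw)/andP[_]; lra.
  + have /andP[B1 _] : 0 <= S (z - (b - a)) z <= C * (z - (z - (b - a))).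
      by apply: S_bounds => //; lra.
    have /andP[_ B2] := S_bounds Ia Ib (ltW ab).
    have : C * (b - a) <= C * (z - b) by rewrite ler_wpM2l//; lra.
    lra.
Qed.

(** When [S] integrates [|f|], this expresses that [|f| <= t] almost everywhere on [I] within
    distance [e] of [x]. *)
Definition locally_le x e (t : R) := forall c d, I c -> I d -> c <= d ->
  x - e <= c -> d <= x + e -> S c d <= t * (d - c).

(** An interval through [b] shorter than [e / 2] stays within [e] of [x], where averages are at most
    [t]. An interval with a larger average thus has length at least [e / 2]; shifting it to [x]
    changes the integral by at most [C] times the distance, hence the factor [2 * C / e] for the
    average. *)
Lemma maximal_upper x t (e : R) b : I x -> F x <= t -> 0 < e -> locally_le x e t ->
  I b -> `|b - x| <= e / 2 -> F b <= t + 2 * C / e * `|b - x|.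
Proof.
move=> Ix Fxt e0 H Ib bx; rewrite leNgt; apply/negP => Fb.
have [a [d [[Ia Id ad ad_adm /andP[ab bd]] Sad]]] := F_ltP Ib Fb.
have C0 := C_ge0 Ia Id ad.
have L0 : 0 <= 2 * C / e * `|b - x|.
  by rewrite mulr_ge0// divr_ge0 ?(ltW e0)// mulr_ge0.
have long : e / 2 <= d - a.
  rewrite leNgt; apply/negP => short.
  have : S a d <= t * (d - a).
    by apply: H => //; [lra|move: bx; rewrite ler_distl => /andP[]; lra..].
  have : t * (d - a) <= (t + 2 * C / e * `|b - x|) * (d - a).
    by rewrite ler_wpM2r; lra.
  lra.
have := @maximal_shift a d x `|b - x| Ia Id ad ad_adm Ix.
have -> : a - `|b - x| <= x <= d + `|b - x|.
  by have := ler_norm (b - x); have := ler_norm (x - b); rewrite distrC; lra.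
move=> /(_ isT (normr_ge0 _)) H2.
have : F x * (d - a) <= t * (d - a) by rewrite ler_wpM2r; lra.
have : 2 * C / e * `|b - x| * (e / 2) <= 2 * C / e * `|b - x| * (d - a).
  by rewrite ler_wpM2l.
have -> : 2 * C / e * `|b - x| * (e / 2) = C * `|b - x|.
  by field; rewrite gt_eqF.
lra.
Qed.

(** As [x] is not a local maximum, some [z] close to [x] has an interval with an average above
    [F x]. Such an interval has length at least [e / 2], so shifting it to [b] lowers the average
    only linearly in the distance; [z] may be taken as close to [x] as desired. *)
Lemma maximal_lower x (e : R) b : I x -> 0 < e -> locally_le x e (F x) ->
  (forall d : R, 0 < d -> exists2 z, I z & `|z - x| < d /\ F x < F z) ->
  I b -> F x <= F b + 2 * C / e * `|b - x|.
Proof.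
move=> Ix e0 H near Ib; rewrite leNgt; apply/negP => Fb.
set L := 2 * C / e.
have D0 : 0 <= `|b - x| by []; set D : R := `|b - x| in D0 *; pose k := F x - F b - L * D.
have k0 : 0 < k by rewrite /k /L /D; lra.
have [z0 Iz0 [z0x Fz0]] := near _ e0.
have C0 : 0 <= C.
  by have [a [d [[Ia Id ad _ _] _]]] := F_ltP Iz0 Fz0; exact: C_ge0 Ia Id ad.
have L0 : 0 <= L by rewrite divr_ge0 ?(ltW e0)// mulr_ge0.
(* The bound [e / 2] keeps short intervals through [z] within [e] of [x]; the other one makes the
   detour from [x] to [z] cost less than the slack [k]. *)
have [z Iz [zx Fz]] : exists2 z, I z &
    `|z - x| < Num.min (e / 2) (k / (L + 1)) /\ F x < F z.
  by apply: near; rewrite lt_min !divr_gt0//; lra.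
move: zx; rewrite lt_min => /andP[zx1 zx2].
have [a [d [[Ia Id ad ad_adm /andP[az zd]] Sad]]] := F_ltP Iz Fz.
have long : e / 2 <= d - a.
  rewrite leNgt; apply/negP => short.
  have : S a d <= F x * (d - a).
    by apply: H => //; [lra|move: zx1; rewrite ltr_distl => /andP[]; lra..].
  lra.
have zb : `|z - b| <= D + `|z - x|.
  have -> : z - b = (x - b) + (z - x) by ring.
  by rewrite /D (distrC b) ler_normD.
have := @maximal_shift a d b `|z - b| Ia Id ad ad_adm Ib.
have -> : a - `|z - b| <= b <= d + `|z - b|.
  by have := ler_norm (b - z); have := ler_norm (z - b); rewrite distrC; lra.
move=> /(_ isT (normr_ge0 _)) H2.
have Ck : C * `|z - b| <= C * (D + `|z - x|) by rewrite ler_wpM2l.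
have CL : C = L * (e / 2) by rewrite /L; field; rewrite gt_eqF.
have LD : L * (D + `|z - x|) < F x - F b.
  have : L * `|z - x| <= (L + 1) * `|z - x| by rewrite ler_wpM2r//; lra.
  move: zx2; rewrite ltr_pdivlMr; last lra.
  by rewrite mulrC => A1 A2; have := le_lt_trans A2 A1; rewrite mulrDr /k; lra.
have : L * (D + `|z - x|) * (e / 2) < (F x - F b) * (e / 2).
  by rewrite ltr_pM2r//; lra.
have : (F x - F b) * (e / 2) <= (F x - F b) * (d - a).
  rewrite ler_wpM2l//; apply: ltW; apply: le_lt_trans LD.
  by apply: mulr_ge0 => //; apply: addr_ge0.
have : C * (D + `|z - x|) = L * (D + `|z - x|) * (e / 2) by rewrite {1}CL mulrAC.
lra.
Qed.

(** * Local bounds from the oscillation of [h] on a set that determines averages *)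

Section oscillation.
Variables (h : R -> R) (D : set R).
Hypothesis S_le : forall a b t, I a -> I b -> a < b ->
  (forall q, D q -> a < q < b -> h q <= t) -> S a b <= t * (b - a).
Hypothesis S_ge : forall a b t, I a -> I b -> a < b ->
  (forall q, D q -> a < q < b -> t <= h q) -> t * (b - a) <= S a b.
Hypothesis D_sub : D `<=` I.

Let Sxx a : I a -> S a a = 0.
Proof. by move=> Ia; have /andP[] := S_bounds Ia Ia (lexx a); lra. Qed.

Let S_le' a b t : I a -> I b -> a <= b ->
  (forall q, D q -> a < q < b -> h q <= t) -> S a b <= t * (b - a).
Proof.
move=> Ia Ib; rewrite le_eqVlt => /predU1P[<- _|]; last exact: S_le.
by rewrite Sxx// subrr mulr0.
Qed.

Let S_ge' a b t : I a -> I b -> a <= b ->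
  (forall q, D q -> a < q < b -> t <= h q) -> t * (b - a) <= S a b.
Proof.
move=> Ia Ib; rewrite le_eqVlt => /predU1P[<- _|]; last exact: S_ge.
by rewrite Sxx// subrr mulr0.
Qed.

Let average_leF' a b x : I a -> I b -> a <= b -> a <= x <= b -> adm (b - a) ->
  S a b <= F x * (b - a).
Proof.
move=> Ia Ib; rewrite le_eqVlt => /predU1P[<- _ _|ab axb ad]; last exact: average_leF.
by rewrite Sxx// subrr mulr0.
Qed.

Lemma locally_le_sides x e t : I x ->
  (forall c d, I c -> I d -> x <= c -> c <= d -> d <= x + e -> S c d <= t * (d - c)) ->
  (forall c d, I c -> I d -> x - e <= c -> c <= d -> d <= x -> S c d <= t * (d - c)) ->
  locally_le x e t.
Proof.
move=> Ix right left c d Ic Id cd ec de.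
have [xc|cx] := leP x c; first exact: right.
have [dx|xd] := leP d x; first exact: left.
have -> : t * (d - c) = t * (x - c) + t * (d - x) by lra.
rewrite (SD Ic Id (ltW cx) (ltW xd)) lerD//; [apply: left|apply: right] => //; lra.
Qed.

(** On each side of [x], and close to it, [h] varies by less than [e / 2]. If [h q > F x + e] there,
    then [h] exceeds [F x + e / 2] between [x] and [q], and the average over that interval, short
    enough to be admissible, exceeds [F x]. *)
Lemma maximal_dominates x (w : R -> R) (M e : R) :
  (forall p q, D p -> D q -> p < q -> `|h q - h p| <= w q - w p) ->
  {homo w : x y / x <= y} -> (forall x, 0 <= w x <= M) ->
  I x -> 0 < e -> exists2 d, 0 < d & locally_le x d (F x + e).
Proof.
move=> hw wnd wM Ix e0; have e20 : 0 < e / 2 by lra.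
have [d1 d10 H1] := nondecreasing_small_increments wnd wM x e20.
pose d := Num.min d1 r0; have d0 : 0 < d by rewrite lt_min d10.
have dd1 : d <= d1 by rewrite ge_min lexx.
have dr0 : d <= r0 by rewrite ge_min lexx orbT.
exists (d / 2); first lra.
apply: locally_le_sides => // c b Ic Ib.
- move=> xc cb bx; apply: S_le' => // q Dq /andP[cq qb].
  rewrite leNgt; apply/negP => hq.
  have xq : x < q by lra.
  have : (F x + e / 2) * (q - x) <= S x q.
    apply: S_ge' => //; [exact: D_sub|exact: ltW|] => p Dp /andP[xp pq].
    have := hw _ _ Dp Dq pq; have := ler_norm (h q - h p).
    by have := H1 _ _ (ltW pq) (or_introl (conj xp _)); lra.
  have : S x q <= F x * (q - x).
    by apply: average_leF => //; [exact: D_sub|apply: adm_small; lra|rewrite lexx ltW].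
  have : 0 < e / 2 * (q - x) by rewrite mulr_gt0//; lra.
  lra.
- move=> xc cb bx; apply: S_le' => // q Dq /andP[cq qb].
  rewrite leNgt; apply/negP => hq.
  have qx : q < x by lra.
  have : (F x + e / 2) * (x - q) <= S q x.
    apply: S_ge' => //; [exact: D_sub|exact: ltW|] => p Dp /andP[qp px].
    have := hw _ _ Dq Dp qp; have := ler_norm (h q - h p); rewrite distrC.
    by have := H1 _ _ (ltW qp) (or_intror (conj _ px)); lra.
  have : S q x <= F x * (x - q).
    by apply: average_leF => //; [exact: D_sub|apply: adm_small; lra|rewrite lexx ltW].
  have : 0 < e / 2 * (x - q) by rewrite mulr_gt0//; lra.
  lra.
Qed.

(* If the level [F x] is crossed by [h] only finitely often, then on each side of
   [x] either [h <= F x] nearby, or [h > F x] nearby; the latter is possible only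
   if the averages from [x] are all equal to [F x]. *)
Lemma maximal_level_dominates x (w : R -> R) (M : R) : I x ->
  (forall p q, D p -> D q -> p < q ->
    jump (above h (F x)) p q <= w q - w p) ->
  {homo w : x y / x <= y} -> (forall x, 0 <= w x <= M) ->
  exists2 d, 0 < d & locally_le x d (F x).
Proof.
move=> Ix hw wnd wM.
have [d1 d10 H1] := nondecreasing_small_increments wnd wM x (ltr01 : 0 < 1 :> R).
pose d := Num.min d1 r0; have d0 : 0 < d by rewrite lt_min d10.
have dd1 : d <= d1 by rewrite ge_min lexx.
have dr0 : d <= r0 by rewrite ge_min lexx orbT.
have sameR p q : D p -> D q -> x < p -> p < x + d -> x < q -> q < x + d ->
    (F x < h q) = (F x < h p).
  wlog pq : p q / p <= q.
    by move=> W Dp Dq xp px xq qx; have [/W->//|/ltW/W->//] := leP p q.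
  move: pq; rewrite le_eqVlt => /predU1P[->//|pq] Dp Dq xp px xq qx.
  have := hw _ _ Dp Dq pq.
  have : w q - w p < 1 by apply: H1; [exact: ltW|left; split => //; lra].
  rewrite /jump /above.
  by do 2 case: (F x < _) => //; rewrite ?subr0 ?sub0r ?normrN normr1; lra.
have sameL p q : D p -> D q -> x - d < p -> p < x -> x - d < q -> q < x ->
    (F x < h q) = (F x < h p).
  wlog pq : p q / p <= q.
    by move=> W Dp Dq xp px xq qx; have [/W->//|/ltW/W->//] := leP p q.
  move: pq; rewrite le_eqVlt => /predU1P[->//|pq] Dp Dq xp px xq qx.
  have := hw _ _ Dp Dq pq.
  have : w q - w p < 1 by apply: H1; [exact: ltW|right; split => //; lra].
  rewrite /jump /above.
  by do 2 case: (F x < _) => //; rewrite ?subr0 ?sub0r ?normrN normr1; lra.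
exists (d / 2); first lra.
apply: locally_le_sides => // c b Ic Ib xc cb bx.
- have [[p [Dp xp px hp]]|no] := pselect (exists p, [/\ D p, x < p, p < x + d & F x < h p]).
    have : F x * (c - x) <= S x c.
      apply: S_ge' => // q Dq /andP[xq qc].
      by apply: ltW; rewrite (sameR p q)//; lra.
    have : S x b <= F x * (b - x).
      by apply: average_leF' => //; [lra|lra|apply: adm_small; lra].
    by rewrite (SD Ix Ib xc cb); lra.
  apply: S_le' => // q Dq /andP[cq qb]; rewrite leNgt; apply/negP => hq.
  by apply: no; exists q; split => //; lra.
- have [[p [Dp xp px hp]]|no] := pselect (exists p, [/\ D p, x - d < p, p < x & F x < h p]).
    have : F x * (x - b) <= S b x.
      apply: S_ge' => // q Dq /andP[bq qx].
      by apply: ltW; rewrite (sameL p q)//; lra.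
    have : S c x <= F x * (x - c).
      by apply: average_leF' => //; [lra|lra|apply: adm_small; lra].
    by rewrite (SD Ic Ix cb bx); lra.
  apply: S_le' => // q Dq /andP[cq qb]; rewrite leNgt; apply/negP => hq.
  by apply: no; exists q; split => //; lra.
Qed.

Lemma maximal_lipschitz x (w : R -> R) (M : R) : I x ->
  (forall p q, D p -> D q -> p < q -> jump (above h (F x)) p q <= w q - w p) ->
  {homo w : x y / x <= y} -> (forall x, 0 <= w x <= M) ->
  (forall d : R, 0 < d -> exists2 z, I z & `|z - x| < d /\ F x < F z) ->
  exists L d : R, 0 < d /\
    forall b, I b -> `|b - x| < d -> `|F b - F x| <= L * `|b - x|.
Proof.
move=> Ix hw wnd wM near; have [d d0 H] := maximal_level_dominates Ix hw wnd wM.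
exists (2 * C / d), (d / 2); split=> [|b Ib bx]; first lra.
have := maximal_upper Ix (lexx _) d0 H Ib (ltW bx).
have := maximal_lower Ix d0 H near Ib.
by rewrite ler_distl; lra.
Qed.

(** From above, [h] hardly exceeds [F x] near [x], so [maximal_upper] applies. From below, one
    interval that nearly attains [F x] is shifted to [b]. *)
Lemma maximal_continuous (w : R -> R) (M : R) x (e : R) :
  (forall p q, D p -> D q -> p < q -> `|h q - h p| <= w q - w p) ->
  {homo w : x y / x <= y} -> (forall x, 0 <= w x <= M) ->
  I x -> 0 < e -> exists2 d : R, 0 < d &
    forall b, I b -> `|b - x| < d -> `|F b - F x| < e.
Proof.
move=> hw wnd wM Ix e0; have e20 : 0 < e / 2 by lra.
have [d d0 H] := maximal_dominates hw wnd wM Ix e20.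
have Fxe : F x - e / 2 < F x by lra.
have [a [c [[Ia Ic ac ac_adm /andP[ax xc]] Sac]]] := F_ltP Ix Fxe.
have C0 := C_ge0 Ia Ic ac.
have L0 : 0 <= 2 * C / d by rewrite divr_ge0 ?(ltW d0)// mulr_ge0.
(* In order: the range of [maximal_upper], a bound making its linear term less than [e / 2], and a
   bound making the cost of the shift less than [(c - a) * (e / 2)]. The [+ 1] keeps the
   denominators positive. *)
exists (Num.min (d / 2) (Num.min (e / 2 / (2 * C / d + 1)) ((c - a) * (e / 2) / (C + 1)))).
  by rewrite !lt_min !divr_gt0 ?mulr_gt0//; lra.
move=> b Ib; rewrite !lt_min => /and3P[b1 b2 b3].
have Fxt : F x <= F x + e / 2 by lra.
have up := maximal_upper Ix Fxt d0 H Ib (ltW b1).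
have := @maximal_shift a c b `|b - x| Ia Ic ac ac_adm Ib.
have -> : a - `|b - x| <= b <= c + `|b - x|.
  by have := ler_norm (b - x); have := ler_norm (x - b); rewrite distrC; lra.
move=> /(_ isT (normr_ge0 _)) low.
move: b2; rewrite ltr_pdivlMr; last lra.
move: b3; rewrite ltr_pdivlMr; last lra.
move=> b3 b2.
have : 2 * C / d * `|b - x| <= `|b - x| * (2 * C / d + 1).
  by rewrite mulrC ler_wpM2l//; lra.
have : C * `|b - x| <= `|b - x| * (C + 1) by rewrite mulrC ler_wpM2l//; lra.
move=> c1 c2; rewrite ltr_distl; apply/andP; split; last by lra.
have : (F x - e / 2 - F b) * (c - a) < (e / 2) * (c - a) by lra.
by rewrite ltr_pM2r; lra.
Qed.

End oscillation.
End maximal_regularity.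

(** * The coarea formula and absolute continuity *)

Section coarea.
Context {R : realType}.
Local Notation mu := (@lebesgue_measure R).
Implicit Types (u : R -> R) (c : R -> R -> R) (s : seq R).

Lemma jump_aboveE u (y a b : R) :
  jump (above u y) a b = \1_(`[Num.min (u a) (u b), Num.max (u a) (u b)[) y.
Proof.
rewrite /jump /above indicE mem_setE in_itv/= ge_min lt_max.
by case: (leP (u a) y) => _; case: (leP (u b) y) => _;
  rewrite ?(subr0, sub0r, subrr, normr0, normrN, normr1).
Qed.

Lemma jump_above01 u (y a b : R) : jump (above u y) a b != 0 ->
  jump (above u y) a b = 1 /\ (y < u a)%R != (y < u b)%R.
Proof.
rewrite /jump /above.
by do 2 case: (y < _) => //=; rewrite ?(subr0, sub0r, subrr, normr0, normrN, normr1) ?eqxx.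
Qed.

Lemma jump_above_integral u (a b : R) :
  (\int[mu]_y (jump (above u y) a b)%:E = (jump u a b)%:E)%E.
Proof.
under eq_integral do rewrite jump_aboveE.
rewrite integral_indic//= setIT lebesgue_measure_itv/= lte_fin /jump.
by case: (ltgtP (u a) (u b)) => ab; rewrite ?ltxx ?ab -?EFinB ?subrr ?normr0//;
  [rewrite gtr0_norm ?subr_gt0|rewrite ltr0_norm ?subr_lt0 ?opprB].
Qed.

Definition weighted_jump c u (a b : R) : R := c a b * jump u a b.

Lemma measurable_gap_sum_above c u s :
  measurable_fun setT (fun y => gap_sum (weighted_jump c (above u y)) s).
Proof.
case: s => [|x s] /=; first exact: measurable_cst.
elim: s x => [|z s IH] x /=; first exact: measurable_cst.
apply: measurable_funD => //; rewrite /weighted_jump; apply: measurable_funM => //.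
rewrite (_ : (fun y => _) = \1_(`[Num.min (u x) (u z), Num.max (u x) (u z)[)); last first.
  by apply/funext => y; rewrite jump_aboveE.
exact: measurable_indic.
Qed.

(** The set of levels crossed in a gap has as length the jump across it, and the weight [c] does not
    depend on the level. *)
Lemma gap_sum_coarea c u s : (forall a b, 0 <= c a b) ->
  (\int[mu]_y (gap_sum (weighted_jump c (above u y)) s)%:E =
   (gap_sum (weighted_jump c u) s)%:E)%E.
Proof.
move=> c0; case: s => [|x s] /=; first by rewrite integral0.
have m0 a b y v : 0 <= weighted_jump c (above v y) a b.
  by rewrite mulr_ge0// jump_ge0.
elim: s x => [|z s IH] x /=; first by rewrite integral0.
under eq_integral do rewrite EFinD.
rewrite ge0_integralD//; first last.
- by apply/measurable_EFinP; exact: (measurable_gap_sum_above c u (z :: s)).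
- by move=> y _; rewrite lee_fin gap_sum_from_ge0.
- have := measurable_gap_sum_above c u [:: x; z].
  by move=> /measurable_EFinP; under eq_fun do rewrite /= addr0.
- by move=> y _; rewrite lee_fin.
rewrite IH EFinD; congr (_ + _)%E; rewrite /weighted_jump.
under eq_integral do rewrite EFinM.
rewrite ge0_integralZl//; first by rewrite jump_above_integral EFinM.
- apply/measurable_EFinP.
  rewrite (_ : (fun y => _) = \1_(`[Num.min (u x) (u z), Num.max (u x) (u z)[)); last first.
    by apply/funext => y; rewrite jump_aboveE.
  exact: measurable_indic.
- by move=> y _; rewrite lee_fin jump_ge0.
- by rewrite lee_fin.
Qed.

Lemma countable_seq_exhaustion (D : set R) : countable D ->
  exists P : nat -> seq R, [/\ forall k, sorted <%R (P k),
    forall k x, x \in P k -> D x,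
    forall k l, (k <= l)%N -> {subset P k <= P l} &
    forall s, {in s, forall x, D x} -> exists k, {subset s <= P k}].
Proof.
move=> /pfcard_geP[->|[q]].
  by exists (fun=> [::]); split => // -[|x s] H; [exists 0%N|have := H x; rewrite inE eqxx => /(_ isT)].
exists (fun k => strict_sort [seq q i | i <- iota 0 k]); split.
- by move=> k; exact: strict_sort_sorted.
- move=> k x; rewrite mem_strict_sort => /mapP[i _ ->]; exact: funS.
- move=> k l kl x; rewrite !mem_strict_sort => /mapP[i ik ->]; apply/map_f.
  by move: ik; rewrite !mem_iota !add0n/= => /leq_trans; apply.
- elim=> [|x s IH] H; first by exists 0%N.
  have [|k sk] := IH; first by move=> z zs; apply: H; rewrite inE zs orbT.
  have [|i _ qi] := @surj _ _ _ _ q x; first by apply: H; rewrite inE eqxx.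
  exists (maxn k i.+1) => z; rewrite inE mem_strict_sort => /orP[/eqP ->|/sk].
    by rewrite -qi; apply/map_f; rewrite mem_iota /= add0n leq_max ltnSn orbT.
  rewrite mem_strict_sort => /mapP[j + ->]; rewrite mem_iota add0n /= => jk.
  by apply/map_f; rewrite mem_iota /= add0n leq_max jk.
Qed.

Lemma weighted_jump1 u : weighted_jump (fun _ _ => 1) u = jump u.
Proof. by apply/funext => a; apply/funext => b; rewrite /weighted_jump mul1r. Qed.

(** Over a countable set the Banach indicatrix is the increasing limit of the crossing counts of a
    sequence of partitions, hence measurable. By the coarea formula each count has integral at most
    [M], and monotone convergence passes this to [N]. *)
Lemma indicatrix_integrable u (D : set R) (M : R) : countable D ->
  (forall s, sorted <%R s -> {in s, forall x, D x} -> gap_sum (jump u) s <= M) ->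
  exists2 N : R -> \bar R, mu.-integrable setT N &
    forall y s, sorted <%R s -> {in s, forall x, D x} ->
      ((gap_sum (jump (above u y)) s)%:E <= N y)%E.
Proof.
move=> /countable_seq_exhaustion[P [Ps PD Pmono Pex]] HM.
pose g k y := (gap_sum (jump (above u y)) (P k))%:E.
have mg k : measurable_fun setT (g k).
  apply/measurable_EFinP; have := measurable_gap_sum_above (fun _ _ => 1) u (P k).
  by under eq_fun do rewrite weighted_jump1.
have g0 k y : (0 <= g k y)%E.
  by rewrite lee_fin gap_sum_ge0// => a b; exact: jump_ge0.
have gnd y : {homo g^~ y : n m / (n <= m)%N >-> (n <= m)%E}.
  move=> k l kl; rewrite lee_fin; apply: gap_sum_le => //.
  + by move=> a b; exact: jump_ge0.
  + exact: jump_subadditive.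
  + by apply: sorted_subseq => //; exact: Pmono.
have glim y : limn (g^~ y) = ereal_sup (range (g^~ y)).
  by apply/cvg_lim => //; exact: ereal_nondecreasing_cvgn.
exists (fun y => limn (g^~ y)); last first.
  move=> y s ss sD; have [k sk] := Pex _ sD.
  rewrite glim; apply: (@le_trans _ _ (g k y)); last first.
    by apply: ereal_sup_ubound; exists k.
  rewrite lee_fin; apply: gap_sum_le => //.
  + by move=> a b; exact: jump_ge0.
  + exact: jump_subadditive.
  + exact: sorted_subseq.
have lim0 y : (0 <= limn (g^~ y))%E.
  by rewrite glim; apply: (le_trans (g0 0%N y)); apply: ereal_sup_ubound; exists 0%N.
apply/integrableP; split.
  apply: (emeasurable_fun_cvg g) => // y _.
  by rewrite glim; exact: ereal_nondecreasing_cvgn.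
under eq_integral do rewrite gee0_abs//.
rewrite (@monotone_convergence _ _ _ mu setT _ g)//.
apply: (@le_lt_trans _ _ M%:E); last exact: ltry.
apply: lime_le.
  apply: ereal_nondecreasing_is_cvgn => k l kl; apply: ge0_le_integral => //.
  - exact: mg.
  - exact: mg.
  - by move=> y _; exact: gnd.
apply: nearW => k; have := gap_sum_coarea (c := fun _ _ => 1) u (P k).
rewrite weighted_jump1 => /(_ (fun _ _ => ler01)) H.
rewrite (_ : (\int[mu]_x g k x)%E = (gap_sum (jump u) (P k))%:E); last first.
  by rewrite -H; apply: eq_integral => y _; rewrite weighted_jump1.
by rewrite lee_fin; apply: HM => // x; exact: PD.
Qed.

End coarea.

Lemma le_lebesgue_measure (R : realType) (A B : set R) :
  measurable A -> measurable B -> A `<=` B ->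
  (lebesgue_measure A <= lebesgue_measure B)%E.
Proof.
by move=> mA mB AB; apply: le_measure; rewrite ?inE; [exact: mA|exact: mB|].
Qed.

(** * Gaps contained in a set of small measure *)

Section gap_covers.
Context {R : realType}.
Local Notation mu := (@lebesgue_measure R).
Implicit Types (g : R -> R -> R) (s : seq R) (U : set R).

(** As a weight, it keeps only the gaps contained in [U]. Absolute continuity becomes smallness of
    such sums for [U] of small measure, where [U] need not be a union of intervals. *)
Definition inside U (a b : R) : R := `[< `]a, b[%classic `<=` U >]%:R.

Lemma inside_ge0 U a b : 0 <= inside U a b. Proof. exact: ler0n. Qed.

Lemma gap_sum_neq0 g s : gap_sum g s != 0 ->
  exists s1 a b s2, s = s1 ++ [:: a, b & s2] /\ g a b != 0.
Proof.
case: s => [|x s] /=; first by rewrite eqxx.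
elim: s x => [|z s IH] x /=; first by rewrite eqxx.
have [gxz|gxz _] := eqVneq (g x z) 0; last by exists [::], x, z, s.
rewrite gxz add0r => /IH[s1 [a [b [s2 [-> gab]]]]].
by exists (x :: s1), a, b, s2.
Qed.

Lemma sorted_gap s s1 a b s2 : sorted <%R s -> s = s1 ++ [:: a, b & s2] ->
  [/\ a < b, a \in s & b \in s].
Proof.
move=> ss E; move: ss; rewrite E => /cat_sorted2[_ /=/andP[-> _]].
by rewrite !mem_cat !inE !eqxx !orbT.
Qed.

Fixpoint gap_cover_from U (h : R -> R -> set R) x s : set R :=
  if s is y :: s' then
    (if `[< `]x, y[%classic `<=` U >] then h x y else set0) `|` gap_cover_from U h y s'
  else set0.

Definition gap_cover U h s : set R := if s is x :: s' then gap_cover_from U h x s' else set0.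

Lemma gap_cover_sub U h s s1 a b s2 : s = s1 ++ [:: a, b & s2] ->
  `]a, b[%classic `<=` U -> h a b `<=` gap_cover U h s.
Proof.
move=> -> abU; elim: s1 => [|x [|z s1] IH] /=.
- by rewrite asboolT//; exact: subsetUl.
- by move=> t /IH; right.
- by move=> t /IH; right.
Qed.

Lemma measurable_gap_cover U h s : (forall a b, measurable (h a b)) ->
  measurable (gap_cover U h s).
Proof.
move=> mh; case: s => [|x s] /=; first exact: measurable0.
elim: s x => [|y s IH] x /=; first exact: measurable0.
by apply: measurableU => //; case: ifPn => _ //; exact: measurable0.
Qed.

(** The gaps inside [U] are disjoint, so their lengths add up to at most the measure of [U]. The
    induction uses only the part of [U] to the right of the current point. *)
Lemma gap_cover_measure_le U (h : R -> R -> set R) (m : R) s :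
  0 <= m -> measurable U -> sorted <%R s ->
  (forall a b, measurable (h a b)) ->
  (forall a b, a < b -> (mu (h a b) <= (m * (b - a))%:E)%E) ->
  (mu (gap_cover U h s) <= m%:E * mu U)%E.
Proof.
move=> m0 mU + mh hm; case: s => [_|x s xs] /=.
  by rewrite measure0 mule_ge0// lee_fin.
have mUx z : measurable (U `&` `]z, +oo[%classic) by exact: measurableI.
apply: (@le_trans _ _ (m%:E * mu (U `&` `]x, +oo[%classic))%E); last first.
  apply: lee_wpmul2l; rewrite ?lee_fin//.
  by apply: le_lebesgue_measure => //; exact: subIsetl.
elim: s x xs => [|y s IH] x /=; first by rewrite measure0 mule_ge0// lee_fin.
move=> /andP[xy ys].
have mgc z t : measurable (gap_cover_from U h z t).
  exact: (@measurable_gap_cover U h (z :: t)).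
case: asboolP => xyU; last first.
  rewrite set0U; apply: (le_trans (IH _ ys)); apply: lee_wpmul2l; rewrite ?lee_fin//.
  apply: le_lebesgue_measure => //; apply: setIS => z /=; rewrite !in_itv/= !andbT.
  exact: lt_trans.
apply: (@le_trans _ _ (mu (h x y) + mu (gap_cover_from U h y s))%E).
  by apply: measureU2; [exact: mh|exact: mgc].
apply: (le_trans (leeD (hm _ _ xy) (IH _ ys))).
have -> : (m * (y - x))%:E = (m%:E * mu `]x, y[%classic)%E.
  by rewrite /= lebesgue_measure_itv/= lte_fin xy -EFinB -EFinM.
rewrite -ge0_muleDr//; apply: lee_wpmul2l; rewrite ?lee_fin//.
rewrite -measureU; [|exact: measurable_itv|exact: mUx|].
- apply: le_lebesgue_measure => //; first exact: measurableU.
  move=> z [xyz|[Uz yz]]; split.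
  + exact: xyU.
  + by move: xyz; rewrite /= !in_itv/= => /andP[->].
  + by [].
  + by move: yz; rewrite /= !in_itv/= !andbT; exact: lt_trans.
- apply/seteqP; split=> // z [/=]; rewrite !in_itv/= andbT => /andP[_ zy] [_ yz].
  by move: (lt_trans zy yz); rewrite ltxx.
Qed.

End gap_covers.

(** * From Lipschitz points to absolute continuity *)

Section lusin.
Context {R : realType}.
Local Notation mu := (@lebesgue_measure R).

Lemma close_same_side (y p q : R) : `|p - q| < `|q - y| -> (y < p) = (y < q).
Proof.
have [yq|qy|->] := ltgtP y q; last by rewrite subrr normr0 normr_lt0.
  by rewrite (gtr0_norm (_ : 0 < q - y)) ?subr_gt0// ltr_norml; lra.
by rewrite (ltr0_norm (_ : q - y < 0)) ?subr_lt0// ltr_norml => ?; apply/negbTE; rewrite -leNgt; lra.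
Qed.

(* A variant of the Banach-Zarecki theorem. If the conclusion fails, there are
   sets [U k] of measure below [2^-(k+1)] whose gaps carry variation [> e]. By the
   coarea formula this variation is the integral over [y] of the number of gaps
   in [U k] across which [F] crosses the level [y]. These numbers are dominated by
   the Banach indicatrix, and tend to [0]: otherwise some [x] with [F x = y] lies
   in the closure of infinitely many gaps, and as [F] is Lipschitz at [x] such
   levels form a null set by Borel-Cantelli. *)
Lemma lusin_abs_continuous (I : set R) (F : R -> R) (M : R) (Z : set R) :
  is_interval I ->
  (forall s, sorted <%R s -> {in s, forall x, I x} -> gap_sum (jump F) s <= M) ->
  (forall x (e : R), I x -> 0 < e -> exists2 d : R, 0 < d &
    forall b, I b -> `|b - x| < d -> `|F b - F x| < e) ->
  mu.-negligible Z ->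
  (forall x, I x -> ~ Z (F x) ->
    (forall d : R, 0 < d -> exists2 z, I z & `|z - x| < d /\ F x < F z) ->
    exists L d : R, 0 < d /\ forall b, I b -> `|b - x| < d -> `|F b - F x| <= L * `|b - x|) ->
  forall e : R, 0 < e -> exists2 d : R, 0 < d &
    forall U : set R, measurable U -> (mu U < d%:E)%E ->
    forall s, sorted <%R s -> {in s, forall x, I x} ->
      gap_sum (weighted_jump (inside U) F) s <= e.
Proof.
move=> Iitv FM Fc Z0 Flip e e0.
apply: contrapT => no.
have /choice[US HUS] : forall k : nat, exists p : set R * seq R,
  [/\ measurable p.1, (mu p.1 < (1 / (2 ^ k.+1)%:R)%:E)%E, sorted <%R p.2,
      {in p.2, forall x, I x} & e < gap_sum (weighted_jump (inside p.1) F) p.2].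
  move=> k; apply: contrapT => H; apply: no.
  exists (1 / (2 ^ k.+1)%:R); first by rewrite divr_gt0// ltr0n expn_gt0.
  move=> U mU Ud s ss sI; rewrite leNgt; apply/negP => K; apply: H.
  by exists (U, s).
pose U k := (US k).1; pose P k := (US k).2.
have mU k : measurable (U k) by case: (HUS k).
have Ud k : (mu (U k) < (1 / (2 ^ k.+1)%:R)%:E)%E by case: (HUS k).
have Ps k : sorted <%R (P k) by case: (HUS k).
have PI k : {in P k, forall x, I x} by case: (HUS k).
have Pe k : e < gap_sum (weighted_jump (inside (U k)) F) (P k) by case: (HUS k).
(* All the partitions together are countable, so a single integrable indicatrix dominates every
   crossing count [g k]. *)
pose D : set R := \bigcup_k [set` P k].
have cD : countable D.
  by apply: bigcup_countable => // k _; exact/finite_set_countable/finite_seq.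
have PD k : {in P k, forall x, D x} by move=> x xP; exists k.
have DI : D `<=` I by move=> x [k _] /PI.
have [N Nint HN] := indicatrix_integrable (M := M) cD
  (fun s ss sD => FM s ss (fun x xs => DI _ (sD x xs))).
pose g k y := gap_sum (weighted_jump (inside (U k)) (above F y)) (P k).
have gint k : (\int[mu]_y (g k y)%:E = (gap_sum (weighted_jump (inside (U k)) F) (P k))%:E)%E.
  by apply: gap_sum_coarea => a b; exact: inside_ge0.
have wj0 k y a b : 0 <= weighted_jump (inside (U k)) (above F y) a b.
  by rewrite mulr_ge0// ?inside_ge0// jump_ge0.
have g0 k y : 0 <= g k y by rewrite gap_sum_ge0.
have gN k y : ((g k y)%:E <= N y)%E.
  apply: le_trans (HN y (P k) (Ps k) (@PD k)); rewrite lee_fin /g.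
  case: (P k) => //= x s; elim: s x => //= z s IH x; rewrite lerD//.
  by rewrite /weighted_jump ler_piMl ?jump_ge0// /inside; case: asbool.
(* If [F] is [m]-Lipschitz at some [x] in [[a, b]], the level [F x] lies in [h m a b]. Over the gaps
   inside [U k] these intervals have total length at most [2 m] times the measure of [U k], which is
   summable in [k]. *)
pose h (m : nat) a b : set R := `[F a - m%:R * (b - a), F a + m%:R * (b - a)]%classic.
have mh m a b : measurable (h m a b) by exact: measurable_itv.
pose H m k := gap_cover (U k) (h m) (P k).
have mH m k : measurable (H m k) by apply: measurable_gap_cover; exact: mh.
have Hm m k : (mu (H m k) <= (2 * m%:R)%:E * mu (U k))%E.
  apply: gap_cover_measure_le => // a b ab.
  rewrite /h /= lebesgue_measure_itv/= lte_fin; case: ifP => _; last first.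
    by rewrite lee_fin !mulr_ge0//; lra.
  by rewrite -EFinB lee_fin; lra.
have H0 m : mu.-negligible (lim_sup_set (H m)).
  have mL : measurable (lim_sup_set (H m)).
    by apply: bigcap_measurable => // n _; apply: bigcup_measurable => k _; exact: mH.
  apply/negligibleP; [exact: mL|apply: lim_sup_set_cvg0; first exact: mH].
  apply: (@le_lt_trans _ _ (2 * m%:R)%:E); last exact: ltry.
  apply: le_trans (epsilon_trick0 xpredT _); last by rewrite mulr_ge0.
  apply: lee_nneseries => // k _; apply: (le_trans (Hm m k)).
  have -> : 2 * m%:R / (2 ^ k.+1)%:R = 2 * m%:R * (1 / (2 ^ k.+1)%:R) :> R by rewrite mul1r.
  by rewrite [leRHS]EFinM; apply: lee_wpmul2l; [rewrite lee_fin mulr_ge0|exact: ltW].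
have cvg0 : {ae mu, forall y, setT y -> (g k y)%:E @[k --> \oo] --> (0 : \bar R)%E}.
  have bad : mu.-negligible (Z `|` ~` [set y | setT y -> N y \is a fin_num] `|`
      \bigcup_m lim_sup_set (H m)).
    apply: negligibleU; last exact: negligible_bigcup.
    by apply: negligibleU => //; exact: (integrable_ae _ Nint).
  apply: negligibleS bad => y; apply: contra_notP => /= ybad _.
  have yZ : ~ Z y by move=> ?; apply: ybad; left; left.
  have Ny : N y \is a fin_num.
    by apply: contrapT => Ny; apply: ybad; left; right => /(_ Logic.I).
  have yH m : ~ lim_sup_set (H m) y by move=> ?; apply: ybad; right; exists m.
  pose J := jump (above F y).
  have J0 a b : 0 <= J a b by exact: jump_ge0.
  have JM s : sorted <%R s -> {in s, forall x, D x} -> gap_sum J s <= fine (N y).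
    by move=> ss sD; rewrite -lee_fin fineK//; exact: HN.
  (* [w] counts the crossings of the level [y] along [D]. It rises by at least one across each
     crossing gap and is bounded, so every such gap passes one of finitely many integers [i]. It
     remains to exclude, for fixed [i], crossing gaps that pass [i] for infinitely many [k]. *)
  pose w := control_fun J D.
  have w0 x : 0 <= w x by exact: (control_fun_ge0 (M := fine (N y))).
  have wM x : w x <= fine (N y) by exact: control_fun_le.
  have wnd : {homo w : x z / x <= z} by exact: (control_fun_nd (M := fine (N y))).
  have wstep a b : D a -> D b -> a < b -> w a + J a b <= w b.
    by apply: (control_fun_step (M := fine (N y))) => //; exact: jump_subadditive.
  pose gap k a b := exists s1 s2, P k = s1 ++ [:: a, b & s2] /\ `]a, b[%classic `<=` U k.
  have key (i : nat) : \forall k \near \oo, forall a b,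
      gap k a b -> J a b != 0 -> ~ (w a < i%:R <= w b).
    apply: contrapT => notkey.
    have freq K : exists k a b, [/\ (K <= k)%N, gap k a b, J a b != 0 & w a < i%:R <= w b].
      apply: contrapT => H1; apply: notkey; exists K => // k /= Kk a b gab Jab wab.
      by apply: H1; exists k, a, b.
    have small k a b : gap k a b -> [/\ a < b, D a, D b & b - a < 1 / (2 ^ k.+1)%:R].
      move=> [s1 [s2 [E abU]]]; have [ab aP bP] := sorted_gap (Ps k) E.
      split => //; [exact: PD aP|exact: PD bP|].
      rewrite -lte_fin; apply: le_lt_trans (Ud k).
      have <- : mu `]a, b[%classic = (b - a)%:E.
        by rewrite /= lebesgue_measure_itv/= lte_fin ab EFinB.
      by apply: le_lebesgue_measure.
    (* The place where [w] reaches [i] lies in the closure of every gap passing [i]; since the gaps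
       shrink, they accumulate at this point. *)
    pose W := [set q | D q /\ i%:R <= w q]; pose x := inf W.
    have xin k a b : gap k a b -> w a < i%:R <= w b -> a <= x <= b.
      move=> /small[ab Da Db _] /andP[wa wb].
      have lbW : lbound W a.
        move=> q [_ iq]; rewrite leNgt; apply/negP => /ltW/wnd; lra.
      apply/andP; split; first by apply: lb_le_inf => //; exists b.
      by apply: ge_inf; [exists a|].
    have Ix : I x.
      have [k [a [b [_ gab _ wab]]]] := freq 0%N; have [_ Da Db _] := small _ _ _ gab.
      exact: (Iitv _ _ (DI _ Da) (DI _ Db) _ (xin _ _ _ gab wab)).
    have arb (d : R) : 0 < d -> exists K, forall k, (K <= k)%N -> 1 / (2 ^ k.+1)%:R < d.
      move=> d0; 
      have /cvgrPdist_lt/(_ _ d0)[K _ HK] : ((2^-1 : R) ^+ k @[k --> \oo]) --> (0 : R).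
        by apply: cvg_expr; rewrite gtr0_norm ?invr_gt0// invf_lt1// ltr1n.
      exists K => k Kk; have := HK k.+1 (leq_trans Kk (leqnSn _)).
      by rewrite sub0r normrN gtr0_norm ?exprn_gt0 ?invr_gt0// natrX exprVn mul1r.
    have close (d : R) K : 0 < d -> exists k a b, [/\ (K <= k)%N, gap k a b,
        J a b != 0, w a < i%:R <= w b & b - a < d].
      move=> /arb[K' HK']; have [k [a [b [Kk gab Jab wab]]]] := freq (maxn K K').
      exists k, a, b; split => //; first by rewrite (leq_trans _ Kk)// leq_maxl.
      have [_ _ _ /lt_trans] := small _ _ _ gab; apply.
      by apply: HK'; rewrite (leq_trans _ Kk)// leq_maxr.
    have dist k a b d : gap k a b -> w a < i%:R <= w b -> b - a < d ->
        `|a - x| < d /\ `|b - x| < d.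
      move=> gab wab abd; have /andP[ax xb] := xin _ _ _ gab wab.
      by clear -ax xb abd; rewrite distrC !ger0_norm; lra.
    (* Otherwise continuity would put both ends of a short gap on the same side of [y], and the gap
       would not cross. *)
    have Fxy : F x = y.
      apply/eqP; rewrite -subr_eq0 -normr_eq0 -[_ == _]negbK -normr_gt0 normr_id.
      apply/negP => Fxy0; have [d d0 Hd] := Fc x _ Ix Fxy0.
      have [k [a [b [_ gab Jab wab abd]]]] := close d 0%N d0.
      have [ax bx] := dist _ _ _ _ gab wab abd; have [_ Da Db _] := small _ _ _ gab.
      have [_] := jump_above01 Jab.
      rewrite (close_same_side (Hd _ (DI _ Da) ax)) (close_same_side (Hd _ (DI _ Db) bx)).
      by case: (_ < _).
    (* One end of every crossing gap lies strictly above [y = F x], and these gaps shrink to [x]; so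
       [x] is not a local maximum and [Flip] applies. *)
    have [||L [d [d0 Hd]]] := Flip x Ix; first by rewrite Fxy.
      move=> d d0; have [k [a [b [_ gab Jab wab abd]]]] := close d 0%N d0.
      have [ax bx] := dist _ _ _ _ gab wab abd; have [_ Da Db _] := small _ _ _ gab.
      have [_] := jump_above01 Jab; rewrite Fxy.
      case: (ltP y (F a)) => ya; first by exists a => //; exact: DI.
      by case: (ltP y (F b)) => yb // _; exists b => //; exact: DI.
    have [m Lm] : exists m : nat, L <= m%:R.
      by exists (Num.truncn L).+1; rewrite ltW// truncnS_gt.
    apply: (yH m) => K _; have [k [a [b [Kk gab Jab wab abd]]]] := close d K d0.
    exists k => //=; have [s1 [s2 [E abU]]] := gab.
    apply: (gap_cover_sub (h := h m) E abU); rewrite /h /= in_itv/= -ler_distl -Fxy distrC.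
    have [ax _] := dist _ _ _ _ gab wab abd; have [_ Da _ _] := small _ _ _ gab.
    rewrite (le_trans (Hd _ (DI _ Da) ax))//.
    have /andP[ax' xb] := xin _ _ _ gab wab.
    rewrite (@le_trans _ _ (m%:R * `|a - x|))// ?ler_wpM2r// ler_wpM2l//.
    by clear -ax' xb; rewrite distrC ger0_norm; lra.
  have [n Nn] : exists n : nat, fine (N y) < n%:R.
    by exists (Num.truncn (fine (N y))).+1; rewrite truncnS_gt.
  apply: cvg_near_cst.
  have : \forall k \near \oo, forall i : 'I_n, forall a b,
      gap k a b -> J a b != 0 -> ~ (w a < (i : nat)%:R <= w b).
    by apply: filter_forall => i; exact: key.
  apply: filterS => k nokey; congr EFin; apply/eqP; rewrite -[_ == _]negbK.
  apply/negP => /gap_sum_neq0[s1 [a [b [s2 [E]]]]].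
  rewrite /weighted_jump mulf_eq0 negb_or /inside pnatr_eq0 eqb0 negbK => /andP[/asboolP abU Jab].
  have [ab aP bP] := sorted_gap (Ps k) E.
  have wab := wstep _ _ (PD _ _ aP) (PD _ _ bP) ab.
  have [J1 _] := jump_above01 Jab; rewrite /J J1 in wab.
  (* The least integer above [w a] is reached at [b], because a crossing raises [w] by at least one;
     it is below [n] because [w] stays below [N y]. *)
  have /andP[tr1 tr2] := truncn_itv (w0 a).
  have iltn : ((Num.truncn (w a)).+1 < n)%N.
    rewrite -(ltr_nat R); apply: le_lt_trans Nn; rewrite (le_trans _ (wM b))//.
    by rewrite -natr1; lra.
  apply: (nokey (Ordinal iltn) a b) => //; first by exists s1, s2.
  by rewrite /= tr2 /= -natr1; lra.
have mg k : measurable_fun setT (fun y => (g k y)%:E).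
  by apply/measurable_EFinP; exact: measurable_gap_sum_above.
have absN k y : (`|(g k y)%:E| <= N y)%E by rewrite gee0_abs ?lee_fin.
have [|_ _] := @dominated_convergence _ _ _ mu setT measurableT
  (fun k y => (g k y)%:E) (fun _ => 0%E) N mg (measurable_cst _) cvg0 Nint.
  by apply: aeW => y k _; exact: absN.
rewrite integral0 => lim0.
have : (e%:E <= 0)%E.
  rewrite -[leRHS](cvg_lim _ lim0)//; apply: lime_ge; last first.
    by apply: nearW => k /=; rewrite gint lee_fin ltW.
  by apply/cvg_ex; exists 0%E; exact: lim0.
by rewrite lee_fin leNgt e0.
Qed.

End lusin.

(** * Functions of bounded variation *)

Section continuity_points.
Context {R : realType}.
Local Notation mu := (@lebesgue_measure R).

Definition continuity_at (f : R -> R) (x : R) := forall e : R, 0 < e ->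
  exists2 d : R, 0 < d & forall b, `|b - x| < d -> `|f b - f x| < e.

Lemma nondecreasing_continuity_points (w : R -> R) (M : R) :
  {homo w : x y / x <= y} -> (forall x, 0 <= w x <= M) ->
  exists2 Z : set R, countable Z & forall x, ~ Z x -> continuity_at w x.
Proof.
move=> wnd wM.
exists (\bigcup_k [set x | x \in (`](- k%:R), k%:R[) /\ discontinuity w x]).
  apply: bigcup_countable => // k _; apply: discontinuity_countable.
  by move=> a b _ _; exact: wnd.
move=> x Zx.
have cR : cvg (w y @[y --> x^'+]).
  apply: nondecreasing_at_right_is_cvgr.
    by apply: nearW => y a b _ _; exact: wnd.
  by apply: nearW => y; exists 0 => _ [a _ <-]; have /andP[] := wM a.
have cL : cvg (w y @[y --> x^'-]).
  apply: nondecreasing_at_left_is_cvgr.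
    by apply: nearW => y a b _ _; exact: wnd.
  by apply: nearW => y; exists M => _ [a _ <-]; have /andP[] := wM a.
have LR : lim (w y @[y --> x^'-]) = lim (w y @[y --> x^'+]).
  apply: contrapT => /eqP LR; apply: Zx.
  exists (Num.truncn `|x|).+1 => //; split; last by split.
  by rewrite in_itv/= -ltr_norml truncnS_gt.
move=> e e0; have e20 : 0 < e / 2 by lra.
move: cR cL => /cvgrPdist_lt/(_ _ e20) /nbhs_ballP[d1 /= d10 H1].
move=> /cvgrPdist_lt/(_ _ e20) /nbhs_ballP[d2 /= d20 H2].
set L := lim (w y @[y --> x^'+]) in H1 LR; rewrite LR in H2.
have {}H1 y : x < y -> y < x + d1 -> `|L - w y| < e / 2.
  by move=> xy yd; apply: H1 => //=; rewrite /ball/= ltr0_norm; lra.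
have {}H2 y : y < x -> x - d2 < y -> `|L - w y| < e / 2.
  by move=> xy yd; apply: H2 => //=; rewrite /ball/= gtr0_norm; lra.
have := H1 (x + d1 / 2); have := H2 (x - d2 / 2).
have : w (x - d2 / 2) <= w x by apply: wnd; lra.
have : w x <= w (x + d1 / 2) by apply: wnd; lra.
move=> w1 w2; rewrite !ltr_distl => /(_ _ _)/andP h2 /(_ _ _)/andP h1.
have {}h1 : L < w (x + d1 / 2) + e / 2 /\ w (x + d1 / 2) - e / 2 < L.
  by case: h1; lra.
have {}h2 : L < w (x - d2 / 2) + e / 2 /\ w (x - d2 / 2) - e / 2 < L.
  by case: h2; lra.
exists (Num.min d1 d2); first by rewrite lt_min d10.
move=> b; rewrite lt_min => /andP[]; rewrite !ltr_distl => /andP[b1 b2] /andP[b3 b4].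
case: (ltgtP b x) => bx.
- have := H2 b bx; rewrite ltr_distl => /(_ _)/andP[|? ?]; first lra.
  by have := wnd b x (ltW bx); lra.
- have := H1 b bx; rewrite ltr_distl => /(_ _)/andP[|? ?]; first lra.
  by have := wnd x b (ltW bx); lra.
- by rewrite bx; lra.
Qed.

Lemma integral_le_off_countable (A Z : set R) (f : R -> R) (t : R) :
  measurable A -> (mu A < +oo)%E -> mu.-integrable A (EFin \o f) -> countable Z ->
  (forall x, A x -> ~ Z x -> f x <= t) ->
  (\int[mu]_(x in A) (f x)%:E <= t%:E * mu A)%E.
Proof.
move=> mA Afin intf cZ H.
have Z0 := countable_lebesgue_measure0 cZ.
have mZ : measurable Z by exact: countable_measurable.
rewrite (@negligible_integral _ _ _ mu A Z _ mZ mA intf Z0).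
have mAZ : measurable (A `\` Z) by exact: measurableD.
apply: (@le_trans _ _ (\int[mu]_(x in A `\` Z) (cst t%:E x))%E).
  apply: le_integral => //.
  - by apply: (@integrableS _ _ _ mu A (A `\` Z) _ mA mAZ _ intf) => // x [].
  - apply: measurable_bounded_integrable => //.
    + by apply: le_lt_trans Afin; apply: le_lebesgue_measure => // x [].
    + by exists `|t|; split; [exact: num_real|move=> x tx y _; exact: ltW].
  - by move=> x /set_mem[Ax Zx]; rewrite lee_fin; exact: H.
rewrite (@integral_cst _ _ _ mu _ mAZ t%:E).
have -> : (mu A = mu (A `\` Z) + mu (A `&` Z))%E.
  by apply: measureDI; [exact: mA|exact: mZ].
rewrite (_ : mu (A `&` Z) = 0%E) ?adde0//.
have mAZ' : measurable (A `&` Z) by exact: measurableI.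
by apply: (@subset_measure0 _ _ _ mu _ Z mAZ' mZ) => // x [].
Qed.

End continuity_points.

Section bounded_variation.
Context {R : realType}.
Local Notation mu := (@lebesgue_measure R).
Variables (I : interval R) (f : R -> R) (M : R).
Hypothesis fM : forall s, sorted <%R s -> {in s, forall x, x \in I} ->
  gap_sum (jump f) s <= M.

Let v := control_fun (jump f) [set` I].

Lemma bv_control : [/\ {homo v : x y / x <= y}, forall x, 0 <= v x <= M &
  forall a b, a \in I -> b \in I -> a <= b -> `|f b - f a| <= v b - v a].
Proof.
have g0 x y : 0 <= jump f x y by exact: jump_ge0.
split.
- by apply: (control_fun_nd (M := M)).
- by move=> x; rewrite (control_fun_ge0 (M := M))//= control_fun_le.
- move=> a b Ia Ib; rewrite le_eqVlt => /predU1P[->|ab].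
    by rewrite !subrr normr0.
  rewrite lerBrDl; apply: (control_fun_step (M := M)) => //.
  exact: jump_subadditive.
Qed.

Lemma bv_bounded : exists2 C : R, 0 < C & forall x, x \in I -> `|f x| <= C.
Proof.
have [vnd vM fv] := bv_control.
have [[x0 Ix0]|no] := pselect (exists x0, x0 \in I); last first.
  by exists 1 => // x Ix; exfalso; apply: no; exists x.
exists (`|f x0| + M + 1).
  by have /andP[? ?] := vM x0; have := normr_ge0 (f x0); lra.
move=> x Ix; have : `|f x - f x0| <= M.
  have /andP[? ?] := vM x; have /andP[? ?] := vM x0.
  have [xx0|x0x] := leP x x0; first by have := fv _ _ Ix Ix0 xx0; rewrite distrC; lra.
  by have := fv _ _ Ix0 Ix (ltW x0x); lra.
have := ler_normD (f x - f x0) (f x0); rewrite subrK; lra.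
Qed.

Lemma measurable_fun_nondecreasing_on (w : R -> R) :
  {in I &, {homo w : x y / x <= y}} -> measurable_fun [set` I] w.
Proof.
move=> wnd; apply: (measurability _ (RGenOInfty.measurableE R)) => //.
move=> _ [_ [t ->] <-]; apply: is_interval_measurable.
move=> x y [/= Ix +] [/= Iy _]; rewrite !in_itv/= !andbT => tx z /andP[xz zy].
have Iz : z \in I by apply: (interval_is_interval Ix Iy); rewrite xz.
by split => //=; rewrite in_itv/= andbT (lt_le_trans tx)// wnd.
Qed.

Lemma bv_measurable : measurable_fun [set` I] f.
Proof.
have [vnd vM fv] := bv_control.
(* Jordan decomposition: both [v] and [v - f] are nondecreasing on [I]. *)
rewrite (_ : f = v \- (v \- f)); last by apply/funext => x /=; lra.
apply: measurable_funB; apply: measurable_fun_nondecreasing_on => x y Ix Iy xy.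
  exact: vnd.
by have := fv _ _ Ix Iy xy; have := ler_norm (f y - f x) => /=; lra.
Qed.

Lemma bv_integrable (J : interval R) : [set` J] `<=` [set` I] ->
  (mu [set` J] < +oo)%E -> mu.-integrable [set` J] (EFin \o f).
Proof.
move=> JI Jfin; apply: measurable_bounded_integrable => //.
  exact: measurable_funS bv_measurable.
have [C C0 fC] := bv_bounded.
exists C; split; first exact: num_real.
by move=> x Cx y /= /JI /fC fy; exact: le_trans (ltW Cx).
Qed.

(** Increments of [f] are dominated by those of its variation function, so [f] is continuous in the
    interior wherever that function is. *)
Lemma bv_continuity_points : exists2 Z : set R, countable Z &
  forall x, [set` I]^° x -> ~ Z x -> continuity_at f x.
Proof.
have [vnd vM fv] := bv_control.
have [Z cZ HZ] := nondecreasing_continuity_points vnd vM.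
exists Z => // x /nbhs_ballP[r /= r0 rI] /HZ xc e e0.
have [d d0 Hd] := xc e e0.
exists (Num.min d r); first by rewrite lt_min d0.
move=> b; rewrite lt_min => /andP[bd br].
have Ib : b \in I by apply: rI; rewrite /ball/= distrC.
have Ix : x \in I by apply: rI; exact: ballxx.
have := Hd _ bd; rewrite ltr_distl => /andP[? ?].
have [bx|xb] := leP b x; first by have := fv _ _ Ib Ix bx; rewrite distrC; lra.
by have := fv _ _ Ix Ib (ltW xb); lra.
Qed.

End bounded_variation.

Lemma countable_setU (T : Type) (A B : set T) :
  countable A -> countable B -> countable (A `|` B).
Proof.
move=> cA cB; rewrite -bigcup2E; apply: bigcup_countable => // -[|[|k]] _ //=.
Qed.

(** * Intervals, their lengths and averages *)

Section interval_averages.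
Context {R : realType}.
Local Notation mu := (@lebesgue_measure R).
Implicit Types (J : interval R) (u : R -> R).

Lemma lebesgue_measure_cc (a b : R) : a <= b -> mu `[a, b]%classic = (b - a)%:E.
Proof.
rewrite le_eqVlt => /predU1P[->|ab].
  by rewrite /= lebesgue_measure_itv/= ltxx subrr.
by rewrite /= lebesgue_measure_itv/= lte_fin ab EFinB.
Qed.

Lemma closed_sub_itv J (x y : R) : x \in J -> y \in J -> `[x, y]%classic `<=` [set` J].
Proof. by move=> xJ yJ z /=; rewrite in_itv/=; exact: (interval_is_interval xJ yJ). Qed.

Lemma itv_length_ge J (x y : R) : x \in J -> y \in J -> x <= y ->
  ((y - x)%:E <= mu [set` J])%E.
Proof.
move=> xJ yJ xy; rewrite -lebesgue_measure_cc//; apply: le_lebesgue_measure => //.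
exact: closed_sub_itv.
Qed.

Lemma itv_dist_le J (x y d : R) : x \in J -> y \in J -> (mu [set` J] < d%:E)%E ->
  `|y - x| < d.
Proof.
move=> xJ yJ Jd; have [xy|yx] := leP x y; rewrite -lte_fin; apply: le_lt_trans Jd.
  by rewrite ger0_norm ?subr_ge0//; exact: itv_length_ge.
by rewrite ltr0_norm ?subr_lt0// opprB; apply: itv_length_ge => //; exact: ltW.
Qed.

Lemma nondegenerate_itv_length J : nondegenerate_itv J -> (mu [set` J] < +oo)%E ->
  exists2 l : R, 0 < l & mu [set` J] = l%:E.
Proof.
move=> [x [y [xJ yJ xy]]] fin; exists (fine (mu [set` J])).
  rewrite fine_gt0// fin andbT; apply: lt_le_trans (itv_length_ge xJ yJ (ltW xy)).
  by rewrite lte_fin subr_gt0.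
by rewrite fineK// ge0_fin_numE.
Qed.

(** Links the arbitrary intervals of the maximal function to the closed intervals with endpoints in
    [I] on which shifts are carried out. *)
Lemma itv_inner_approximation J (x e : R) : nondegenerate_itv J ->
  (mu [set` J] < +oo)%E -> x \in J -> 0 < e ->
  exists a b, [/\ a \in J, b \in J, a < b, a <= x <= b &
    (mu [set` J] <= (b - a + e)%:E)%E].
Proof.
move=> [p [q [pJ qJ pq]]] Jfin xJ e0.
have [l [r [c1 [c2 EJ]]]] : exists l r c1 c2, J = Interval (BSide c1 l) (BSide c2 r).
  case: J pJ Jfin {qJ xJ} => [[c1 l|[]] [c2 r|[]]];
    rewrite ?in_itv/= ?andbF ?lebesgue_measure_itv/= ?ltry ?ltNyr ?ltNyy ?ltxx//= ?ltxx//.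
  by exists l, r, c1, c2.
have lx : l <= x by move: xJ; rewrite EJ in_itv/=; case: (c1); case: (c2) => /= /andP[]; lra.
have xr : x <= r by move: xJ; rewrite EJ in_itv/=; case: (c1); case: (c2) => /= /andP[]; lra.
have lp : l <= p by move: pJ; rewrite EJ in_itv/=; case: (c1); case: (c2) => /= /andP[]; lra.
have qr : q <= r by move: qJ; rewrite EJ in_itv/=; case: (c1); case: (c2) => /= /andP[]; lra.
have lr : l < r by lra.
have JE : mu [set` J] = (r - l)%:E.
  by rewrite EJ /= lebesgue_measure_itv/= lte_fin lr EFinB.
have inJ z : l < z -> z < r -> z \in J.
  by move=> lz zr; rewrite EJ in_itv/=; case: (c1); case: (c2); apply/andP; split => /=; lra.
(* Both ends may have to be trimmed, hence [e / 2]; the other bound keeps the trimmed interval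
   nondegenerate. *)
pose d := Num.min (e / 2) ((r - l) / 4).
have d0 : 0 < d by rewrite lt_min; apply/andP; split; lra.
have de : d <= e / 2 by rewrite ge_min lexx.
have dr : d <= (r - l) / 4 by rewrite ge_min lexx orbT.
rewrite JE; have [x1|x1] := leP x (l + d).
  exists x, (r - d); rewrite (inJ (r - d)); [|lra|lra].
  by split; [exact: xJ| |lra|apply/andP; split; lra|rewrite lee_fin; lra].
have [x2|x2] := leP (r - d) x.
  exists (l + d), x; rewrite (inJ (l + d)); [|lra|lra].
  by split; [|exact: xJ|lra|apply/andP; split; lra|rewrite lee_fin; lra].
exists (l + d), (r - d); rewrite !inJ; [|lra..].
by split; [| |lra|apply/andP; split; lra|rewrite lee_fin; lra].
Qed.

Lemma itv_interior J (a x b : R) : a \in J -> b \in J -> a < x -> x < b ->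
  [set` J]^° x.
Proof.
move=> aJ bJ ax xb; apply/nbhs_ballP; exists (Num.min (x - a) (b - x)).
  by rewrite /= lt_min; apply/andP; split; lra.
move=> y; rewrite /ball/= lt_min => /andP[]; rewrite !ltr_distl => h1 h2.
by apply: (interval_is_interval aJ bJ); lra.
Qed.

(** A point of [J] that is neither its least nor its greatest element is interior. *)
Lemma itv_boundary_countable J : countable ([set` J] `\` [set` J]^°).
Proof.
have one (A : set R) : (forall x y, A x -> A y -> x = y) -> countable A.
  move=> A1; have [[x Ax]|no] := pselect (exists x, A x).
    apply: (@sub_countable _ _ _ [set x]); last exact: countable1.
    by apply: subset_card_le => y Ay /=; exact: A1.
  rewrite (_ : A = set0); first exact: countable0.
  by apply/seteqP; split => // x Ax; apply: no; exists x.
pose mn := [set x | x \in J /\ forall y, y \in J -> x <= y].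
pose mx := [set x | x \in J /\ forall y, y \in J -> y <= x].
apply: (@sub_countable _ _ _ (mn `|` mx)).
  apply: subset_card_le => x [/= xJ nx].
  have [xmin|nmin] := pselect (forall y, y \in J -> x <= y); first by left.
  right; split => // z zJ; rewrite leNgt; apply/negP => xz; apply: nmin => y yJ.
  by rewrite leNgt; apply/negP => yx; apply: nx; exact: itv_interior yJ zJ yx xz.
apply: countable_setU.
- by apply: one => x y [xJ xm] [yJ ym]; apply/eqP; rewrite eq_le xm// ym.
- by apply: one => x y [xJ xm] [yJ ym]; apply/eqP; rewrite eq_le xm// ym.
Qed.

(** A bound off a countable set would bound the integral. With [Z] the discontinuities of [u], the
    witness is an interior continuity point. *)
Lemma itv_integral_exists_gt J u (Z : set R) (t : R) :
  mu.-integrable [set` J] (EFin \o u) -> (mu [set` J] < +oo)%E -> countable Z ->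
  (t%:E * mu [set` J] < \int[mu]_(x in [set` J]) (u x)%:E)%E ->
  exists z, [/\ z \in J, [set` J]^° z, ~ Z z & t < u z].
Proof.
move=> uint Jfin cZ; rewrite ltNge => /negP H; apply: contrapT => no; apply: H.
apply: (integral_le_off_countable (Z := Z `|` ([set` J] `\` [set` J]^°))) => //.
  by apply: countable_setU => //; exact: itv_boundary_countable.
move=> x /= xJ /not_orP[Zx Jx]; rewrite leNgt; apply/negP => tu; apply: no.
by exists x; split => //; apply: contrapT => Jx'; apply: Jx.
Qed.

Lemma itv_integral_exists_lt J u (Z : set R) (t : R) :
  mu.-integrable [set` J] (EFin \o u) -> (mu [set` J] < +oo)%E -> countable Z ->
  (\int[mu]_(x in [set` J]) (u x)%:E < t%:E * mu [set` J])%E ->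
  exists z, [/\ z \in J, [set` J]^° z, ~ Z z & u z < t].
Proof.
move=> uint Jfin cZ H.
have Nint : mu.-integrable [set` J] (EFin \o (\- u)).
  by have := integrableN uint; congr (mu.-integrable _ _); apply/funext.
have [|z [zJ Jz Zz]] := @itv_integral_exists_gt J (\- u) Z (- t) Nint Jfin cZ.
  have -> : (\int[mu]_(x in [set` J]) ((\- u) x)%:E = - \int[mu]_(x in [set` J]) (u x)%:E)%E.
    rewrite -integralN; first by apply: eq_integral => x _; rewrite /= EFinN.
    exact: integrable_add_def.
  by rewrite EFinN mulNe lteN2.
by rewrite /= ltrN2 => uz; exists z.
Qed.

Lemma average_gt J u (t : R) : nondegenerate_itv J -> (mu [set` J] < +oo)%E ->
  mu.-integrable [set` J] (EFin \o u) ->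
  (t%:E < (mu [set` J])^-1 * \int[mu]_(x in [set` J]) (u x)%:E)%E =
  (t%:E * mu [set` J] < \int[mu]_(x in [set` J]) (u x)%:E)%E.
Proof.
move=> nd fin uint; have [l l0 ->] := nondegenerate_itv_length nd fin.
have /fineK <- := @integrable_fin_num _ _ _ mu _ (measurable_itv J) _ uint.
by rewrite inver gt_eqF// -!EFinM !lte_fin mulrC ltr_pdivlMr.
Qed.

Lemma average_lt J u (t : R) : nondegenerate_itv J -> (mu [set` J] < +oo)%E ->
  mu.-integrable [set` J] (EFin \o u) ->
  ((mu [set` J])^-1 * \int[mu]_(x in [set` J]) (u x)%:E < t%:E)%E =
  (\int[mu]_(x in [set` J]) (u x)%:E < t%:E * mu [set` J])%E.
Proof.
move=> nd fin uint; have [l l0 ->] := nondegenerate_itv_length nd fin.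
have /fineK <- := @integrable_fin_num _ _ _ mu _ (measurable_itv J) _ uint.
by rewrite inver gt_eqF// -!EFinM !lte_fin mulrC ltr_pdivrMr.
Qed.

End interval_averages.

(** * The maximal function of a function of bounded variation *)

Section maximal_function.
Context {R : realType}.
Local Notation mu := (@lebesgue_measure R).
Variables (I : interval R) (f : R -> R) (M : R).
Hypothesis ndI : nondegenerate_itv I.
Hypothesis fM : forall s, sorted <%R s -> {in s, forall x, x \in I} ->
  gap_sum (jump f) s <= M.

Let h (x : R) : R := `|f x|.

Lemma gap_sum_le_pointwise (g g' : R -> R -> R) s :
  (forall a b, g a b <= g' a b) -> gap_sum g s <= gap_sum g' s.
Proof.
move=> gg'; case: s => //= x s; elim: s x => //= y s IH x.
exact: lerD.
Qed.

Lemma abs_bv s : sorted <%R s -> {in s, forall x, x \in I} -> gap_sum (jump h) s <= M.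
Proof.
move=> ss sI; apply: le_trans (fM ss sI); apply: gap_sum_le_pointwise => a b.
by rewrite /jump /h ler_dist_dist.
Qed.

(** The countable set on which the crossings of [|f|] are counted. It is large enough, since bounds
    at rational points carry over to continuity points and hence to averages. *)
Definition rational_points : set R := [set x | x \in I /\ exists q : rat, x = ratr q].

Lemma countable_rational_points : countable rational_points.
Proof.
apply: (@sub_countable _ _ _ (range (@ratr R))); last first.
  by apply: (sub_countable (card_image_le _ _)); exact: countableP.
by apply: subset_card_le => x [_ [q ->]]; exists q.
Qed.

Lemma small_subinterval x (d : R) : x \in I -> 0 < d ->
  exists a b, [/\ a \in I, b \in I, a < b, a <= x <= b & b - a < d].
Proof.
move=> xI d0; have [p [q [pI qI pq]]] := ndI.
have cvx a b z : a \in I -> b \in I -> a <= z -> z <= b -> z \in I.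
  by move=> aI bI az zb; apply: (interval_is_interval aI bI); rewrite az.
have [xq|qx] := ltP x q.
  exists x, (Num.min q (x + d / 2)); have m1 : Num.min q (x + d / 2) <= q by rewrite ge_min lexx.
  have m2 : Num.min q (x + d / 2) <= x + d / 2 by rewrite ge_min lexx orbT.
  have m3 : x < Num.min q (x + d / 2) by rewrite lt_min xq; lra.
  by split; [| apply: (cvx x q) => //; exact: ltW| |rewrite lexx ltW|lra].
exists (Num.max p (x - d / 2)), x; have m1 : p <= Num.max p (x - d / 2) by rewrite le_max lexx.
have m2 : x - d / 2 <= Num.max p (x - d / 2) by rewrite le_max lexx orbT.
have m3 : Num.max p (x - d / 2) < x by rewrite gt_max; apply/andP; split; lra.
by split; [apply: (cvx p x) => //; exact: ltW| | |rewrite lexx ltW|lra].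
Qed.

Lemma closed_averaging_interval a b x : a \in I -> b \in I -> a < b -> a <= x <= b ->
  averaging_intervals I x `[a, b].
Proof.
move=> aI bI ab axb; split.
- by exists a, b; rewrite !in_itv/= !lexx (ltW ab).
- by rewrite in_itv.
- exact: closed_sub_itv.
- by rewrite lebesgue_measure_cc ?ltry// ltW.
Qed.

Lemma small_averaging_interval x (d : R) : x \in I -> 0 < d ->
  exists2 J, averaging_intervals I x J & (mu [set` J] < d%:E)%E.
Proof.
move=> xI d0; have [a [b [aI bI ab axb bad]]] := small_subinterval xI d0.
exists `[a, b]; first exact: closed_averaging_interval.
by rewrite lebesgue_measure_cc ?lte_fin// ltW.
Qed.

(** An extended real bound on the length treats both maximal functions at once: [+oo] gives the
    global one, [r%:E] the local one. *)
Definition bounded_maximal (rho : \bar R) (x : R) : \bar R :=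
  ereal_sup [set iavg f [set` J] |
    J in [set J | averaging_intervals I x J /\ (mu [set` J] <= rho)%E]].

Lemma maximal_funE : maximal_fun I f = bounded_maximal +oo%E.
Proof.
apply/funext => x; rewrite /maximal_fun /bounded_maximal; congr (ereal_sup (image _ _)).
by apply/seteqP; split => [J HJ|J []//]; split => //; exact: leey.
Qed.

Let hint J x : averaging_intervals I x J -> mu.-integrable [set` J] (EFin \o h).
Proof. by case=> _ _ JI Jfin; apply: (bv_integrable abs_bv). Qed.

Let fint J x : averaging_intervals I x J -> mu.-integrable [set` J] (EFin \o f).
Proof. by case=> _ _ JI Jfin; apply: (bv_integrable fM). Qed.

Lemma iavgE (J : interval R) : iavg f [set` J] =
  ((mu [set` J])^-1 * \int[mu]_(x in [set` J]) (h x)%:E)%E.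
Proof. by []. Qed.

Lemma bounded_iavg : exists2 C : R, 0 < C & (forall x, x \in I -> `|f x| <= C) /\
  forall (J : interval R) x, averaging_intervals I x J -> (iavg f [set` J] <= C%:E)%E.
Proof.
have [C C0 fC] := bv_bounded fM; exists C => //; split => // J x HJ.
have [nd xJ JI Jfin] := HJ; rewrite leNgt iavgE average_gt//; last exact: hint HJ.
apply/negP => /(itv_integral_exists_gt (hint HJ) Jfin (@countable0 R)).
by move=> [z [zJ _ _]]; apply/negP; rewrite -leNgt; apply: fC; exact: JI.
Qed.

Variable rho : \bar R.
Hypothesis rho0 : (0 < rho)%E.

Let small_rho : exists2 r : R, 0 < r & (r%:E <= rho)%E.
Proof.
case: rho rho0 => [r r0| |//]; first by exists r.
by move=> _; exists 1 => //; exact: leey.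
Qed.

Lemma bounded_maximal_fin x : x \in I -> bounded_maximal rho x \is a fin_num.
Proof.
move=> xI; have [C C0 [_ HC]] := bounded_iavg; have [r r0 rrho] := small_rho.
rewrite fin_numElt; apply/andP; split.
  have [J HJ Jr] := small_averaging_interval xI r0.
  apply: (@lt_le_trans _ _ (iavg f [set` J])).
    by apply: lt_le_trans (iavg_ge0 _ _); exact: ltNyr.
  by apply: ereal_sup_ubound; exists J => //; split => //; exact: le_trans (ltW Jr) rrho.
apply: (@le_lt_trans _ _ C%:E); last exact: ltry.
by apply: ge_ereal_sup => _ [J [HJ _] <-]; exact: HC HJ.
Qed.

Let F x := fine (bounded_maximal rho x).

Let S a b : R := (\int[mu]_(x in `[a, b]) h x)%R.

Let SE a b : a \in I -> b \in I -> a <= b ->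
  (\int[mu]_(x in `[a, b]) (h x)%:E = (S a b)%:E)%E.
Proof.
move=> aI bI ab; rewrite /S /Rintegral fineK//.
apply: (@integrable_fin_num _ _ _ mu _ (measurable_itv `[a, b])).
apply: (bv_integrable abs_bv); first exact: closed_sub_itv.
by rewrite lebesgue_measure_cc ?ltry.
Qed.

Let hcc a b : a \in I -> b \in I -> a <= b -> mu.-integrable `[a, b] (EFin \o h).
Proof.
move=> aI bI ab; apply: (bv_integrable abs_bv); first exact: closed_sub_itv.
by rewrite lebesgue_measure_cc ?ltry.
Qed.

Let SD a b c : a \in I -> c \in I -> a <= b -> b <= c -> S a c = S a b + S b c.
Proof.
move=> aI cI ab bc; have bI : b \in I by apply: (interval_is_interval aI cI); rewrite ab.
have := @Rintegral_itvB R h (BLeft a) (BRight c) b (hcc aI cI (le_trans ab bc)).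
rewrite !bnd_simp => /(_ ab bc) E.
have oint : mu.-integrable `]b, c] (EFin \o h).
  apply: (bv_integrable abs_bv).
    by apply: subset_trans (closed_sub_itv bI cI); apply: subset_itvr; rewrite bnd_simp.
  apply: (@le_lt_trans _ _ (mu `[b, c])); last by rewrite lebesgue_measure_cc ?ltry.
  by apply: le_lebesgue_measure => //; apply: subset_itvr; rewrite bnd_simp.
by rewrite Rintegral_itv_obnd_cbnd// -/(S a c) -/(S a b) -/(S b c) in E; lra.
Qed.

Let S_ge0 a b : 0 <= S a b.
Proof. by apply: Rintegral_ge0 => x _; exact: normr_ge0. Qed.

Let S_leC (C : R) : (forall x, x \in I -> `|f x| <= C) ->
  forall a b, a \in I -> b \in I -> a <= b -> 0 <= S a b <= C * (b - a).
Proof.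
move=> fC a b aI bI ab; rewrite S_ge0/= -lee_fin -SE// EFinM -lebesgue_measure_cc//.
apply: (integral_le_off_countable (Z := set0)) => //; first by rewrite lebesgue_measure_cc ?ltry.
  exact: hcc.
by move=> x xab _; apply: fC; exact: closed_sub_itv xab.
Qed.

Let rational_near a z b (d : R) : a \in I -> b \in I -> a < z -> z < b -> 0 < d ->
  exists q, [/\ rational_points q, a < q < b & `|q - z| < d].
Proof.
move=> aI bI az zb d0.
have [q] : exists q : rat, ratr q \in `]z, (Num.min b (z + d))[.
  by apply: rat_in_itvoo; rewrite lt_min zb; lra.
rewrite in_itv/= lt_min => /andP[zq /andP[qb qd]]; exists (ratr q).
have aqb : a < ratr q < b by rewrite (lt_trans az zq).
split => //; last by rewrite gtr0_norm; lra.
split; last by exists q.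
by apply: (interval_is_interval aI bI); case/andP: aqb => /ltW -> /ltW.
Qed.

(** An integral above [t * (b - a)] would force [h > t] at an interior continuity point, hence at a
    nearby rational point. *)
Let S_le a b t : a \in I -> b \in I -> a < b ->
  (forall q, rational_points q -> a < q < b -> h q <= t) -> S a b <= t * (b - a).
Proof.
move=> aI bI ab H; have ab' := ltW ab; have [Z cZ Zf] := bv_continuity_points abs_bv.
rewrite -lee_fin -SE// EFinM -lebesgue_measure_cc// leNgt; apply/negP.
have fin : (mu `[a, b] < +oo)%E by rewrite lebesgue_measure_cc ?ltry.
move=> /(itv_integral_exists_gt (hcc aI bI (ltW ab)) fin cZ)[z [_ zab Zz tz]].
have zI : [set` I]^° z by apply: interiorS zab; exact: closed_sub_itv.
move: zab; rewrite interior_itv_bnd /= in_itv/= => /andP[az zb].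
have tz0 : 0 < h z - t by lra.
have [d d0 Hd] := Zf z zI Zz _ tz0.
have [q [qD aqb qz]] := rational_near aI bI az zb d0.
by have := H q qD aqb; have := Hd _ qz; rewrite ltr_distl; lra.
Qed.

Let S_ge a b t : a \in I -> b \in I -> a < b ->
  (forall q, rational_points q -> a < q < b -> t <= h q) -> t * (b - a) <= S a b.
Proof.
move=> aI bI ab H; have ab' := ltW ab; have [Z cZ Zf] := bv_continuity_points abs_bv.
rewrite -lee_fin -SE// EFinM -lebesgue_measure_cc// leNgt; apply/negP.
have fin : (mu `[a, b] < +oo)%E by rewrite lebesgue_measure_cc ?ltry.
move=> /(itv_integral_exists_lt (hcc aI bI (ltW ab)) fin cZ)[z [_ zab Zz tz]].
have zI : [set` I]^° z by apply: interiorS zab; exact: closed_sub_itv.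
move: zab; rewrite interior_itv_bnd /= in_itv/= => /andP[az zb].
have tz0 : 0 < t - h z by lra.
have [d d0 Hd] := Zf z zI Zz _ tz0.
have [q [qD aqb qz]] := rational_near aI bI az zb d0.
by have := H q qD aqb; have := Hd _ qz; rewrite ltr_distl; lra.
Qed.

Let average_leF a b x : a \in I -> b \in I -> a < b -> ((b - a)%:E <= rho)%E ->
  a <= x <= b -> S a b <= F x * (b - a).
Proof.
move=> aI bI ab abrho axb; have ab' := ltW ab.
have xI : x \in I by apply: (interval_is_interval aI bI).
have HJ := closed_averaging_interval aI bI ab axb; have [nd _ _ fin] := HJ.
have : (iavg f [set` `[a, b]] <= (F x)%:E)%E.
  rewrite /F fineK ?bounded_maximal_fin//; apply: ereal_sup_ubound.
  by exists `[a, b] => //; split => //; rewrite lebesgue_measure_cc.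
rewrite -lee_fin leNgt iavgE => /negP H; rewrite leNgt; apply/negP => H1; apply: H.
rewrite average_gt//; last exact: hcc (ltW ab).
by rewrite lebesgue_measure_cc// SE.
Qed.

Let F_ltP x t : x \in I -> t < F x -> exists a b,
  [/\ a \in I, b \in I, a < b, ((b - a)%:E <= rho)%E & a <= x <= b] /\
  t * (b - a) < S a b.
Proof.
(* For negative [t] any short interval will do, as [S] is nonnegative. Otherwise [[a, b]] is taken
   inside an interval [J] of length [l], and [t * (b - a) <= t * l] relies on the sign of [t]. *)
move=> xI tF; have [t0|t0] := ltP t 0.
  have [r r0 rrho] := small_rho.
  have [a [b [aI bI ab axb bar]]] := small_subinterval xI r0.
  exists a, b; split; first by split => //; apply: le_trans rrho; rewrite lee_fin ltW.
  by apply: lt_le_trans (S_ge0 a b); rewrite nmulr_rlt0// subr_gt0.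
have : (t%:E < bounded_maximal rho x)%E.
  by rewrite -(fineK (bounded_maximal_fin xI)) lte_fin.
move=> /ereal_sup_gt[_ [J [HJ Jrho] <-]].
have [nd xJ JI fin] := HJ; rewrite iavgE average_gt//; last exact: hint HJ.
have [C C0 [fC _]] := bounded_iavg.
have [l l0 El] := nondegenerate_itv_length nd fin.
have /fineK Efin := @integrable_fin_num _ _ _ mu _ (measurable_itv J) _ (hint HJ).
set s := fine _ in Efin; rewrite El -Efin -EFinM lte_fin => ts.
(* Discarding a part of [J] of measure at most [e] loses at most [C * e] of the integral, which is
   half of the slack. *)
pose e := (s - t * l) / (2 * C).
have e0 : 0 < e by rewrite divr_gt0//; lra.
have [a [b [aJ bJ ab axb abe]]] := itv_inner_approximation nd fin xJ e0.
have ab' := ltW ab; have aI := JI _ aJ; have bI := JI _ bJ.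
rewrite El lee_fin in abe.
have lba : b - a <= l by rewrite -lee_fin -El; apply: itv_length_ge => //; exact: ltW.
exists a, b; split.
  by split => //; apply: le_trans Jrho; rewrite El lee_fin.
have mc : measurable ([set` J] `\` `[a, b]) by exact: measurableD.
have Jab : [set` J] = `[a, b]%classic `|` ([set` J] `\` `[a, b]%classic).
  by rewrite setDUK//; exact: closed_sub_itv.
have sE : (s%:E = (S a b)%:E + \int[mu]_(x in [set` J] `\` `[a, b]) (h x)%:E)%E.
  rewrite -SE// Efin {1}Jab (@ge0_integral_setU _ _ _ mu _ _ (measurable_itv _) mc)//.
  - by rewrite -Jab; exact: (measurable_int mu (hint HJ)).
  - by move=> y _; rewrite lee_fin normr_ge0.
  - by apply/disj_setPS => y [yab [_ /(_ yab)]].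
have cint : (\int[mu]_(x in [set` J] `\` `[a, b]) (h x)%:E <= (C * e)%:E)%E.
  apply: (@le_trans _ _ (C%:E * mu ([set` J] `\` `[a, b]))%E).
    apply: (integral_le_off_countable (Z := set0)) => //.
    - by apply: le_lt_trans fin; apply: le_lebesgue_measure => // y [].
    - by apply: (@integrableS _ _ _ mu _ _ _ (measurable_itv J) mc _ (hint HJ)) => y [].
    - by move=> y [yJ _] _; apply: fC; exact: JI.
  rewrite EFinM; apply: lee_wpmul2l; first by rewrite lee_fin ltW.
  have : (mu [set` J] = mu ([set` J] `\` `[a, b]) + mu ([set` J] `&` `[a, b]))%E.
    by apply: measureDI; exact: measurable_itv.
  rewrite El setIidr; last exact: closed_sub_itv.
  rewrite lebesgue_measure_cc//.
  have := measure_ge0 mu ([set` J] `\` `[a, b]).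
  case: (mu ([set` J] `\` `[a, b])) => [m _ [E]| |//]; last by rewrite addye.
  by rewrite lee_fin; lra.
have : (s%:E <= (S a b + C * e)%:E)%E by rewrite sE EFinD leeD2l.
rewrite lee_fin; have -> : C * e = (s - t * l) / 2 by rewrite /e; field; lra.
have : t * (b - a) <= t * l by rewrite ler_wpM2l.
lra.
Qed.

Let canonical_inf x : \bar R := ereal_inf [set ereal_sup
  [set ((mu [set` J])^-1 * \int[mu]_(y in [set` J]) (f y)%:E)%E |
    J in [set J | averaging_intervals I x J /\ (mu [set` J] < d%:E)%E]] |
  d in [set d : R | 0 < d]].

Let canonical_representativeE x : canonical_representative I f x = fine (canonical_inf x).
Proof. by []. Qed.

Lemma average_le_iavg (J : interval R) x : averaging_intervals I x J ->
  (`|(mu [set` J])^-1 * \int[mu]_(y in [set` J]) (f y)%:E| <= iavg f [set` J])%E.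
Proof.
move=> HJ; have [nd xJ JI fin] := HJ.
have [l l0 El] := nondegenerate_itv_length nd fin.
rewrite iavgE El inver gt_eqF// abseM gee0_abs ?lee_fin ?invr_ge0 ?(ltW l0)//.
apply: lee_wpmul2l; first by rewrite lee_fin invr_ge0 ltW.
apply: (@le_abse_integral _ _ _ mu _ (fun y => (f y)%:E)); first exact: measurable_itv.
exact: (measurable_int mu (fint HJ)).
Qed.

Let canonical_bounds x (B : R) : x \in I ->
  (forall J, averaging_intervals I x J -> (mu [set` J] <= rho)%E -> (iavg f [set` J] <= B%:E)%E) ->
  ((- B)%:E <= canonical_inf x <= B%:E)%E.
Proof.
move=> xI HB; have [r r0 rrho] := small_rho.
have bnd J : averaging_intervals I x J -> (mu [set` J] < r%:E)%E ->
    ((- B)%:E <= (mu [set` J])^-1 * \int[mu]_(y in [set` J]) (f y)%:E <= B%:E)%E.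
  move=> HJ Jr; have := le_trans (average_le_iavg HJ) (HB J HJ (le_trans (ltW Jr) rrho)).
  by case: (_ * _)%E => // a; rewrite abse_EFin !lee_fin ler_norml.
apply/andP; split.
  apply: le_ereal_inf_tmp => _ [d /= d0 <-].
  have dr0 : 0 < Num.min d r by rewrite lt_min d0.
  have [J HJ Jd] := small_averaging_interval xI dr0.
  have /andP[+ _] : ((- B)%:E <= (mu [set` J])^-1 * \int[mu]_(y in [set` J]) (f y)%:E <= B%:E)%E.
    by apply: bnd => //; apply: lt_le_trans Jd _; rewrite lee_fin ge_min lexx orbT.
  move=> /le_trans; apply; apply: ereal_sup_ubound; exists J => //; split => //.
  by apply: lt_le_trans Jd _; rewrite lee_fin ge_min lexx.
apply: (@le_trans _ _ (ereal_sup
    [set ((mu [set` J])^-1 * \int[mu]_(y in [set` J]) (f y)%:E)%E |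
      J in [set J | averaging_intervals I x J /\ (mu [set` J] < r%:E)%E]])).
  by apply: ereal_inf_lbound; exists r.
by apply: ge_ereal_sup => _ [J [HJ Jr] <-]; have /andP[] := bnd J HJ Jr.
Qed.

Let canonical_fin x : x \in I -> canonical_inf x \is a fin_num.
Proof.
move=> xI; have [C C0 [_ HC]] := bounded_iavg.
have /andP[h1 h2] := canonical_bounds xI (fun J HJ _ => HC J x HJ).
by rewrite fin_numElt (lt_le_trans (ltNyr _) h1) (le_lt_trans h2 (ltry _)).
Qed.

Lemma canonical_le_maximal x : x \in I -> `|canonical_representative I f x| <= F x.
Proof.
move=> xI; have := @canonical_bounds x (F x) xI.
rewrite canonical_representativeE -(fineK (canonical_fin xI)) !lee_fin -ler_norml; apply.
move=> J HJ Jrho; rewrite /F fineK ?bounded_maximal_fin//; apply: ereal_sup_ubound.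
by exists J.
Qed.

(** A limsup above [t] yields arbitrarily short intervals around [x] with average above [t], and [f]
    exceeds [t] inside such an interval, off any given countable set. *)
Lemma canonical_peak (Z : set R) x (t e : R) : countable Z -> x \in I ->
  t < canonical_representative I f x -> 0 < e ->
  exists z, [/\ [set` I]^° z, ~ Z z, t < f z & `|z - x| < e].
Proof.
move=> cZ xI tx e0.
have tinf : (t%:E < canonical_inf x)%E.
  by rewrite -(fineK (canonical_fin xI)) lte_fin.
have /(lt_le_trans tinf) : (canonical_inf x <= ereal_sup
    [set ((mu [set` J])^-1 * \int[mu]_(y in [set` J]) (f y)%:E)%E |
      J in [set J | averaging_intervals I x J /\ (mu [set` J] < e%:E)%E]])%E.
  by apply: ereal_inf_lbound; exists e.
move=> /ereal_sup_gt[_ [J [HJ Je] <-]]; have [nd xJ JI fin] := HJ.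
rewrite average_gt//; last exact: fint HJ.
move=> /(itv_integral_exists_gt (fint HJ) fin cZ)[z [zJ Jz Zz tz]].
by exists z; split => //; [exact: interiorS JI _ Jz|exact: itv_dist_le xJ zJ Je].
Qed.

Lemma canonical_valley (Z : set R) x (t e : R) : countable Z -> x \in I ->
  canonical_representative I f x < t -> 0 < e ->
  exists z, [/\ [set` I]^° z, ~ Z z, f z < t & `|z - x| < e].
Proof.
move=> cZ xI tx e0.
have : (canonical_inf x < t%:E)%E.
  by rewrite -(fineK (canonical_fin xI)) lte_fin.
move=> /ereal_inf_lt[_ [d /= d0 <-] supt].
have de0 : 0 < Num.min d e by rewrite lt_min d0.
have [J HJ Jde] := small_averaging_interval xI de0.
have Jd : (mu [set` J] < d%:E)%E.
  by apply: lt_le_trans Jde _; rewrite lee_fin ge_min lexx.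
have Je : (mu [set` J] < e%:E)%E.
  by apply: lt_le_trans Jde _; rewrite lee_fin ge_min lexx orbT.
have [nd xJ JI fin] := HJ.
have : ((mu [set` J])^-1 * \int[mu]_(y in [set` J]) (f y)%:E < t%:E)%E.
  by apply: le_lt_trans supt; apply: ereal_sup_ubound; exists J.
rewrite average_lt//; last exact: fint HJ.
move=> /(itv_integral_exists_lt (fint HJ) fin cZ)[z [zJ Jz Zz tz]].
by exists z; split => //; [exact: interiorS JI _ Jz|exact: itv_dist_le xJ zJ Je].
Qed.

Lemma canonical_at_continuity z : [set` I]^° z -> continuity_at f z ->
  canonical_representative I f z = f z.
Proof.
move=> Iz fz; have zI : z \in I by exact: interior_subset Iz.
case: (ltgtP (canonical_representative I f z) (f z)) => // fb; exfalso.
  pose e := (f z - canonical_representative I f z) / 2.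
  have e0 : 0 < e by rewrite /e; lra.
  have [d d0 Hd] := fz _ e0.
  have [|y [_ _ fy yz]] := @canonical_valley set0 z (f z - e) d (@countable0 R) zI _ d0.
    by rewrite /e; lra.
  by have := Hd _ yz; rewrite ltr_distl; lra.
pose e := (canonical_representative I f z - f z) / 2.
have e0 : 0 < e by rewrite /e; lra.
have [d d0 Hd] := fz _ e0.
have [|y [_ _ fy yz]] := @canonical_peak set0 z (f z + e) d (@countable0 R) zI _ d0.
  by rewrite /e; lra.
by have := Hd _ yz; rewrite ltr_distl; lra.
Qed.

Lemma points_away (ws : seq R) (x : R) : x \notin ws ->
  exists2 e : R, 0 < e & {in ws, forall w, e <= `|w - x|}.
Proof.
elim: ws => [|w ws IH]; first by exists 1.
rewrite inE negb_or => /andP[xw /IH[e e0 He]].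
exists (Num.min e `|w - x|); first by rewrite lt_min e0 normr_gt0 subr_eq0 eq_sym.
move=> y; rewrite inE => /orP[/eqP ->|/He]; first by rewrite ge_min lexx orbT.
by apply: le_trans; rewrite ge_min lexx.
Qed.

(** Peaks and valleys of the canonical representative can both be moved by arbitrarily little to
    interior points off [Z], where [f] takes nearly the same or more extreme values. With [Z] the
    discontinuities, only continuity points of [f] are left to estimate. *)
Lemma canonical_variation_le (Z : set R) (B : R) : countable Z ->
  (forall s, sorted <%R s -> {in s, forall z, [set` I]^° z /\ ~ Z z} ->
     gap_sum (jump f) s <= B) ->
  forall s, sorted <%R s -> {in s, forall x, x \in I} ->
    gap_sum (jump (canonical_representative I f)) s <= B.
Proof.
move=> cZ HB; apply: (@variation_comparison _ _ f [set` I]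
  (fun z => [set` I]^° z /\ ~ Z z)) => //.
- move=> x t ws xI tx Hws.
  have xws : x \notin ws by apply/negP => /Hws[_]; rewrite leNgt tx.
  have [e e0 He] := points_away xws.
  have [z [Iz Zz tz zx]] := canonical_peak cZ xI tx e0.
  exists z; split => // w /He; move: zx; rewrite ltr_distl => /andP[z1 z2] we.
  split=> wx; move: we; [rewrite ltr0_norm|rewrite gtr0_norm]; lra.
- move=> x t e xI xt e0; have [z [Iz Zz tz zx]] := canonical_valley cZ xI xt e0.
  by exists z.
Qed.

Lemma maximal_variation_le (B : R) :
  (forall s, sorted <%R s -> {in s, forall x, x \in I} ->
     gap_sum (jump (canonical_representative I f)) s <= B) ->
  forall s, sorted <%R s -> {in s, forall x, x \in I} -> gap_sum (jump F) s <= B.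
Proof.
move=> HB; apply: (@variation_comparison _ _ (fun x => `|canonical_representative I f x|)
  [set` I] [set` I]) => //.
- move=> x t ws xI /(F_ltP xI)[a [b [[aI bI ab abrho /andP[ax xb]] tS]]] Hws.
  have [Z cZ Zf] := bv_continuity_points fM; have ab' := ltW ab.
  have fin : (mu `[a, b] < +oo)%E by rewrite lebesgue_measure_cc ?ltry.
  have : (t%:E * mu `[a, b] < \int[mu]_(y in `[a, b]) (h y)%:E)%E.
    by rewrite lebesgue_measure_cc// SE.
  move=> /(itv_integral_exists_gt (hcc aI bI ab') fin cZ)[z [zab zint Zz tz]].
  have zI : [set` I]^° z by apply: interiorS zint; exact: closed_sub_itv.
  exists z; split; first exact: interior_subset zI.
    by rewrite canonical_at_continuity//; exact: Zf.
  move=> w /Hws[wI Fw]; have wab : ~ (a <= w <= b).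
    move=> wab; have := average_leF aI bI ab abrho wab.
    have : F w * (b - a) <= t * (b - a) by rewrite ler_wpM2r//; lra.
    lra.
  move: zab; rewrite in_itv/= => /andP[az zb].
  by split=> wx; rewrite ltNge; apply/negP => ?; apply: wab; apply/andP; split; lra.
- move=> x t e xI Fxt e0; exists x; split => //; last by rewrite subrr normr0.
  by rewrite (le_lt_trans _ Fxt)// canonical_le_maximal.
- move=> s ss sI; apply: le_trans (HB s ss sI); apply: gap_sum_le_pointwise => a b.
  exact: ler_dist_dist.
Qed.

Lemma maximal_abs_continuous (B : R) :
  (forall s, sorted <%R s -> {in s, forall x, x \in I} -> gap_sum (jump F) s <= B) ->
  forall e : R, 0 < e -> exists2 d : R, 0 < d &
    forall U : set R, measurable U -> (mu U < d%:E)%E ->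
    forall s, sorted <%R s -> {in s, forall x, x \in I} ->
      gap_sum (weighted_jump (inside U) F) s <= e.
Proof.
move=> FB; have [C C0 [fC _]] := bounded_iavg; have [r r0 rrho] := small_rho.
have adm_r l : l <= r -> (l%:E <= rho)%E by move=> lr; apply: le_trans rrho; rewrite lee_fin.
have Iitv : is_interval [set` I] by exact: interval_is_interval.
have DI : rational_points `<=` [set` I] by move=> x [].
have [N Nint HN] := indicatrix_integrable (M := M) countable_rational_points
  (fun s ss sD => abs_bv ss (fun x xs => DI _ (sD x xs))).
(* The exceptional levels are those where the dominating indicatrix of [|f|] is infinite. At any
   other level [F x] the crossings of [|f|] are bounded in number, and their counting function is
   the [w] of [maximal_lipschitz]. *)
apply: (@lusin_abs_continuous _ [set` I] F B (~` [set y | setT y -> N y \is a fin_num])).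
- exact: Iitv.
- exact: FB.
- have [vnd vM hv] := bv_control abs_bv.
  move=> x e xI e0; apply: (@maximal_continuous _ [set` I] S C r
    (fun l => (l%:E <= rho)%E) F Iitv SD (S_leC fC) r0 adm_r average_leF F_ltP
    h rational_points S_le S_ge DI _ M x e _ vnd vM xI e0).
  by move=> p q pD qD pq; apply: hv; [exact: DI|exact: DI|exact: ltW].
- exact: (integrable_ae _ Nint).
- move=> x xI /contrapT /(_ Logic.I) Ny near.
  pose J := jump (above h (F x)).
  have J0 a b : 0 <= J a b by exact: jump_ge0.
  have JM s : sorted <%R s -> {in s, forall x, rational_points x} ->
      gap_sum J s <= fine (N (F x)).
    by move=> ss sD; rewrite -lee_fin fineK//; exact: HN.
  apply: (@maximal_lipschitz _ [set` I] S C r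
    (fun l => (l%:E <= rho)%E) F Iitv SD (S_leC fC) r0 adm_r average_leF F_ltP
    h rational_points S_le S_ge x (control_fun J rational_points) (fine (N (F x))) xI) => //.
  + move=> p q pD qD pq; rewrite lerBrDl.
    apply: (control_fun_step (M := fine (N (F x)))) => //; exact: jump_subadditive.
  + by apply: (control_fun_nd (M := fine (N (F x)))).
  + move=> z; rewrite (control_fun_ge0 (M := fine (N (F x))))//=.
    exact: control_fun_le.
Qed.

End maximal_function.

(** * Measures of monotone functions *)

Section monotone_measure.
Context {R : realType}.
Variables (I : interval R) (p : R -> R) (m C : R).
Hypothesis pnd : {in I &, {homo p : x y / x <= y}}.
Hypothesis pmC : forall x, x \in I -> m <= p x <= C.
Hypothesis mC : m <= C.

(* The right limit [p (x+)], extended by [C] past the right end of [I]. *)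
Definition right_limit (x : R) : R :=
  inf ([set p y | y in [set y | y \in I /\ x < y]] `|` [set C]).

Let lbm x : has_lbound ([set p y | y in [set y | y \in I /\ x < y]] `|` [set C]).
Proof. by exists m => _ [[y [yI _] <-]|->//]; have /andP[] := pmC yI. Qed.

Let ne x : ([set p y | y in [set y | y \in I /\ x < y]] `|` [set C]) !=set0.
Proof. by exists C; right. Qed.

Lemma right_limit_bounds x : m <= right_limit x <= C.
Proof.
apply/andP; split; last by apply: ge_inf => //; right.
by apply: lb_le_inf => // _ [[y [yI _] <-]|->//]; have /andP[] := pmC yI.
Qed.

Lemma right_limit_le x y : y \in I -> x < y -> right_limit x <= p y.
Proof. by move=> yI xy; apply: ge_inf => //; left; exists y. Qed.

Lemma right_limit_nondecreasing : {homo right_limit : x y / x <= y}.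
Proof.
move=> x y xy; apply: lb_le_inf => // _ [[z [zI yz] <-]|->].
  by apply: right_limit_le => //; exact: le_lt_trans yz.
by have /andP[] := right_limit_bounds x.
Qed.

Lemma right_limit_near x b (e : R) : b \in I -> x < b -> 0 < e ->
  exists2 d : R, 0 < d & forall y, y \in I -> x < y -> y < x + d ->
    right_limit x <= p y < right_limit x + e.
Proof.
move=> bI xb e0; have [_ [[y [yI xy] <-]|->] pe] := inf_adherent e0 (conj (ne x) (lbm x)).
  exists (y - x) => [|z zI xz zy]; first by rewrite subr_gt0.
  rewrite right_limit_le//=; apply: le_lt_trans pe; apply: pnd => //; lra.
exists 1 => // z zI xz _; rewrite right_limit_le//=; apply: le_lt_trans pe.
by have /andP[] := pmC zI.
Qed.

Lemma right_limit_right_continuous : right_continuous right_limit.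
Proof.
move=> x; apply/cvgrPdist_lt => e e0.
have [_ [[y [yI xy] <-]|->] pe] := inf_adherent e0 (conj (ne x) (lbm x)); apply/nbhs_ballP.
  exists (y - x) => /= [|z]; first by rewrite subr_gt0.
  rewrite /ball/= ltr_distl => /andP[zy _] xz.
  have := right_limit_nondecreasing (ltW xz); have := @right_limit_le z y yI.
  have zy' : z < y by lra.
  by move=> /(_ zy') h1 h2; rewrite ler0_norm; rewrite -/(right_limit x) in pe; lra.
exists 1 => //= z _ xz; have /andP[_ zC] := right_limit_bounds z.
have := right_limit_nondecreasing (ltW xz) => h2.
by rewrite ler0_norm; rewrite -/(right_limit x) in pe; lra.
Qed.

Let cumul : cumulative R R := HB.pack right_limit
  (isCumulative.Build R _ R right_limit right_limit_nondecreasing right_limit_right_continuous).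

Let ls := lebesgue_stieltjes_measure cumul.

Let ls_oc a b : a <= b -> ls `]a, b]%classic = (right_limit b - right_limit a)%:E.
Proof.
move=> ab; rewrite /ls /lebesgue_stieltjes_measure /measure_extension.
rewrite measurable_mu_extE/=; last exact: is_ocitv.
by rewrite wlength_itv_bnd// EFinB.
Qed.

Let lsT : (ls setT <= (C - m)%:E)%E.
Proof.
pose J n : set R := `]- (n%:R), n%:R]%classic.
have mJ : measurable (\bigcup_n J n) by apply: bigcup_measurable => n _; exact: measurable_itv.
have Jcvg : (ls \o J) n @[n --> \oo] --> ls (\bigcup_n J n).
  apply: nondecreasing_cvg_mu; rewrite /J//.
  by move=> k l kl; apply/subsetPset/subset_itv; rewrite leBSide/= ?lerN2 ler_nat.
rewrite -(bigcup_itvT false false) -/J -(cvg_lim _ Jcvg)//.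
apply: lime_le; first by apply/cvg_ex; eexists; exact: Jcvg.
apply: nearW => n; rewrite /= ls_oc ?ge0_cp// lee_fin.
have /andP[_ h1] := right_limit_bounds n%:R.
by have /andP[h2 _] := right_limit_bounds (- n%:R); lra.
Qed.

(** This is the Lebesgue-Stieltjes measure of [right_limit], whose total increment is at most
    [C - m], cut down to the interior of [I]: at the endpoints [right_limit] may jump, and a
    distributional derivative must not charge them. *)
Lemma monotone_measure : exists mu : {finite_measure set (measurableTypeR R) -> \bar R},
  [/\ forall a b, [set` I]^° a -> [set` I]^° b -> a <= b ->
        mu `]a, b]%classic = (right_limit b - right_limit a)%:E,
      forall A : set R, measurable A -> mu (A `&` [set` I]^°) = mu A &
      (mu setT <= (C - m)%:E)%E].
Proof.
have mI0 : measurable [set` I]^° by apply: open_measurable; exact: open_interior.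
have mI : measurable ([set` I]^° : set (measurableTypeR R)) by exact: mI0.
have Ifin : (ls [set` I]^° < +oo)%E.
  apply: le_lt_trans (ltry (C - m)); apply: le_trans lsT.
  apply: le_measure; rewrite ?inE//.
exists (mfrestr mI Ifin); split.
- move=> a b aI bI ab; rewrite -[LHS]/(ls (`]a, b] `&` [set` I]^°)) setIidl ?ls_oc// => x /=.
  rewrite in_itv/= => /andP[ax xb].
  have [ao bo] := (interior_subset aI, interior_subset bI).
  move: xb; rewrite le_eqVlt => /predU1P[->//|xb].
  exact: itv_interior ao bo ax xb.
- move=> A mA; rewrite -[LHS]/(ls ((A `&` [set` I]^°) `&` [set` I]^°)).
  by rewrite -setIA setIid.
- rewrite -[leLHS]/(ls (setT `&` [set` I]^°)) setTI; apply: le_trans lsT.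
  by apply: le_measure; rewrite ?inE.
Qed.

End monotone_measure.

(** * Test functions and distributional derivatives *)

Section test_functions.
Context {R : realType}.
Local Notation mu := (@lebesgue_measure R).
Variables (U : set R) (phi : R -> R).
Hypothesis phiU : test_function U phi.

Let phi_derivable x : derivable phi x 1.
Proof. by have [H _ _] := phiU; exact: (H 0%N x). Qed.

Let phi'_derivable x : derivable (derive1 phi) x 1.
Proof. by have [H _ _] := phiU; exact: (H 1%N x). Qed.

Lemma test_function_continuous : continuous phi.
Proof. by move=> x; apply: differentiable_continuous; exact/derivable1_diffP. Qed.

Lemma test_function_derivative_continuous : continuous (derive1 phi).
Proof. by move=> x; apply: differentiable_continuous; exact/derivable1_diffP. Qed.

Lemma test_function_off_support x : ~ closure [set x | phi x != 0] x ->
  phi x = 0 /\ derive1 phi x = 0.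
Proof.
move=> nx; have zero y : ~ closure [set x | phi x != 0] y -> phi y = 0.
  move=> ny; apply/eqP; rewrite -[_ == _]negbK; apply/negP => phiy; apply: ny.
  exact: subset_closure.
split; first exact: zero.
rewrite derive1E (@near_eq_derive _ _ _ _ (cst 0))//; first by rewrite derive_cst.
have : open (~` closure [set x | phi x != 0]) by apply: closed_openC; exact: closed_closure.
by rewrite openE => /(_ x nx); apply: filterS => y /zero ->.
Qed.

Lemma test_function_outside x : ~ U x -> phi x = 0 /\ derive1 phi x = 0.
Proof. by case: phiU => _ _ sub nx; apply: test_function_off_support => /sub. Qed.

Lemma test_function_bounded_support : exists2 B : R, 0 < B &
  forall x, B <= `|x| -> phi x = 0 /\ derive1 phi x = 0.
Proof.
case: phiU => _ /compact_bounded[B0 [_ HB]] _.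
exists (Num.max (B0 + 1) 0 + 1).
  by have : 0 <= Num.max (B0 + 1) 0 by [rewrite le_max lexx orbT]; lra.
move=> x xB; apply: test_function_off_support => /(HB (B0 + 1)).
have : B0 + 1 <= Num.max (B0 + 1) 0 by rewrite le_max lexx.
by move=> h1; rewrite ltrDl ltr01 => /(_ isT) /=; lra.
Qed.

Lemma test_function_FTC x y : x <= y ->
  (\int[mu]_(z in `[x, y]) (derive1 phi z)%:E = (phi y - phi x)%:E)%E.
Proof.
rewrite le_eqVlt => /predU1P[->|xy].
  by rewrite set_itv1 integral_set1 subrr.
have H := @continuous_FTC2 R (derive1 phi) phi x y xy.
rewrite EFinB; apply: H.
- by apply: continuous_subspaceT; exact: test_function_derivative_continuous.
- split; first by move=> z _; exact: phi_derivable.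
  + by apply: cvg_at_right_filter; exact: test_function_continuous.
  + by apply: cvg_at_left_filter; exact: test_function_continuous.
- by move=> z _; reflexivity.
Qed.

Lemma test_function_derivative_integrable : mu.-integrable setT (EFin \o derive1 phi).
Proof.
have [B B0 HB] := test_function_bounded_support.
have Bint : mu.-integrable `[- B, B] (EFin \o derive1 phi).
  apply: continuous_compact_integrable; first exact: segment_compact.
  by apply: continuous_subspaceT; exact: test_function_derivative_continuous.
have -> : EFin \o derive1 phi = (EFin \o derive1 phi) \_ `[- B, B].
  apply/funext => x; rewrite patchE; case: ifPn => // /negP xB /=.
  have [|_ ->//] := HB x; rewrite leNgt; apply/negP; rewrite ltr_norml => h.
  by apply: xB; rewrite inE/= in_itv/=; case/andP: h => /ltW -> /ltW ->.
by rewrite -(@integrable_mkcond _ _ _ mu _ _ (measurable_itv `[- B, B])).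
Qed.

Lemma test_function_derivative_integral (S : set R) : measurable S -> U `<=` S ->
  (\int[mu]_(x in S) (derive1 phi x)%:E = 0)%E.
Proof.
move=> mS US; have [B B0 HB] := test_function_bounded_support.
have out x : ~ S x -> derive1 phi x = 0.
  by move=> nS; have [|] := test_function_outside (x := x); [move=> /US|].
transitivity (\int[mu]_x (derive1 phi x)%:E)%E.
  rewrite integral_mkcond; apply: eq_integral => x _; rewrite patchE.
  by case: ifPn => // /negP nS; rewrite out// => Sx; apply: nS; rewrite inE.
transitivity (\int[mu]_(x in [set` `[(- B)%R, B]%R]) (derive1 phi x)%:E)%E.
  rewrite [RHS]integral_mkcond; apply: eq_integral => x _; rewrite patchE.
  case: ifPn => // /negP xB /=.
  have [|_ ->//] := HB x; rewrite leNgt; apply/negP; rewrite ltr_norml => h.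
  by apply: xB; rewrite inE/= in_itv/=; case/andP: h => /ltW -> /ltW ->.
rewrite test_function_FTC; last lra.
have [-> _] : phi B = 0 /\ derive1 phi B = 0 by apply: HB; rewrite gtr0_norm.
have [-> _] : phi (- B) = 0 /\ derive1 phi (- B) = 0.
  by apply: HB; rewrite normrN gtr0_norm.
by rewrite subrr.
Qed.

(** The indicator form of the primitive provides the kernel to which Fubini is applied in
    [measure_integration_by_parts]. *)
Lemma test_function_primitive (x : R) :
  (\int[mu]_y ((x <= y)%R%:R * derive1 phi y)%:E = (- phi x)%:E)%E.
Proof.
have [B B0 HB] := test_function_bounded_support.
pose b : R := Num.max x B; have xb : x <= b by rewrite le_max lexx.
have Bb : B <= b by rewrite le_max lexx orbT.
transitivity (\int[mu]_(y in `[x, b]) (derive1 phi y)%:E)%E.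
  rewrite [RHS]integral_mkcond; apply: eq_integral => y _; rewrite patchE mem_setE in_itv/=.
  case: (leP x y) => xy /=; last by rewrite mul0r.
  rewrite mul1r; case: (leP y b) => yb //.
  have [|_ -> //] := HB y; rewrite ger0_norm; lra.
rewrite test_function_FTC//; have [-> _] : phi b = 0 /\ derive1 phi b = 0.
  by apply: HB; rewrite ger0_norm; lra.
by rewrite sub0r.
Qed.

Let mphi' : measurable_fun setT (derive1 phi).
Proof. by apply: continuous_measurable_fun; exact: test_function_derivative_continuous. Qed.

Let msection (x : R) : measurable_fun setT (fun y : R => ((x <= y)%R%:R * derive1 phi y)%:E).
Proof.
apply/measurable_EFinP; apply: measurable_funM => //.
rewrite (_ : (fun y => _) = \1_(`[x, +oo[)); first exact: measurable_indic.
by apply/funext => y; rewrite indicE mem_setE in_itv/= andbT.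
Qed.

Let section_bound : exists2 C : R, 0 <= C & forall x : R,
  (\int[mu]_y `|((x <= y)%R%:R * derive1 phi y)%:E| <= C%:E)%E.
Proof.
have /integrableP[_ Cy] := test_function_derivative_integrable.
have C0 : (0 <= \int[mu]_y `|(EFin \o derive1 phi) y|)%E by apply: integral_ge0.
exists (fine (\int[mu]_y `|(EFin \o derive1 phi) y|)); first exact: fine_ge0.
move=> x; rewrite fineK ?ge0_fin_numE//; apply: ge0_le_integral => //.
- by apply: measurableT_comp => //; exact: msection.
- by apply: measurableT_comp => //; apply/measurable_EFinP.
- move=> y _; rewrite !abse_EFin lee_fin normrM.
  by case: (x <= (y : R))%R; rewrite ?(normr1, normr0, mul1r, mul0r).
Qed.

Lemma test_function_bounded : exists C : R, forall x, `|phi x| <= C.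
Proof.
have [C C0 HC] := section_bound; exists C => x.
rewrite -lee_fin -abse_EFin -abseN -EFinN -test_function_primitive.
apply: le_trans (HC x); apply: le_abse_integral => //; exact: msection.
Qed.

Lemma test_function_integrable (nu : {finite_measure set (measurableTypeR R) -> \bar R}) :
  nu.-integrable setT (EFin \o phi).
Proof.
apply: measurable_bounded_integrable => //.
- by rewrite ltey_eq fin_num_measure.
- have mphi : measurable_fun setT phi.
    by apply: continuous_measurable_fun; exact: test_function_continuous.
  exact: mphi.
- have [C HC] := test_function_bounded; exists C; split; first exact: num_real.
  by move=> y Cy x _; exact: le_trans (HC x) (ltW Cy).
Qed.

(** Fubini for the kernel [1_{x <= y} phi'(y)]: integrating in [y] gives [- phi x], integrating in
    [x] gives [phi' y] times the distribution function of [nu]. *)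
Lemma measure_integration_by_parts (nu : {finite_measure set (measurableTypeR R) -> \bar R}) :
  (\int[nu]_x (phi x)%:E =
   - \int[mu]_y (derive1 phi y * fine (nu `]-oo, y]%classic))%:E)%E.
Proof.
pose k (z : measurableTypeR R * measurableTypeR R) : \bar R :=
  ((z.1 <= z.2)%R%:R * derive1 phi z.2)%:E.
have mk : measurable_fun setT k.
  apply/measurable_EFinP; apply: measurable_funM.
    rewrite (_ : (fun z => _) = \1_[set z : measurableTypeR R * measurableTypeR R | z.1 <= z.2]).
      have mle : measurable_fun setT (fun z : measurableTypeR R * measurableTypeR R => z.1 <= z.2).
        by apply: measurable_fun_ler; [exact: measurable_fst|exact: measurable_snd].
      apply: measurable_indic; rewrite -[X in measurable X]setTI.
      exact: (mle measurableT [set true]).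
    by apply/funext => z; rewrite indicE mem_setE.
  by apply: (measurableT_comp mphi'); exact: measurable_snd.
have [C C0 HC] := section_bound.
have kint : (nu \x mu)%E.-integrable setT k.
  apply/integrable12ltyP => //.
  apply: (@le_lt_trans _ _ (\int[nu]_x (cst C%:E x))%E); last first.
    by rewrite integral_cst// lte_mul_pinfty ?lee_fin// ltey_eq fin_num_measure.
  apply: ge0_le_integral => //.
  - by move=> x _; apply: integral_ge0.
  - apply: (measurable_fun_fubini_tonelli_F (m2 := mu) (abse \o k)); last by move=> z /=.
    by apply: measurableT_comp; [exact: abse_measurable|exact: mk].
  - by move=> x _; exact: HC.
have := Fubini kint; rewrite /k /=.
under eq_integral do rewrite test_function_primitive.
have -> : (\int[nu]_x (- phi x)%:E = - \int[nu]_x (phi x)%:E)%E.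
  rewrite -(@integralN _ _ _ nu _ (EFin \o phi))//.
  exact: (integrable_add_def measurableT (test_function_integrable nu)).
move=> /(congr1 oppe); rewrite oppeK => ->; congr (- _)%E; apply: eq_integral => y _.
rewrite EFinM fineK; last by apply: fin_num_measure; exact: measurable_itv.
transitivity (\int[nu]_x ((derive1 phi y)%:E * (\1_(`]-oo, y]%classic) x)%:E))%E.
  apply: eq_integral => x _; rewrite -EFinM indicE mem_setE in_itv/= mulrC.
  by [].
have mI : measurable (`]-oo, y]%classic : set (measurableTypeR R)) by exact: measurable_itv.
by rewrite integralZl ?integral_indic ?setIT//; exact: integrable_indic.
Qed.

End test_functions.

(** * Comparing right limits of monotone functions *)

Section right_limits.
Context {R : realType}.
Variable I : interval R.

(** The increments are compared between points slightly to the right of [a] and of [b]; the point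
    [c] beyond [b] provides the room for this. *)
Lemma right_limit_increment_le (p q : R -> R) (mp Cp mq Cq a b c : R) :
  {in I &, {homo p : x y / x <= y}} -> (forall x, x \in I -> mp <= p x <= Cp) ->
  {in I &, {homo q : x y / x <= y}} -> (forall x, x \in I -> mq <= q x <= Cq) ->
  a \in I -> a <= b -> b < c -> c \in I ->
  (forall y z, a < y -> y < z -> z < c -> p z - p y <= q z - q y) ->
  right_limit I p Cp b - right_limit I p Cp a <=
  right_limit I q Cq b - right_limit I q Cq a.
Proof.
move=> pnd pb qnd qb aI ab bc cI H.
move: ab; rewrite le_eqVlt => /predU1P[->|ab]; first by rewrite !subrr.
have cvx z : a < z -> z < c -> z \in I.
  by move=> az zc; apply: (interval_is_interval aI cI); rewrite !ltW.
have bI : b \in I by exact: cvx.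
apply/ler_addgt0Pr => e e0.
have e2 : 0 < e / 2 by lra.
have pC : mp <= Cp by have /andP[] := pb _ bI; exact: le_trans.
have qC : mq <= Cq by have /andP[] := qb _ bI; exact: le_trans.
have [d1 d10 H1] := right_limit_near pnd pb pC bI ab e2.
have [d2 d20 H2] := right_limit_near qnd qb qC cI bc e2.
pose z := Num.min (a + d1 / 2) ((a + b) / 2).
have [z1 z2] : z <= a + d1 / 2 /\ z <= (a + b) / 2 by rewrite !ge_min !lexx orbT.
have az : a < z by rewrite lt_min; apply/andP; split; lra.
pose y := Num.min (b + d2 / 2) ((b + c) / 2).
have [y1 y2] : y <= b + d2 / 2 /\ y <= (b + c) / 2 by rewrite !ge_min !lexx orbT.
have yb : b < y by rewrite lt_min; apply/andP; split; lra.
have zI : z \in I by apply: cvx; lra.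
have yI : y \in I by apply: cvx; lra.
have /andP[_ h1] : right_limit I p Cp a <= p z < right_limit I p Cp a + e / 2 by apply: H1 => //; lra.
have /andP[_ h2] : right_limit I q Cq b <= q y < right_limit I q Cq b + e / 2 by apply: H2 => //; lra.
have h3 : right_limit I p Cp b <= p y by exact: (right_limit_le pb).
have h4 : right_limit I q Cq a <= q z by exact: (right_limit_le qb).
have : p y - p z <= q y - q z by apply: H; lra.
lra.
Qed.

(** [p] and [n] may both jump at [x], but since [F] is continuous there the jumps cancel in the
    difference. *)
Lemma right_limit_sub (p n F : R -> R) (mp Cp mn Cn x : R) :
  {in I &, {homo p : x y / x <= y}} -> (forall x, x \in I -> mp <= p x <= Cp) ->
  {in I &, {homo n : x y / x <= y}} -> (forall x, x \in I -> mn <= n x <= Cn) ->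
  (forall x, x \in I -> F x = p x - n x) -> [set` I]^° x -> continuity_at F x ->
  right_limit I p Cp x - right_limit I n Cn x = F x.
Proof.
move=> pnd pb nnd nb HF /nbhs_ballP[r /= r0 rI] Fx.
have cI : x + r / 2 \in I.
  by apply: rI; rewrite /ball /= opprD addNKr normrN gtr0_norm; lra.
have xI : x \in I by apply: rI; exact: ballxx.
have xc : x < x + r / 2 by lra.
apply/eqP; rewrite eq_sym -subr_eq0 -normr_le0; apply/ler_addgt0Pr => e e0; rewrite add0r.
have e3 : 0 < e / 3 by lra.
have pC : mp <= Cp by have /andP[] := pb _ xI; exact: le_trans.
have nC : mn <= Cn by have /andP[] := nb _ xI; exact: le_trans.
have [d1 d10 H1] := right_limit_near pnd pb pC cI xc e3.
have [d2 d20 H2] := right_limit_near nnd nb nC cI xc e3.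
have [d3 d30 H3] := Fx _ e3.
pose d := Num.min (Num.min d1 d2) (Num.min d3 (r / 2)).
have d0 : 0 < d by rewrite !lt_min d10 d20 d30; lra.
have [k1 k2 k3 k4] : [/\ d <= d1, d <= d2, d <= d3 & d <= r / 2].
  by rewrite !ge_min !lexx !orbT.
pose y := x + d / 2; have xy : x < y by rewrite /y; lra.
have yI : y \in I by apply: (interval_is_interval xI cI); rewrite /y; apply/andP; split; lra.
have /andP[? ?] : right_limit I p Cp x <= p y < right_limit I p Cp x + e / 3 by apply: H1; rewrite // /y; lra.
have /andP[? ?] : right_limit I n Cn x <= n y < right_limit I n Cn x + e / 3 by apply: H2; rewrite // /y; lra.
have : `|F y - F x| < e / 3.
  by apply: H3; rewrite /y [x + _]addrC addrK gtr0_norm; lra.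
have := HF _ yI; rewrite ltr_norml => Fy /andP[h1 h2].
by rewrite ler_norml; apply/andP; split; lra.
Qed.

End right_limits.

(** * Jordan decomposition into half-variations *)

Section half_variations.
Context {R : realType}.
Local Notation mu := (@lebesgue_measure R).
Variables (I : interval R).

(** As [f] and [- f] have the same variation function [v], the functions [rise f] and [rise (\- f)]
    have difference [f] and sum [v]. The factor one half makes their total increases add up to the
    variation of [f], not to twice that. *)
Definition rise (f : R -> R) (x : R) : R := (control_fun (jump f) [set` I] x + f x) / 2.

Lemma jumpN (f : R -> R) : jump (\- f) = jump f.
Proof. by apply/funext => x; apply/funext => y; rewrite /jump /= -opprD normrN. Qed.

Lemma rise_sub f x : rise f x - rise (\- f) x = f x.
Proof. by rewrite /rise jumpN /=; lra. Qed.

Variables (f : R -> R) (M : R).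
Hypothesis fM : forall s, sorted <%R s -> {in s, forall x, x \in I} ->
  gap_sum (jump f) s <= M.

Lemma rise_nondecreasing : {in I &, {homo rise f : x y / x <= y}}.
Proof.
have [_ _ fv] := bv_control fM; move=> x y xI yI xy.
have := fv _ _ xI yI xy; have := ler_norm (f x - f y); rewrite distrC /rise; lra.
Qed.

Lemma rise_bounded : exists m C : R, forall x, x \in I -> m <= rise f x <= C.
Proof.
have [_ vM _] := bv_control fM; have [C C0 fC] := bv_bounded fM.
exists (- C), (M + C) => x xI; have /andP[? ?] := vM x.
by have := fC _ xI; rewrite ler_norml => /andP[? ?]; rewrite /rise; apply/andP; split; lra.
Qed.


Definition rise_measure (g : R -> R) (C : R) (m : set R -> \bar R) : Prop :=
  [/\ exists c : R, forall x, x \in I -> c <= rise g x <= C,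
      forall a b, [set` I]^° a -> [set` I]^° b -> a <= b ->
        m `]a, b]%classic = (right_limit I (rise g) C b - right_limit I (rise g) C a)%:E &
      forall A : set R, measurable A -> m (A `&` [set` I]^°) = m A].

End half_variations.

(** * The two measures of a function of bounded variation *)

Section bv_measures.
Context {R : realType}.
Local Notation mu := (@lebesgue_measure R).
Variables (I : interval R) (f : R -> R) (M : R).
Hypothesis ndI : nondegenerate_itv I.
Hypothesis fM : forall s, sorted <%R s -> {in s, forall x, x \in I} ->
  gap_sum (jump f) s <= M.

Let fNM s : sorted <%R s -> {in s, forall x, x \in I} -> gap_sum (jump (\- f)) s <= M.
Proof. by rewrite jumpN; exact: fM. Qed.

Let range_rise (g : R -> R) : (exists m C : R, forall x, x \in I -> m <= rise I g x <= C) ->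
  let S := rise I g @` [set` I] in
  [/\ has_sup S, has_inf S & forall x, x \in I -> inf S <= rise I g x <= sup S].
Proof.
move=> [m [C H]] S; have [x0 [_ [x0I _ _]]] := ndI.
have ne : S !=set0 by exists (rise I g x0), x0.
have ubS : has_ubound S by exists C => _ [x xI <-]; have /andP[] := H _ xI.
have lbS : has_lbound S by exists m => _ [x xI <-]; have /andP[] := H _ xI.
split => // x xI; rewrite ub_le_sup ?ge_inf//; by exists x.
Qed.

(** The half-variations add up to the variation function, so their oscillations over [I] add up to
    at most [M]. [Cp] and [Cn] are the suprema over [I], so that each mass is bounded by an
    oscillation. *)
Lemma bv_measures : exists (Cp Cn : R)
    (mp mn : {finite_measure set (measurableTypeR R) -> \bar R}),
  [/\ rise_measure I f Cp mp, rise_measure I (\- f) Cn mn &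
      (mp setT + mn setT <= M%:E)%E].
Proof.
have [psup pinf pb] := range_rise (rise_bounded fM).
have [nsup ninf nb] := range_rise (rise_bounded fNM).
set Sp := rise I f @` [set` I] in psup pinf pb.
set Sn := rise I (\- f) @` [set` I] in nsup ninf nb.
have [x0 [_ [x0I _ _]]] := ndI.
have pC : inf Sp <= sup Sp by have /andP[] := pb _ x0I; exact: le_trans.
have nC : inf Sn <= sup Sn by have /andP[] := nb _ x0I; exact: le_trans.
have [mp [mp1 mp2 mp3]] := monotone_measure pb pC.
have [mn [mn1 mn2 mn3]] := monotone_measure nb nC.
exists (sup Sp), (sup Sn), mp, mn; split.
- by split => //; exists (inf Sp).
- by split => //; exists (inf Sn).
apply: (le_trans (leeD mp3 mn3)); rewrite -EFinD lee_fin.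
apply/ler_addgt0Pr => e e0; have e4 : 0 < e / 4 by lra.
have [_ [a aI <-] Ha] := sup_adherent e4 psup.
have [_ [b bI <-] Hb] := inf_adherent e4 pinf.
have [_ [c cI <-] Hc] := sup_adherent e4 nsup.
have [_ [d dI <-] Hd] := inf_adherent e4 ninf.
have [vnd vM _] := bv_control fM.
(* The four nearly extremal points lie between [l] and [u], so by monotonicity both oscillations
   are, up to [e], at most increments over [[l, u]], which add up to an increment of the variation
   function. *)
pose l := Num.min (Num.min a b) (Num.min c d).
pose u := Num.max (Num.max a b) (Num.max c d).
have Imin x y : x \in I -> y \in I -> Num.min x y \in I by rewrite /Num.min; case: ifP.
have Imax x y : x \in I -> y \in I -> Num.max x y \in I by rewrite /Num.max; case: ifP.
have lI : l \in I by rewrite !Imin.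
have uI : u \in I by rewrite !Imax.
have lu x : x \in [:: a; b; c; d] -> l <= x <= u.
  by rewrite !inE /l /u => /or4P[] /eqP ->; rewrite !ge_min !le_max !lexx ?orbT.
have pnd := rise_nondecreasing fM; have nnd := rise_nondecreasing fNM.
have [/andP[_ au] /andP[lb _] /andP[_ cu] /andP[ld _]] :
  [/\ l <= a <= u, l <= b <= u, l <= c <= u & l <= d <= u].
  by split; apply: lu; rewrite !inE eqxx ?orbT.
have := pnd _ _ aI uI au; have := pnd _ _ lI bI lb.
have := nnd _ _ cI uI cu; have := nnd _ _ lI dI ld.
have /andP[? ?] := vM l; have /andP[? ?] := vM u.
move: Ha Hb Hc Hd; rewrite /rise jumpN /=; lra.
Qed.

Variables (Cp Cn : R) (mp mn : {finite_measure set (measurableTypeR R) -> \bar R}).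
Hypothesis mpE : rise_measure I f Cp mp.
Hypothesis mnE : rise_measure I (\- f) Cn mn.

Lemma bv_measure_increment (a b : R) : [set` I]^° a -> [set` I]^° b -> a <= b ->
  continuity_at f a -> continuity_at f b ->
  (mp `]a, b]%classic - mn `]a, b]%classic = (f b - f a)%:E)%E.
Proof.
move=> Ia Ib ab fa fb.
have [[c Hp] mp1 _] := mpE; have [[d Hn] mn1 _] := mnE.
rewrite mp1// mn1// -EFinB; congr EFin.
have E x : [set` I]^° x -> continuity_at f x ->
    right_limit I (rise I f) Cp x - right_limit I (rise I (\- f)) Cn x = f x.
  apply: (right_limit_sub (rise_nondecreasing fM) Hp (rise_nondecreasing fNM) Hn).
  by move=> y _; rewrite rise_sub.
by have := E _ Ia fa; have := E _ Ib fb; lra.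
Qed.

Lemma bv_measure_distribution : exists c : R, forall y, [set` I]^° y -> continuity_at f y ->
  f y = c + (fine (mp `]-oo, y]%classic) - fine (mn `]-oo, y]%classic)).
Proof.
pose g y := fine (mp `]-oo, y]%classic) - fine (mn `]-oo, y]%classic).
have [[y0 [I0 f0]]|no] := pselect (exists y, [set` I]^° y /\ continuity_at f y); last first.
  by exists 0 => y Iy fy; exfalso; apply: no; exists y.
have step a b : [set` I]^° a -> [set` I]^° b -> a <= b ->
    continuity_at f a -> continuity_at f b -> f b - f a = g b - g a.
  move=> Ia Ib ab fa fb.
  have E (m : {finite_measure set (measurableTypeR R) -> \bar R}) :
      fine (m `]-oo, b]%classic) = fine (m `]-oo, a]%classic) + fine (m `]a, b]%classic).
    have ma : measurable (`]-oo, a]%classic : set (measurableTypeR R)) by exact: measurable_itv.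
    have mab : measurable (`]a, b]%classic : set (measurableTypeR R)) by exact: measurable_itv.
    rewrite -fineD ?fin_num_measure// -measureU//.
      by congr (fine (m _)); rewrite -itv_bndbnd_setU// bnd_simp.
    apply/seteqP; split => // x /= []; rewrite !in_itv/= => xa /andP[ax _].
    by move: ax; rewrite ltNge xa.
  have mab : measurable (`]a, b]%classic : set (measurableTypeR R)) by exact: measurable_itv.
  have := bv_measure_increment Ia Ib ab fa fb.
  rewrite -(fineK (fin_num_measure mp _ mab)) -(fineK (fin_num_measure mn _ mab)) -EFinB => -[].
  by rewrite /g (E mp) (E mn); lra.
exists (f y0 - g y0) => y Iy fy; rewrite -/(g y).
have [yy0|y0y] := leP y y0; first by have := step _ _ Iy I0 yy0 fy f0; lra.
by have := step _ _ I0 Iy (ltW y0y) f0 fy; lra.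
Qed.

End bv_measures.

(** * The distributional derivative of a function of bounded variation *)

Section bv_integration_by_parts.
Context {R : realType}.
Local Notation mu := (@lebesgue_measure R).
Variables (I : interval R) (f : R -> R) (M : R).
Hypothesis fM : forall s, sorted <%R s -> {in s, forall x, x \in I} ->
  gap_sum (jump f) s <= M.
Variables (c : R) (mp mn : {finite_measure set (measurableTypeR R) -> \bar R}).
Hypothesis fE : forall y, [set` I]^° y -> continuity_at f y ->
  f y = c + (fine (mp `]-oo, y]%classic) - fine (mn `]-oo, y]%classic)).

(** Off a countable set [f] is a constant plus a difference of distribution functions, and the
    constant contributes nothing because [derive1 phi] has integral 0. *)
Lemma bv_integration_by_parts phi : test_function [set` I]^° phi ->
  (\int[mu]_(x in [set` I]) (f x * derive1 phi x)%:E =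
   - (\int[mp]_x (phi x)%:E - \int[mn]_x (phi x)%:E))%E.
Proof.
move=> phiI.
have [Z cZ HZ] := bv_continuity_points fM.
have sub : [set` I]^° `<=` [set` I] by exact: interior_subset.
pose cdf (m : {finite_measure set (measurableTypeR R) -> \bar R}) (y : R) :=
  fine (m `]-oo, y]%classic).
have mcdf m : measurable_fun setT (cdf m).
  apply: nondecreasing_measurable => // x y xy.
  have mx z : measurable (`]-oo, z]%classic : set (measurableTypeR R)) by exact: measurable_itv.
  rewrite fine_le ?fin_num_measure// le_measure ?inE//.
  by apply: subset_itvl; rewrite bnd_simp.
have mphi' : measurable_fun setT (derive1 phi).
  by apply: continuous_measurable_fun; exact: test_function_derivative_continuous phiI.
have intm m : mu.-integrable setT (fun y => (derive1 phi y * cdf m y)%:E).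
  apply: (@le_integrable _ _ _ mu _ _ _ (fun y => (fine (m setT))%:E * (EFin \o derive1 phi) y)%E) => //.
  - apply/measurable_EFinP.
    have : measurable_fun setT (fun y : R => derive1 phi y * cdf m y) by exact: measurable_funM.
    exact.
  - move=> y _; rewrite /= lee_fin !normrM mulrC ler_wpM2r//.
    have my : measurable (`]-oo, y]%classic : set (measurableTypeR R)) by exact: measurable_itv.
    rewrite /cdf !ger0_norm ?fine_ge0//; apply: fine_le; rewrite ?fin_num_measure//.
    by apply: le_measure; rewrite ?inE.
  - by apply: integrableZl => //; exact: test_function_derivative_integrable phiI.
have intI m : (\int[mu]_(x in [set` I]) (derive1 phi x * cdf m x)%:E = - \int[m]_x (phi x)%:E)%E.
  rewrite (measure_integration_by_parts phiI m) oppeK integral_mkcond.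
  apply: eq_integral => x _; rewrite patchE; case: ifPn => // /negP xI.
  have [|_ ->] := test_function_outside phiI (x := x); last by rewrite mul0r.
  by move=> /sub Ix; apply: xI; rewrite inE.
have cZb : countable (Z `|` ([set` I] `\` [set` I]^°)).
  by apply: countable_setU => //; exact: itv_boundary_countable.
have mZb : measurable (Z `|` ([set` I] `\` [set` I]^°)) by exact: countable_measurable.
have mI : measurable [set` I] by exact: measurable_itv.
have int' m : mu.-integrable [set` I] (fun y => (derive1 phi y * cdf m y)%:E).
  exact: integrableS (intm m).
have intc : mu.-integrable [set` I] (fun y => c%:E * (EFin \o derive1 phi) y)%E.
  apply: integrableZl => //.
  by apply: integrableS (test_function_derivative_integrable phiI).
have /integrableB/(_ (int' mn)) intB := int' mp.
transitivity (\int[mu]_(x in [set` I]) (c%:E * (EFin \o derive1 phi) x +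
    ((derive1 phi x * cdf mp x)%:E - (derive1 phi x * cdf mn x)%:E)))%E.
  apply: ae_eq_integral => //.
  - apply/measurable_EFinP; apply: measurable_funM; first exact: (bv_measurable fM).
    exact: measurable_funTS.
  - by apply: emeasurable_funD; [exact: measurable_int intc|exact: measurable_int (intB mI)].
  exists (Z `|` ([set` I] `\` [set` I]^°)); split.
  - exact: mZb.
  - exact: countable_lebesgue_measure0.
  move=> x /= /not_implyP[xI ne]; apply: contrapT => /not_orP[nZ nb]; apply: ne.
  have Ix : [set` I]^° x by apply: contrapT => nIx; apply: nb.
  rewrite (fE Ix (HZ x Ix nZ)) -EFinM -EFinB -EFinD; congr EFin.
  by rewrite /cdf; ring.
rewrite integralD// ?integralB//; last exact: intB.
rewrite integralZl//; last by apply: integrableS (test_function_derivative_integrable phiI).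
rewrite (test_function_derivative_integral phiI mI sub) mule0 add0e !intI.
have fin m := integrable_fin_num measurableT (test_function_integrable phiI m).
move: (fin mp) (fin mn) => /=.
move: (\int[mp]_x (phi x)%:E)%E (\int[mn]_x (phi x)%:E)%E => [p| |] [n| |] //= _ _.
by congr EFin; ring.
Qed.


End bv_integration_by_parts.

Lemma gap_sum_from_le_measure {R : realType} (m : {measure set (measurableTypeR R) -> \bar R})
    (D : set R) (g : R -> R -> R) x s :
  (forall a b, D a -> D b -> a < b -> ((g a b)%:E <= m `]a, b]%classic)%E) ->
  D x -> {in s, forall y, D y} -> path <%R x s ->
  ((gap_sum_from g x s)%:E <= m `]x, last x s]%classic)%E.
Proof.
move=> H; elim: s x => [|y s IH] x Dx Ds /=; first by rewrite set_itv_ge ?bnd_simp ?ltxx// measure0.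
case/andP=> xy ys; have Dy : D y by apply: Ds; rewrite inE eqxx.
have yl : y <= last y s.
  by move: ys; rewrite lt_path_sortedE => /andP[/allP ys _];
    case: s ys {IH Ds} => [//|z s] ys; apply/ltW/ys => /=; exact: mem_last.
have mI a b : measurable (`]a, b]%classic : set (measurableTypeR R)) by exact: measurable_itv.
have -> : `]x, last y s]%classic = `]x, y]%classic `|` `]y, last y s]%classic.
  by rewrite -itv_bndbnd_setU// bnd_simp// ltW.
rewrite measureU//.
  rewrite EFinD; apply: leeD; first exact: H.
  by apply: IH => // z zs; apply: Ds; rewrite inE zs orbT.
apply/seteqP; split => // z /= []; rewrite !in_itv/= => /andP[_ zy] /andP[yz _].
by move: yz; rewrite ltNge zy.
Qed.

Lemma bounded_locally_integrable {R : realType} (U : set R) (g : R -> R) (C : R) :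
  open U -> measurable_fun U g -> (forall x, U x -> `|g x| <= C) -> locally_integrable U g.
Proof.
move=> oU mg gC; split => // K KU cK.
have mK : measurable K by apply: closed_measurable; exact: compact_closed.
have mgK : measurable_fun K g by apply: measurable_funS mg => //; exact: open_measurable.
have : (lebesgue_measure : measure _ R).-integrable K (EFin \o g).
  apply: measurable_bounded_integrable => //; first exact: compact_finite_measure.
  exists C; split; first exact: num_real.
  by move=> y Cy x Kx; exact: le_trans (gC _ (KU _ Kx)) (ltW Cy).
by case/integrableP.
Qed.

Lemma bv_locally_integrable {R : realType} (I : interval R) (f : R -> R) (M : R) :
  (forall s, sorted <%R s -> {in s, forall x, x \in I} -> gap_sum (jump f) s <= M) ->
  locally_integrable [set` I]^° f.
Proof.
move=> fM; have [C C0 fC] := bv_bounded fM.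
have sub : [set` I]^° `<=` [set` I] by exact: interior_subset.
apply: (@bounded_locally_integrable _ _ _ C); first exact: open_interior.
  by apply: measurable_funS (bv_measurable fM).
by move=> x /sub; exact: fC.
Qed.

(** [Df] is [mp - mn], but [mp] and [mn] need not be its Jordan parts: at a removable discontinuity
    of [f] both carry an atom, and the atoms cancel. So neither the formula nor the mass of [Df] can
    be read off [mp] and [mn] separately. *)
Lemma bv_distributional_derivative {R : realType} (I : interval R) (f : R -> R) (M : R) :
  nondegenerate_itv I ->
  (forall s, sorted <%R s -> {in s, forall x, x \in I} -> gap_sum (jump f) s <= M) ->
  exists (Df : {charge set (measurableTypeR R) -> \bar R}) (P N : set R)
      (DfPN : hahn_decomposition Df P N),
    [/\ distributional_derivative I f DfPN, charge_variation DfPN [set` I] \is a fin_num &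
    forall s, sorted <%R s -> {in s, forall x, x \in I} ->
      ((gap_sum (jump (canonical_representative I f)) s)%:E <= charge_variation DfPN [set` I])%E].
Proof.
move=> ndI fM; have [Cp [Cn [mp [mn [mpE mnE _]]]]] := bv_measures ndI fM.
pose Df : {charge set (measurableTypeR R) -> \bar R} :=
  cadd (charge_of_finite_measure mp) (copp (charge_of_finite_measure mn)).
have DfE A : Df A = (mp A - mn A)%E by [].
have [P [N DfPN]] := Hahn_decomposition Df; exists Df, P, N, DfPN.
have mI : measurable ([set` I] : set (measurableTypeR R)) by exact: measurable_itv.
have vfin : charge_variation DfPN [set` I] \is a fin_num.
  by rewrite /charge_variation fin_numD !fin_num_measure.
split => //.
- split; first exact: bv_locally_integrable fM.
  + by move=> A mA; rewrite !DfE; case: mpE => _ _ ->//; case: mnE => _ _ ->.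
  + move=> phi phiI; have [c fE] := bv_measure_distribution fM mpE mnE.
    (* The Jordan parts have the same difference of distribution functions as [mp] and [mn], and the
       integration by parts depends on nothing else. *)
    apply: (bv_integration_by_parts (c := c) fM) => // y Iy fy; rewrite (fE _ Iy fy).
    have my : measurable (`]-oo, y]%classic : set (measurableTypeR R)) by exact: measurable_itv.
    congr (_ + _); rewrite -!fineB ?fin_num_measure//; congr fine.
    rewrite -DfE (jordan_decomp DfPN my) /cadd/= /cscale/= EFinN mulN1e//.
move=> s ss sI; rewrite -(fineK vfin) lee_fin; move: s ss sI.
have [Z cZ HZ] := bv_continuity_points fM.
have oo0 : (0 < +oo :> \bar R)%E by [].
apply: (canonical_variation_le ndI fM oo0 cZ) => s ss sI.
rewrite -lee_fin fineK//; case: s ss sI => [|x s] /= xs sI; first exact: measure_ge0.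
have xI : [set` I]^° x /\ ~ Z x by apply: sI; rewrite inE eqxx.
apply: (@le_trans _ _ (charge_variation DfPN `]x, last x s]%classic)); last first.
  have mxl : measurable (`]x, last x s]%classic : set (measurableTypeR R)).
    exact: measurable_itv.
  apply: le_measure; rewrite ?inE// => z /=; rewrite in_itv/= => /andP[xz zl].
  have lI : last x s \in I.
    by have [/interior_subset] := sI _ (mem_last x s).
  by apply: (interval_is_interval (interior_subset xI.1) lI); rewrite ltW.
apply: (@gap_sum_from_le_measure _ _ [set z | [set` I]^° z /\ ~ Z z]) => //; last first.
  by move=> y ys; apply: sI; rewrite inE ys orbT.
move=> a b [Ia Za] [Ib Zb] ab; have mab : measurable (`]a, b]%classic : set (measurableTypeR R)).
  exact: measurable_itv.
apply: le_trans (abse_charge_variation DfPN mab).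
rewrite DfE (bv_measure_increment fM mpE mnE)//; first exact: ltW.
- exact: HZ.
- exact: HZ.
Qed.

(** * Absolute continuity and the weak derivative *)

Section interval_comparison.
Context {R : realType}.
Implicit Types (m : {finite_measure set (measurableTypeR R) -> \bar R}).

Let mitv (J : interval R) : measurable ([set` J] : set (measurableTypeR R)).
Proof. exact: measurable_itv. Qed.

Let itv_sub m1 m2 (a b : R) : Prop := forall c d, a <= c -> d <= b ->
  (m1 `]c, d]%classic <= m2 `]c, d]%classic)%E.

Let mcover (s : seq (R * R)) :
  measurable (\big[setU/set0]_(p <- s) `]p.1, p.2]%classic : set (measurableTypeR R)).
Proof. by apply: bigsetU_measurable => p _; exact: mitv. Qed.

(* Removing a half-open interval from another one leaves two half-open
   intervals, whence the induction. *)
Let itv_diff_le m1 m2 (s : seq (R * R)) (a b : R) : itv_sub m1 m2 a b ->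
  (m1 (`]a, b]%classic `\` \big[setU/set0]_(p <- s) `]p.1, p.2]%classic) <=
   m2 (`]a, b]%classic `\` \big[setU/set0]_(p <- s) `]p.1, p.2]%classic))%E.
Proof.
elim: s a b => [|[c d] s IH] a b H; first by rewrite big_nil !setD0; exact: H.
have E : `]a, b]%classic `\` \big[setU/set0]_(p <- (c, d) :: s) `]p.1, p.2]%classic =
   (`]a, Num.min b c]%classic `\` \big[setU/set0]_(p <- s) `]p.1, p.2]%classic) `|`
   (`]Num.max a (Num.max c d), b]%classic `\` \big[setU/set0]_(p <- s) `]p.1, p.2]%classic).
  rewrite big_cons; apply/seteqP; split => x /=; rewrite !in_itv/= !le_min !gt_max.
    move=> [/andP[-> ->] /not_orP[/negP + ns]].
    rewrite negb_and -leNgt -ltNge => /orP[xc|dx]; first by left; rewrite xc.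
    by have [xc|cx] := leP x c; [left|right; rewrite dx].
  move=> [[/and3P[-> -> xc] ns]|[/andP[/and3P[-> cx dx] ->] ns]]; split=> //.
    by move=> [|//]; rewrite ltNge xc.
  by move=> [|//]; rewrite leNgt dx andbF.
have D : (`]a, Num.min b c]%classic `\` \big[setU/set0]_(p <- s) `]p.1, p.2]%classic) `&`
   (`]Num.max a (Num.max c d), b]%classic `\` \big[setU/set0]_(p <- s) `]p.1, p.2]%classic) = set0.
  apply/seteqP; split=> // x /= [[+ _] [+ _]]; rewrite !in_itv/= le_min !gt_max.
  by move=> /and3P[_ _ xc] /andP[/and3P[_ + _] _]; rewrite ltNge xc.
have mD (J : interval R) : measurable ([set` J] `\` \big[setU/set0]_(p <- s) `]p.1, p.2]%classic
    : set (measurableTypeR R)).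
  by apply: measurableD; [exact: mitv|exact: mcover].
rewrite E !measureU//; apply: leeD; apply: IH => u v au vb; apply: H => //.
- by apply: le_trans vb _; rewrite ge_min lexx.
- by apply: le_trans au; rewrite le_max lexx.
Qed.

(** [U] is a countable union of half-open intervals with rational ends. Making them disjoint leaves
    a half-open interval minus finitely many others, which [itv_diff_le] handles. *)
Lemma open_measure_le m1 m2 (U : set R) : open U ->
  (forall a b, a <= b -> `[a, b]%classic `<=` U ->
    (m1 `]a, b]%classic <= m2 `]a, b]%classic)%E) ->
  (m1 U <= m2 U)%E.
Proof.
move=> oU H.
(* Rational intervals whose closure lies in [U]; every other index gets []0, 0]], which is empty. *)
pose ab n : R * R := if (unpickle n : option (rat * rat)) is Some p
  then if `[< `[ratr p.1, ratr p.2]%classic `<=` U >] then (ratr p.1, ratr p.2) else (0, 0)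
  else (0, 0).
pose E n : set R := `](ab n).1, (ab n).2]%classic.
have EU : U = \bigcup_n E n.
  apply/seteqP; split => [x Ux|x [n _]]; last first.
    rewrite /E /ab; case: unpickle => [p|]; last by rewrite /= in_itv/= => /andP[] /lt_le_trans h /h; rewrite ltxx.
    case: asboolP => [pU|_]; last by rewrite /= in_itv/= => /andP[] /lt_le_trans h /h; rewrite ltxx.
    by rewrite /= in_itv/= => /andP[px xp]; apply: pU; rewrite /= in_itv/= xp ltW.
  have /nbhs_ballP[r /= r0 rU] := open_nbhs_nbhs (conj oU Ux).
  have [|q] := @rat_in_itvoo R (x - r) x; first by lra.
  rewrite in_itv/= => /andP[q1 q2].
  have [|q'] := @rat_in_itvoo R x (x + r); first by lra.
  rewrite in_itv/= => /andP[q3 q4].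
  exists (pickle (q, q')) => //; rewrite /E /ab pickleK /= asboolT; last first.
    move=> y /=; rewrite in_itv/= => /andP[qy yq]; apply: rU.
    by rewrite /ball/= ltr_distlC; apply/andP; split; lra.
  by rewrite /= in_itv/= q2 ltW.
have good n : itv_sub m1 m2 (ab n).1 (ab n).2.
  have empty a : itv_sub m1 m2 a a.
    by move=> c d ac da; rewrite set_itv_ge ?measure0// bnd_simp -leNgt (le_trans da).
  rewrite /ab; case: unpickle => [p|]; last exact: empty.
  case: asboolP => [pU|_]; last exact: empty.
  move=> c d pc dp; have [cd|dc] := leP c d; last first.
    by rewrite set_itv_ge ?measure0// bnd_simp -leNgt ltW.
  apply: H => // y /=; rewrite in_itv/= => /andP[cy yd]; apply: pU.
  by rewrite /= in_itv/= (le_trans pc)//= (le_trans yd).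
have seqDUE n : seqDU E n = `](ab n).1, (ab n).2]%classic `\`
    \big[setU/set0]_(p <- [seq ab k | k <- iota 0 n]) `]p.1, p.2]%classic.
  by rewrite /seqDU big_map -(big_mkord xpredT E) /index_iota subn0.
have mE n : measurable (seqDU E n : set (measurableTypeR R)).
  by rewrite seqDUE; apply: measurableD; [exact: mitv|exact: mcover].
rewrite EU seqDU_bigcup_eq !measure_bigcup//.
by apply: lee_nneseries => // n _; rewrite seqDUE; exact: itv_diff_le.
Qed.

End interval_comparison.

(** * Absolute continuity of functions and of their measures *)

Section absolute_continuity.
Context {R : realType}.
Local Notation mu := (@lebesgue_measure R).
Variables (I : interval R) (F : R -> R).

Lemma inside_jump_subadditive U : gap_subadditive (weighted_jump (inside U) F).
Proof.
move=> x y z xy yz; rewrite /weighted_jump.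
have [xzU|nU] := pselect (`]x, z[%classic `<=` U); last first.
  by rewrite /inside (asboolF nU) mul0r addr_ge0// mulr_ge0 ?inside_ge0 ?jump_ge0.
have sub a b : x <= a -> b <= z -> inside U a b = 1.
  move=> xa bz; rewrite /inside asboolT// => t /=; rewrite in_itv/= => /andP[a1 b1].
  by apply: xzU; rewrite /= in_itv/= (le_lt_trans xa)//= (lt_le_trans b1).
by rewrite !sub ?mul1r ?lexx ?(ltW xy) ?(ltW yz)//; exact: jump_subadditive.
Qed.

(** The control function of the jumps inside [U] increases by at most [e] in all and dominates the
    variation of [F] on every interval in [U]. Its increments can be added over disjoint intervals
    or made into a measure. *)
Lemma inside_control (U : set R) (e : R) :
  (forall s, sorted <%R s -> {in s, forall x, x \in I} ->
     gap_sum (weighted_jump (inside U) F) s <= e) ->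
  exists w : R -> R, [/\ {homo w : x y / x <= y}, forall x, 0 <= w x <= e &
    forall y z, y \in I -> z \in I -> y <= z -> `]y, z[%classic `<=` U ->
      forall t, path <%R y t -> {in t, forall x, x \in I /\ x <= z} ->
        gap_sum_from (jump F) y t <= w z - w y].
Proof.
move=> He; pose g := weighted_jump (inside U) F.
have g0 x y : 0 <= g x y by rewrite mulr_ge0 ?inside_ge0 ?jump_ge0.
have gsub := @inside_jump_subadditive U.
exists (control_fun g [set` I]); split.
- by apply: (control_fun_nd (M := e)).
- by move=> x; rewrite (control_fun_ge0 (M := e))//= control_fun_le.
move=> y z yI zI yz yzU t yt tz; rewrite lerBrDl.
have -> : gap_sum_from (jump F) y t = gap_sum_from g y t.
  apply: eq_gap_sum_from => // a b ya bl ab; rewrite /g /weighted_jump.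
  rewrite /inside asboolT ?mul1r// => x /=; rewrite in_itv/= => /andP[ax xb].
  apply: yzU; rewrite /= in_itv/= (le_lt_trans ya)//=; apply: (lt_le_trans xb).
  apply: le_trans bl _; have := mem_last y t; rewrite inE => /orP[/eqP -> //|].
  by case/tz.
exact: (control_fun_cat (M := e)).
Qed.

Variable M : R.
Hypothesis FM : forall s, sorted <%R s -> {in s, forall x, x \in I} ->
  gap_sum (jump F) s <= M.
Hypothesis Fac : forall e : R, 0 < e -> exists2 d : R, 0 < d &
  forall U : set R, measurable U -> (mu U < d%:E)%E ->
  forall s, sorted <%R s -> {in s, forall x, x \in I} ->
    gap_sum (weighted_jump (inside U) F) s <= e.

Lemma disjoint_oo_itv (a b c d : R) : a < b -> c < d ->
  `]a, b[%classic `&` `]c, d[%classic = set0 -> b <= c \/ d <= a.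
Proof.
move=> ab cd E; have [bc|cb] := leP b c; first by left.
right; rewrite leNgt; apply/negP => ad.
pose l := Num.max a c; pose u := Num.min b d.
have [l1 l2] : a <= l /\ c <= l by rewrite !le_max !lexx orbT.
have [u1 u2] : u <= b /\ u <= d by rewrite !ge_min !lexx orbT.
have lu : l < u by rewrite lt_min !gt_max ab cb ad cd.
have : (`]a, b[%classic `&` `]c, d[%classic) ((l + u) / 2).
  by split; rewrite /= in_itv/=; apply/andP; split; lra.
by rewrite E.
Qed.

Lemma nondecreasing_disjoint_increments (w : R -> R) (m C : R) n (a b : 'I_n -> R) :
  {homo w : x y / x <= y} -> (forall x, m <= w x <= C) -> (forall i, a i <= b i) ->
  trivIset setT (fun i => `]a i, b i[%classic) ->
  \sum_(i < n) (w (b i) - w (a i)) <= C - m.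
Proof.
move=> wnd wmC ab tab.
(* The intervals [w a_i, w b_i[ are disjoint subsets of [m, C]. *)
pose J i : set R := `[w (a i), w (b i)[%classic.
have mJ i : measurable (J i) by exact: measurable_itv.
have tabP := (trivIsetP.1 tab).
have tJ : trivIset setT J.
  apply/trivIsetP => i j _ _ ij; apply/seteqP; split => // t /= [].
  rewrite /J /= !in_itv/= => /andP[ai bi] /andP[aj bj].
  have lt k : w (a k) <= t -> t < w (b k) -> a k < b k.
    move=> ak bk; rewrite lt_neqAle ab andbT; apply/negP => /eqP E.
    by move: bk; rewrite -E ltNge ak.
  have := disjoint_oo_itv (lt _ ai bi) (lt _ aj bj) (tabP _ _ Logic.I Logic.I ij).
  by case=> /wnd; lra.
have mm : m <= C by have /andP[] := wmC 0; exact: le_trans.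
rewrite -lee_fin -sumEFin -lebesgue_measure_cc//.
have -> : (\sum_(i < n) (w (b i) - w (a i))%:E = \sum_(i < n) mu (J i))%E.
  apply: eq_bigr => i _; rewrite /J /= lebesgue_measure_itv/= lte_fin EFinB.
  case: ltP => // ba.
  have -> : w (b i) = w (a i) by apply/eqP; rewrite eq_le ba wnd.
  by rewrite subee.
rewrite -(measure_bigsetU_ord mu xpredT mJ tJ); apply: le_lebesgue_measure.
- by apply: bigsetU_measurable => i _; exact: mJ.
- exact: measurable_itv.
- move=> t; rewrite -bigcup_seq => -[i _]; rewrite /J /= !in_itv/= => /andP[ai bi].
  by have /andP[? _] := wmC (a i); have /andP[_ ?] := wmC (b i); apply/andP; split; lra.
Qed.

Lemma abs_continuous_of_inside : abs_continuous_on I F.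
Proof.
move=> e e0; have e2 : 0 < e / 2 by lra.
have [d d0 Hd] := Fac e2; exists d => // n a b abI tab sd.
pose U : set R := \big[setU/set0]_(i < n) `]a i, b i[%classic.
have mJ i : measurable (`]a i, b i[%classic) by exact: measurable_itv.
have mU : measurable U by apply: bigsetU_measurable => i _; exact: mJ.
have Ud : (mu U < d%:E)%E.
  rewrite /U (measure_bigsetU_ord mu xpredT mJ tab).
  apply: le_lt_trans (_ : (\sum_(i < n) (b i - a i)%:E < _)%E); last by rewrite sumEFin lte_fin.
  apply: lee_sum => i _; rewrite /= lebesgue_measure_itv/= lte_fin EFinB.
  by case: ifPn => // _; rewrite -EFinB lee_fin subr_ge0; have [] := abI i.
(* Passing through [w] avoids sorting the given intervals into one partition. *)
have [w [wnd we wF]] := inside_control (Hd U mU Ud).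
apply: (@le_lt_trans _ _ (\sum_(i < n) (w (b i) - w (a i)))); last first.
  apply: le_lt_trans (_ : e / 2 < e); last lra.
  have := nondecreasing_disjoint_increments wnd we _ tab; rewrite subr0; apply => i.
  by have [] := abI i.
apply: ler_sum => i _; have [aI bI] := abI i; rewrite le_eqVlt => /predU1P[->|ab].
  by rewrite !subrr normr0.
have /= := wF _ _ aI bI (ltW ab) _ [:: b i]; rewrite addr0 ab; apply => //.
- by move=> t ht; rewrite /U -bigcup_seq; exists i => //=; exact: mem_index_enum.
- by move=> x; rewrite inE => /eqP ->.
Qed.

(** A null set is covered by an open [V] of small measure. On [U], the part of [V] in the interior
    of [I], the half-variation of [F] grows no faster than the control function [w], whose measure
    has total mass at most [e]. *)
Lemma rise_measure_dominates (Cp : R) (mp : {finite_measure set (measurableTypeR R) -> \bar R}) :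
  rise_measure I F Cp mp -> null_dominates mu mp.
Proof.
move=> [[c pb] mpE mpI].
have sub : [set` I]^° `<=` [set` I] by exact: interior_subset.
apply/null_content_dominatesP => A mA A0; apply/eqP; rewrite eq_le measure_ge0 andbT.
have mI : measurable [set` I]^° by apply: open_measurable; exact: open_interior.
apply/lee_addgt0Pr => e e0; rewrite add0e; have [d d0 Hd] := Fac e0.
have [|V [oV AV Vd]] := lebesgue_regularity_outer mA _ d0; first by rewrite A0.
pose U := V `&` [set` I]^°.
have oU : open U by apply: openI => //; exact: open_interior.
have mV : measurable V by exact: open_measurable.
have mU : measurable U by exact: open_measurable.
have Ud : (mu U < d%:E)%E.
  apply: le_lt_trans Vd; apply: (@le_trans _ _ (mu V)).
    by apply: le_lebesgue_measure => // x [].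
  have mVA : measurable (V `&` A) by exact: measurableI.
  have VA0 : mu (V `&` A) = 0.
    apply/eqP; rewrite eq_le measure_ge0 andbT -A0.
    by apply: le_lebesgue_measure => // x [].
  have -> : mu V = (mu (V `\` A) + 0)%E by rewrite -VA0; exact: (measureDI mu mV mA).
  by rewrite adde0.
have [w [wnd we wF]] := inside_control (Hd U mU Ud).
have wnd' : {in I &, {homo w : x y / x <= y}} by move=> x y _ _; exact: wnd.
have web x : x \in I -> 0 <= w x <= e by [].
have [mw [mwE _ mwT]] := monotone_measure web (ltW e0).
rewrite -mpI//; apply: (@le_trans _ _ (mp U)).
  apply: le_measure; rewrite ?inE//; [exact: measurableI|].
  by move=> x [Ax Ix]; split => //; exact: AV.
apply: (@le_trans _ _ (mw U)); last first.
  apply: le_trans (_ : mw setT <= _)%E; first by apply: le_measure; rewrite ?inE.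
  by rewrite subr0 in mwT.
apply: open_measure_le => // a b ab abU.
have [Ua Ub] : U a /\ U b by split; apply: abU; rewrite /= in_itv/= lexx ab.
have [[_ Ia] [_ Ib]] := (Ua, Ub).
rewrite mpE// mwE// lee_fin.
have /nbhs_ballP[r /= r0 rU] := open_nbhs_nbhs (conj oU Ub).
have bU x : b <= x -> x < b + r -> U x.
  by move=> bx xr; apply: rU; rewrite /ball/= ltr_distlC; apply/andP; split; lra.
have cI : b + r / 2 \in I by apply: sub; apply: (bU _ _ _).2; lra.
apply: (right_limit_increment_le (rise_nondecreasing FM) pb wnd' web (c := b + r / 2)) => //.
- exact: sub.
- lra.
move=> y z ay yz zr.
have zyU x : y <= x -> x <= z -> U x.
  move=> yx xz; have [xb|bx] := leP x b; last by apply: bU; lra.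
  by apply: abU; rewrite /= in_itv/= xb andbT; lra.
have [[_ /sub yI] [_ /sub zI]] : U y /\ U z by split; apply: zyU; rewrite ?lexx ?ltW.
have yzU : `]y, z[%classic `<=` U.
  by move=> x /=; rewrite in_itv/= => /andP[yx xz]; apply: zyU; exact: ltW.
(* The variation function and [F] both rise by at most [w z - w y] from [y] to [z], hence so does
   their half-sum. *)
have H := wF _ _ yI zI (ltW yz) yzU.
have [_ _ Fv] := bv_control FM.
have vw : control_fun (jump F) [set` I] z <= control_fun (jump F) [set` I] y + (w z - w y).
  have J0 a' b' : 0 <= jump F a' b' by exact: jump_ge0.
  exact: (control_fun_split (M := M) J0 (@jump_subadditive _ F) FM yI (ltW yz) H).
have := Fv _ _ yI zI (ltW yz); have := ler_norm (F z - F y).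
rewrite /rise; lra.
Qed.

End absolute_continuity.

(** * Real-valued densities tested against smooth functions *)

Section radon_nikodym_density.
Context {R : realType}.
Local Notation mu := (@lebesgue_measure R).
Variable m : {finite_measure set (measurableTypeR R) -> \bar R}.
Hypothesis mmu : null_dominates mu m.

Lemma radon_nikodym_density : exists h : R -> R,
  [/\ forall x, 0 <= h x, mu.-integrable setT (EFin \o h),
      (\int[mu]_x (h x)%:E = m setT)%E &
      forall U phi, test_function U phi ->
        mu.-integrable setT (fun x => (h x * phi x)%:E) /\
        (\int[mu]_x (h x * phi x)%:E = \int[m]_x (phi x)%:E)%E].
Proof.
pose k := Radon_Nikodym_SigmaFinite.f m mu.
have kE x : k x = (fine (k x))%:E.
  by rewrite fineK//; exact: Radon_Nikodym_SigmaFinite.f_fin_num.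
have kint : mu.-integrable setT (EFin \o (fine \o k)).
  have -> : EFin \o (fine \o k) = k by apply/funext => x; rewrite [RHS]kE.
  exact: Radon_Nikodym_SigmaFinite.f_integrable.
exists (fine \o k); split => //.
- by move=> x /=; apply: fine_ge0; exact: Radon_Nikodym_SigmaFinite.f_ge0.
- rewrite (Radon_Nikodym_SigmaFinite.f_integral mmu measurableT).
  by apply: eq_integral => x _; rewrite /= -kE.
move=> U phi phiU.
have mphi : measurable_fun setT phi.
  by apply: continuous_measurable_fun; exact: test_function_continuous phiU.
have [C HC] := test_function_bounded phiU.
have hphi : mu.-integrable setT (fun x => (fine (k x) * phi x)%:E).
  apply: (@le_integrable _ _ _ mu _ _ _ (fun x => C%:E * (EFin \o (fine \o k)) x)%E) => //.
  - have : measurable_fun setT (fun x : R => fine (k x) * phi x).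
      by apply: measurable_funM => //; apply/measurable_EFinP; exact: measurable_int kint.
    by move=> ?; apply/measurable_EFinP.
  - move=> x _; rewrite /= lee_fin !normrM mulrC ler_wpM2r//.
    exact: le_trans (HC x) (ler_norm C).
  - exact: integrableZl.
split => //.
rewrite -(Radon_Nikodym_change_of_variables mmu measurableT (test_function_integrable phiU m)).
have ae := ae_eq_Radon_Nikodym_SigmaFinite mmu measurableT.
apply: ae_eq_integral => //.
- exact: measurable_int hphi.
- apply: emeasurable_funM; first by apply/measurable_EFinP; exact: mphi.
  exact: measurable_int (Radon_Nikodym_integrable _).
- apply: filterS ae => x /= H _; rewrite -H// -/(k x) [in RHS]kE -EFinM; congr EFin.
  by rewrite mulrC.
Qed.

End radon_nikodym_density.

(** * The weak derivative as a difference of densities *)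

Section weak_derivative.
Context {R : realType}.
Local Notation mu := (@lebesgue_measure R).
Variables (I : interval R) (F : R -> R) (M : R).
Hypothesis ndI : nondegenerate_itv I.
Hypothesis FM : forall s, sorted <%R s -> {in s, forall x, x \in I} ->
  gap_sum (jump F) s <= M.
Hypothesis Fac : forall e : R, 0 < e -> exists2 d : R, 0 < d &
  forall U : set R, measurable U -> (mu U < d%:E)%E ->
  forall s, sorted <%R s -> {in s, forall x, x \in I} ->
    gap_sum (weighted_jump (inside U) F) s <= e.

(** The densities of the two half-variation measures have integrals adding up to at most [M], and
    their difference is at most their sum in absolute value. *)
Lemma weak_derivative_bv : exists2 g : R -> R, weak_derivative I F g &
  (\int[mu]_(x in [set` I]) `|g x|%:E <= M%:E)%E.
Proof.
have [Cp [Cn [mp [mn [mpE mnE mM]]]]] := bv_measures ndI FM.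
have FNM s : sorted <%R s -> {in s, forall x, x \in I} -> gap_sum (jump (\- F)) s <= M.
  by rewrite jumpN; exact: FM.
have FNac (e : R) : 0 < e -> exists2 d : R, 0 < d &
    forall U : set R, measurable U -> (mu U < d%:E)%E ->
    forall s, sorted <%R s -> {in s, forall x, x \in I} ->
      gap_sum (weighted_jump (inside U) (\- F)) s <= e.
  by move=> /Fac; rewrite /weighted_jump jumpN.
have [hp [hp0 hpint hpT hpphi]] := radon_nikodym_density (rise_measure_dominates FM Fac mpE).
have [hn [hn0 hnint hnT hnphi]] := radon_nikodym_density (rise_measure_dominates FNM FNac mnE).
have mI : measurable [set` I] by exact: measurable_itv.
have sub : [set` I]^° `<=` [set` I] by exact: interior_subset.
have mhp : measurable_fun setT hp by apply/measurable_EFinP; exact: measurable_int hpint.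
have mhn : measurable_fun setT hn by apply/measurable_EFinP; exact: measurable_int hnint.
pose g x := hp x - hn x.
have mg : measurable_fun setT g by exact: measurable_funB.
have gM (A : set R) : measurable A -> (\int[mu]_(x in A) `|g x|%:E <= M%:E)%E.
  move=> mA; apply: le_trans mM; rewrite -hpT -hnT -integralD//.
  apply: (@le_trans _ _ (\int[mu]_x `|g x|%:E)%E).
    apply: ge0_subset_integral => //.
    by apply/measurable_EFinP; exact: measurableT_comp.
  apply: ge0_le_integral => //.
  - by apply/measurable_EFinP; exact: measurableT_comp.
  - exact: (emeasurable_funD (measurable_int mu hpint) (measurable_int mu hnint)).
  - move=> x _; rewrite -EFinD lee_fin /g (le_trans (ler_normB _ _))//.
    by rewrite !ger0_norm.
exists g; last exact: gM.
split; first exact: bv_locally_integrable FM.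
  split; first exact: measurable_funTS.
    exact: open_interior.
  move=> K KI cK; apply: le_lt_trans (ltry M); apply: gM.
  by apply: closed_measurable; exact: compact_closed.
move=> phi phiI; have [c Fc] := bv_measure_distribution FM mpE mnE.
rewrite (bv_integration_by_parts FM Fc phiI); congr (- _)%E.
have [ip <-] := hpphi _ _ phiI; have [iN <-] := hnphi _ _ phiI.
rewrite -integralB//= [RHS]integral_mkcond; apply: eq_integral => x _.
rewrite patchE; case: ifPn => [_|/negP xI]; first by rewrite -EFinB /g mulrBl.
have [|-> _] := test_function_outside phiI (x := x); last by rewrite !mulr0 subee.
by move=> /sub Ix; apply: xI; rewrite inE.
Qed.

End weak_derivative.

(** * Extended-real variation and the common statement for both maximal functions *)

Lemma variation_on_leP {R : realType} (I : interval R) (F : R -> R) (B : R) :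
  (variation_on I F <= B%:E)%E <->
  forall s, sorted <%R s -> {in s, forall x, x \in I} -> gap_sum (jump F) s <= B.
Proof.
split => [FB s ss sI|H].
  rewrite -lee_fin; apply: le_trans FB; apply: ereal_sup_ubound; exists s.
    by split => //; apply/allP.
  by rewrite partition_variationE.
apply: ge_ereal_sup => _ [s [ss /allP sI] <-].
by rewrite partition_variationE lee_fin; exact: H.
Qed.

Lemma variation_on_fin {R : realType} (I : interval R) (F : R -> R) :
  (variation_on I F < +oo)%E -> variation_on I F \is a fin_num.
Proof.
move=> Foo; rewrite ge0_fin_numE//; apply: ereal_sup_ubound.
by exists [::] => //; rewrite partition_variationE.
Qed.

Lemma maximal_regularity {R : realType} (I : interval R) (f : R -> R) (M : R)
    (rho : \bar R) (b : \bar R) : nondegenerate_itv I ->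
  (forall s, sorted <%R s -> {in s, forall x, x \in I} -> gap_sum (jump f) s <= M) ->
  (0 < rho)%E -> b \is a fin_num ->
  (forall s, sorted <%R s -> {in s, forall x, x \in I} ->
     ((gap_sum (jump (canonical_representative I f)) s)%:E <= b)%E) ->
  let F := fun x => fine (bounded_maximal I f rho x) in
  [/\ forall x, x \in I -> bounded_maximal I f rho x \is a fin_num,
      abs_continuous_on I F,
      (variation_on I F <= variation_on I (canonical_representative I f))%E
    & exists2 g : R -> R, weak_derivative I F g
    & (\int[lebesgue_measure]_(x in [set` I]) `|g x|%:E <= b)%E].
Proof.
move=> ndI fM rho0 /fineK bE fb F; set B := fine b in bE.
have cB : (variation_on I (canonical_representative I f) <= B%:E)%E.
  by apply/variation_on_leP => s ss sI; rewrite -lee_fin bE; exact: fb.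
have /variation_on_fin/fineK vE := le_lt_trans cB (ltry B).
have Fv : (variation_on I F <= variation_on I (canonical_representative I f))%E.
  rewrite -vE; apply/variation_on_leP; apply: (maximal_variation_le ndI fM rho0).
  by apply/variation_on_leP; rewrite vE.
(* The variation of [F] is bounded by [B] itself and not just by some constant: the same number
   bounds the integral of the weak derivative. *)
have /variation_on_leP FB := le_trans Fv cB.
have Fac := maximal_abs_continuous ndI fM rho0 FB.
split => //; first by move=> x xI; exact: (bounded_maximal_fin ndI fM rho0 xI).
- exact: abs_continuous_of_inside Fac.
- by have [g gF gB] := weak_derivative_bv ndI FB Fac; exists g => //; rewrite -bE.
Qed.

Unset Implicit Arguments.

Theorem theorem2p5 (R : realType) (I : interval R) (f : R -> R)
    (ndI : nondegenerate_itv I) (bvf : (variation_on I f < +oo)%E) :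
  exists (Df : {charge set (measurableTypeR R) -> \bar R}) (P N : set R)
      (DfPN : hahn_decomposition Df P N),
    [/\ distributional_derivative I f DfPN,
        (let Mf := fun x => fine (maximal_fun I f x) in
         [/\ forall x, x \in I -> maximal_fun I f x \is a fin_num,
             abs_continuous_on I Mf,
             (variation_on I Mf
                <= variation_on I (canonical_representative I f))%E
           & exists2 DMf : R -> R, weak_derivative I Mf DMf
             & (\int[lebesgue_measure]_(x in [set` I]) `|DMf x|%:E
                  <= charge_variation DfPN [set` I])%E])
      & forall r : R, 0 < r ->
        (let Mrf := fun x => fine (local_maximal_fun I r f x) in
         [/\ forall x, x \in I -> local_maximal_fun I r f x \is a fin_num,
             abs_continuous_on I Mrf,
             (variation_on I Mrf
                <= variation_on I (canonical_representative I f))%E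
           & exists2 DMrf : R -> R, weak_derivative I Mrf DMrf
             & (\int[lebesgue_measure]_(x in [set` I]) `|DMrf x|%:E
                  <= charge_variation DfPN [set` I])%E])].
Proof.
have fM : forall s, sorted <%R s -> {in s, forall x, x \in I} ->
    gap_sum (jump f) s <= fine (variation_on I f).
  by apply/variation_on_leP; rewrite fineK// variation_on_fin.
have [Df [P [N [DfPN [Dff vfin cf]]]]] := bv_distributional_derivative ndI fM.
exists Df, P, N, DfPN; split => //.
- by rewrite maximal_funE; exact: (maximal_regularity ndI fM (ltry 0) vfin cf).
- by move=> r r0; apply: (maximal_regularity (rho := r%:E) ndI fM _ vfin cf); rewrite lte_fin.
Qed.
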